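(* The Hamiltonian system $\partial_s\eta=\partial_\zeta K^{(3)}$, $\partial_s\zeta=-\partial_\eta K^{(3)}$ that defines the third-order normal form transformation has the form of the following system of two partial differential equations: $$\begin{aligned}\partial_s\eta=\partial_\zeta K^{(3)}={}&\frac12 \mathrm{H}\,\partial_x(\widetilde\eta^2)+\frac{\gamma}{2g}\Big(\zeta\,\partial_x\eta-\widetilde\eta\,\partial_x\widetilde\zeta-|D|(\zeta\widetilde\eta)\Big)\\ &+\frac{\gamma^2}{4g^2}\Big(\zeta\,\partial_x\widetilde\zeta+\frac12|D|(\zeta^2)\Big)+\frac{\gamma^2}{4g}\Big(-(\partial_x^{-1}\eta)(\partial_x\eta)+\mathrm{H}(\eta\widetilde\eta)+|D|(\widetilde\eta\,\partial_x^{-1}\eta)\Big)\\ &-\frac{\gamma^3}{8g^2}\Big(\zeta\widetilde\eta+(\partial_x\widetilde\zeta)(\partial_x^{-1}\eta)+|D|(\zeta\,\partial_x^{-1}\eta)\Big)+\frac{\gamma^4}{16g^2}\Big(\mathrm{H}(\eta\,\partial_x^{-1}\eta)+\widetilde\eta\,\partial_x^{-1}\eta\Big),\end{aligned}$$ $$\begin{aligned}\partial_s\zeta=-\partial_\eta K^{(3)}={}&\mathrm{H}(\widetilde\eta\,\partial_x\widetilde\zeta)+\frac{\gamma}{2}\Big(\eta\widetilde\eta-\frac12\mathrm{H}(\eta^2)\Big)+\frac{\gamma}{2g}\Big(\zeta\,\partial_x\zeta-\mathrm{H}(\zeta\,\partial_x\widetilde\zeta)\Big)\\ &-\frac{\gamma^2}{4g}\Big(\partial_x(\zeta\,\partial_x^{-1}\eta)+\partial_x^{-1}(\zeta\,\partial_x\eta)-\widetilde\zeta\widetilde\eta+\mathrm{H}(\eta\widetilde\zeta)-\mathrm{H}\big((\partial_x\widetilde\zeta)(\partial_x^{-1}\eta)\big)-\partial_x^{-1}\big((\partial_x\widetilde\zeta)\widetilde\eta\big)\Big)\\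 &+\frac{\gamma^3}{8g}\Big(\partial_x^{-1}\big((\partial_x\widetilde\eta)(\partial_x^{-1}\widetilde\eta)\big)-|D|\big((\partial_x^{-1}\eta)(\partial_x^{-1}\widetilde\eta)\big)+|D|^{-1}\big((\partial_x\widetilde\eta)(\partial_x^{-1}\eta)\big)\Big)\\ &-\frac{\gamma^3}{16g^2}\Big(\mathrm{H}(\zeta^2)+2\,\partial_x^{-1}(\zeta\,\partial_x\widetilde\zeta)\Big)\\ &+\frac{\gamma^4}{16g^2}\Big(\widetilde\zeta\,\partial_x^{-1}\eta-\partial_x^{-1}(\eta\widetilde\zeta)+\mathrm{H}(\zeta\,\partial_x^{-1}\eta)+\partial_x^{-1}(\zeta\widetilde\eta)\Big)\\ &-\frac{\gamma^5}{64g^2}\Big(\mathrm{H}\big((\partial_x^{-1}\eta)^2\big)+2\,\partial_x^{-1}(\widetilde\eta\,\partial_x^{-1}\eta)\Big).\end{aligned}$$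
   Context: Fix $g>0$ and $\gamma\in\mathbb{R}$. $\eta(x),\zeta(x)$ are real-valued functions on $\mathbb{R}$, smooth and decaying, with the Fourier transform of $\eta$ satisfying $\eta_0=0$, $\eta_k=O(k)$ as $k\to0$. $D=-i\partial_x$, $|D|$ is the Fourier multiplier with symbol $|k|$, $\partial_x^{-1}$ the one with symbol $1/(ik)$, $|D|^{-1}$ the one with symbol $1/|k|$, and $\mathrm{H}=-i\,\mathrm{sgn}(D)$ is the Hilbert transform. Write $\widetilde\eta=\mathrm{H}\eta$, $\widetilde\zeta=\mathrm{H}\zeta$. $\partial_\eta,\partial_\zeta$ denote variational derivatives (with respect to the $L^2(dx)$ pairing). $K^{(3)}$ is the auxiliary Hamiltonian generating the third-order Birkhoff normal form transformation that removes all cubic terms from the deep-water constant-vorticity water wave Hamiltonian; in physical space it is $$\begin{aligned}K^{(3)}=\int\Big[&\frac12\widetilde\eta^2\partial_x\widetilde\zeta-\frac{\gamma}{4g}\big(g\eta^2\widetilde\eta-\zeta^2\partial_x\eta+2\zeta\widetilde\eta\,\partial_x\widetilde\zeta\big)\\ &-\frac{\gamma^2}{4g^2}\Big(g(\partial_x^{-1}\eta)(\partial_x\eta)\zeta+g\eta\widetilde\eta\widetilde\zeta-g\widetilde\eta(\partial_x\widetilde\zeta)\partial_x^{-1}\eta-\frac12\zeta^2\partial_x\widetilde\zeta\Big)\\ &-\frac{\gamma^3}{16g^2}\Big(\zeta^2\widetilde\eta+2\zeta(\partial_x\widetilde\zeta)\partial_x^{-1}\eta-2g(\partial_x^{-1}\eta)(\partial_x\widetilde\eta)(\partial_x^{-1}\widetilde\eta)\Big)\\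 &-\frac{\gamma^4}{16g^2}(\eta\widetilde\zeta-\widetilde\eta\zeta)\partial_x^{-1}\eta-\frac{\gamma^5}{64g^2}\widetilde\eta(\partial_x^{-1}\eta)^2\Big]dx.\end{aligned}$$ *)

(* Defs.v *)
From HB Require Import structures.
From mathcomp Require Import all_boot all_order all_algebra.
From mathcomp Require Import complex.
From mathcomp Require Import all_classical all_reals all_analysis.

Set Implicit Arguments.
Unset Strict Implicit.
Unset Printing Implicit Defensive.

Import Order.TTheory GRing.Theory Num.Theory.
Import numFieldNormedType.Exports.

Local Open Scope classical_set_scope.
Local Open Scope ring_scope.

(* Functions R -> R are manipulated through their pointwise ring and R-module
   structure: f * g, f ^+ 2, a *: f are pointwise operations. *)

Section FourierMultipliers.
Variable R : realType.
Implicit Types (f : R -> R) (m : R -> R[i]).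

Definition cintegral (A : set R) (F : R -> R[i]) : R[i] :=
  ((Rintegral lebesgue_measure A (fun x => complex.Re (F x))) +i*
   (Rintegral lebesgue_measure A (fun x => complex.Im (F x))))%C.

Definition cis (t : R) : R[i] := (cos t +i* sin t)%C.

(* f_k = (2 pi)^(-1/2) \int f(x) exp(- i k x) dx *)
Definition fourier f (k : R) : R[i] :=
  ((Num.sqrt (2 * pi))^-1)%:C%C *
    cintegral setT (fun x => (f x)%:C%C * cis (- (k * x))).

(* m(D) f, with D = - i d/dx, is
     (2 pi)^(-1/2) p.v. \int m(k) f_k exp(i k x) dk,
   the integral being a principal value at k = 0: this changes nothing for the
   symbols - i sgn(k) and |k|, and gives its meaning to the operator of symbol
   1/(ik) on a function g with g_0 <> 0.  All the symbols below satisfy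
   m(-k) = conj(m(k)), so that the integral is real for a real f; Re only
   serves to land in R. *)
Definition fmult m f (x : R) : R :=
  lim ((fun e : R => complex.Re (((Num.sqrt (2 * pi))^-1)%:C%C *
         cintegral [set k : R | e < `|k|]
           (fun k => m k * fourier f k * cis (k * x)))) @ 0^'+).

Definition hilbert : (R -> R) -> R -> R :=
  fmult (fun k => - 'i%C * (Num.sg k)%:C%C).
Definition absD : (R -> R) -> R -> R := fmult (fun k => `|k|%:C%C).
Definition absDinv : (R -> R) -> R -> R := fmult (fun k => (`|k|%:C%C)^-1).
Definition dxinv : (R -> R) -> R -> R := fmult (fun k => ('i%C * k%:C%C)^-1).
Definition dx f : R -> R := derive1 f.

End FourierMultipliers.

Section PhaseSpace.
Variable R : realType.
Implicit Types f eta zeta : R -> R.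

Definition schwartz f : Prop :=
  (forall (n : nat) (x : R), derivable (derive1n n f) x 1) /\
  (forall m n : nat, exists C : R, forall x : R, `|x ^+ m * derive1n n f x| <= C).

Definition zeta_space : set (R -> R) := [set zeta | schwartz zeta].

Definition eta_space : set (R -> R) := [set eta |
  [/\ schwartz eta,
      fourier eta 0 = 0 &
      exists C : R,
        \forall k \near (0 : R), ComplexField.Normc.normc (fourier eta k) <= C * `|k|]].

(* G represents, for the L^2(dx) pairing, the differential at f of the
   functional J along the directions in T. *)
Definition is_variational_derivative (T : set (R -> R)) (J : (R -> R) -> R)
    (f G : R -> R) : Prop :=
  continuous G /\
  forall phi : R -> R, T phi ->
    lebesgue_measure.-integrable setT (fun x => (G x * phi x)%:E) /\
    is_derive (0 : R) (1 : R) (fun e : R => J (f + e *: phi))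
      (Rintegral lebesgue_measure setT (fun x => G x * phi x)).

(* (V, W) = (d_zeta K, - d_eta K) at (eta, zeta).  The variations of eta have
   zero mean, so that the pairing alone determines d_eta K only up to an
   additive constant; the last clause selects the representative without zero
   mode, in the principal value sense used for the multiplier 1/(ik). *)
Definition is_hamiltonian_vector_field (K : (R -> R) -> (R -> R) -> R)
    (eta zeta V W : R -> R) : Prop :=
  [/\ is_variational_derivative zeta_space (fun z => K eta z) zeta V,
      is_variational_derivative eta_space (fun h => K h zeta) eta (- W) &
      (W x + W (- x)) @[x --> +oo] --> (0 : R)].

Definition K3 (g gamma : R) (eta zeta : R -> R) : R :=
  let eta' := hilbert eta in
  let zeta' := hilbert zeta in
  Rintegral lebesgue_measure setT
   (2^-1 *: (eta' ^+ 2 * dx zeta')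
    - (gamma / (4 * g)) *:
        (g *: (eta ^+ 2 * eta') - zeta ^+ 2 * dx eta
         + 2 *: (zeta * eta' * dx zeta'))
    - (gamma ^+ 2 / (4 * g ^+ 2)) *:
        (g *: (dxinv eta * dx eta * zeta) + g *: (eta * eta' * zeta')
         - g *: (eta' * dx zeta' * dxinv eta) - 2^-1 *: (zeta ^+ 2 * dx zeta'))
    - (gamma ^+ 3 / (16 * g ^+ 2)) *:
        (zeta ^+ 2 * eta' + 2 *: (zeta * dx zeta' * dxinv eta)
         - (2 * g) *: (dxinv eta * dx eta' * dxinv eta'))
    - (gamma ^+ 4 / (16 * g ^+ 2)) *:
        ((eta * zeta' - eta' * zeta) * dxinv eta)
    - (gamma ^+ 5 / (64 * g ^+ 2)) *: (eta' * dxinv eta ^+ 2)).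

End PhaseSpace.

(* Main.v *)
Require Import Defs.
From HB Require Import structures.
From mathcomp Require Import all_boot all_order all_algebra.
From mathcomp Require Import complex.
From mathcomp Require Import all_classical all_reals all_analysis.
From mathcomp Require Import measurable_realfun ring lra.

Set Implicit Arguments.
Unset Strict Implicit.
Unset Printing Implicit Defensive.

Import Order.TTheory GRing.Theory Num.Theory.
Import numFieldNormedType.Exports.

Local Open Scope classical_set_scope.
Local Open Scope ring_scope.

(** Why the theorem is true.  Every term of K3 is an integral of a product of
    three factors, each of them obtained from eta or zeta by composing H, d/dx
    and d^-1.  Along a line eta + e phi or
    zeta + e psi the density is therefore a cubic polynomial in e, and the
    derivative of K3 at e = 0 is the integral of its first-order coefficient.
    The gradient appears once the operators have been moved from the variation
    to the other two factors: H and d^-1 are antisymmetric for the L^2 pairing,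
    |D| = H d/dx and H d^-1 = - |D|^-1 are symmetric.  Concretely, the
    first-order coefficient is the product of the claimed gradient with the
    variation plus a combination of functions of zero integral such as
    H(phi) F + phi H(F); given these, what remains is an identity between
    rational expressions (density_zeta_adjoint, density_eta_adjoint).

    The analysis consists in giving a meaning to all this for operators that
    are defined as principal values of Fourier integrals.  Three facts carry
    it.

    - Fourier inversion (fourier_inversion), by Abel summation: the factor
      exp(- e |k|) turns the inversion integral into a Poisson integral.

    - Decay.  A function in dec a is smooth, and is O((1 + |x|)^-a) with all
      its derivatives.  H maps dec 2 to dec 0 and commutes with d/dx, and
      x H(f) = H(x f) + (integral of f) / pi (mulx_hilbert), so that each
      vanishing moment of f gains one power of decay of H(f).  Since eta has
      zero mean, eta = p' with p rapidly decreasing, whence H(eta) = H(p)' is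
      O(x^-2) while H(p) and H(zeta) are only O(x^-1).

    - Inverse derivatives.  On derivatives, d^-1 and |D|^-1 are given by
      d^-1 q' = q and |D|^-1 q' = - H(q), directly by inversion.  The factor
      d^-1 H(eta) of K3 is H(p), but H(p) does not decay enough for this
      argument; there the Fourier transform of H(p') is computed instead
      (dxinv_hilbert_derive1).  The products under d^-1 in the gradient need
      not have zero mean: for those, d^-1 F is an antiderivative of F, and
      d^-1 F (x) + d^-1 F (- x) tends to 0 (dxinv_sym_cvg0), which is what
      fixes the additive constant of the gradient in eta. *)

Local Notation "f ^'" := (derive1 f) : ring_scope.

(** * Integration on the real line *)

Section Integration.
Variable R : realType.
Implicit Types (f g h : R -> R).
Local Notation mu := (@lebesgue_measure R).

Definition intR f : R := Rintegral mu setT f.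
Definition integrableR f : Prop := mu.-integrable setT (EFin \o f).

Lemma integrableR_measurable f : integrableR f -> measurable_fun setT f.
Proof. by move=> /integrableP[/measurable_EFinP]. Qed.

Lemma integrableR_on (A : set R) f : measurable A -> integrableR f ->
  mu.-integrable A (EFin \o f).
Proof. by move=> mA; apply: integrableS => //; exact: subsetT. Qed.

Lemma integrableR_le f g : measurable_fun setT f -> integrableR g ->
  (forall x, `|f x| <= g x) -> integrableR f.
Proof.
move=> mf sg fg; apply: le_integrable sg => //; first exact/measurable_EFinP.
move=> x _ /=; rewrite lee_fin (le_trans (fg x))//; exact: ler_norm.
Qed.

Lemma integrableR_norm f : integrableR f -> integrableR (fun x => `|f x|).
Proof. exact: integrable_norm. Qed.

Lemma integrableRD f g : integrableR f -> integrableR g -> integrableR (f + g).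
Proof. by move=> sf sg; apply: (integrableD measurableT sf sg). Qed.

Lemma integrableRZ c f : integrableR f -> integrableR (c *: f).
Proof. by move=> sf; apply: (integrableZl measurableT c sf). Qed.

Lemma integrableRN f : integrableR f -> integrableR (- f).
Proof. by move=> sf; rewrite -scaleN1r; exact: integrableRZ. Qed.

Lemma intRD f g : integrableR f -> integrableR g ->
  intR (f + g) = intR f + intR g.
Proof. by move=> sf sg; apply: RintegralD. Qed.

Lemma intRZ c f : integrableR f -> intR (c *: f) = c * intR f.
Proof. by move=> sf; apply: RintegralZl. Qed.

Lemma intRN f : integrableR f -> intR (- f) = - intR f.
Proof. by move=> sf; rewrite -scaleN1r intRZ// mulN1r. Qed.

Lemma normr_intR_le f g : integrableR f -> integrableR g ->
  (forall x, `|f x| <= g x) -> `|intR f| <= intR g.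
Proof.
move=> sf sg fg; apply: le_trans (le_normr_Rintegral _ _) _ => //.
apply: le_Rintegral => //.
exact: integrable_norm.
Qed.

Lemma intR_dominated_cvg (f_ : nat -> R -> R) f g :
  (forall n, measurable_fun setT (f_ n)) -> integrableR g ->
  (forall n x, `|f_ n x| <= g x) ->
  (forall x, f_ n x @[n --> \oo] --> f x) ->
  intR (f_ n) @[n --> \oo] --> intR f.
Proof.
move=> mf sg fg ff.
have mlim : measurable_fun setT f by apply: measurable_fun_cvg mf _ => x _; exact: ff.
have [] := @dominated_convergence _ _ _ mu setT measurableT
  (fun n x => (f_ n x)%:E) (EFin \o f) (EFin \o g).
- by move=> n; apply/measurable_EFinP; exact: mf.
- by apply/measurable_EFinP; exact: mlim.
- by apply: aeW => x _; apply: cvg_EFin; [exact: nearW|exact: ff].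
- exact: sg.
- by apply: aeW => x n _; rewrite lee_fin.
move=> sf _ lim; apply: fine_cvg; rewrite fineK//.
exact: integrable_fin_num.
Qed.

Lemma intR_restrict_cvg (A : nat -> set R) f :
  (forall n, measurable (A n)) -> integrableR f ->
  (forall x, f \_ (A n) x @[n --> \oo] --> f x) ->
  Rintegral mu (A n) f @[n --> \oo] --> intR f.
Proof.
move=> mA sf lim.
under eq_fun do rewrite Rintegral_mkcond.
apply: (@intR_dominated_cvg (fun n => f \_ (A n)) f (fun x => `|f x|)) => //.
- move=> n; apply/(measurable_restrictT _ (mA n)).
  exact: measurable_funTS (integrableR_measurable sf).
- exact: integrable_norm.
- by move=> n x; rewrite patchE; case: ifP => // _; rewrite normr0.
Qed.

Lemma intR_itv_cvg f : integrableR f ->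
  Rintegral mu `[(- n%:R), n%:R] f @[n --> \oo] --> intR f.
Proof.
move=> sf; apply: intR_restrict_cvg => // x.
apply: cvg_near_cst; near=> n.
rewrite patchE mem_set//= in_itv/=.
by rewrite -ler_norml ltW//; near: n; exact: nbhs_infty_gtr.
Unshelve. all: by end_near. Qed.

Lemma Rintegral_FTC (F f : R -> R) (a b : R) : a <= b ->
  (forall x : R, is_derive x 1 F (f x)) -> continuous f ->
  Rintegral mu `[a, b] f = F b - F a.
Proof.
move=> ab dF cf.
have cF : continuous F.
  by move=> x; apply/differentiable_continuous/derivable1_diffP; apply: (@ex_derive _ _ _ _ _ _ _ (dF x)).
move: ab; rewrite le_eqVlt => /predU1P[<-|ab].
  by rewrite set_itv1 Rintegral_set1 subrr.
rewrite /Rintegral (@continuous_FTC2 _ f F)//.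
- exact: continuous_subspaceT.
- split.
  + by move=> x _; apply: (@ex_derive _ _ _ _ _ _ _ (dF x)).
  + exact: cvg_at_right_filter (cF a).
  + exact: cvg_at_left_filter (cF b).
- by move=> x _; rewrite derive1E; apply: derive_val.
Qed.

Lemma intR_FTC (F f : R -> R) (l r : R) :
  (forall x : R, is_derive x 1 F (f x)) -> continuous f -> integrableR f ->
  F n%:R @[n --> \oo] --> r -> F (- n%:R) @[n --> \oo] --> l ->
  intR f = r - l.
Proof.
move=> dF cf sf Fr Fl; apply: cvg_unique (intR_itv_cvg sf) _ => //.
rewrite (_ : (fun n => _) = fun n => F n%:R - F (- n%:R)); last first.
  apply/funext => n; apply: Rintegral_FTC => //.
  by rewrite -subr_ge0 opprK.
exact: cvgB.
Qed.

(** The symbols sgn k and |k| are smooth only on each side of the origin, so the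
    fundamental theorem is needed with one antiderivative per half-line. *)
Lemma intR_FTC2 (F1 F2 f1 f2 f : R -> R) (l r : R) :
  (forall x : R, is_derive x 1 F1 (f1 x)) -> continuous f1 ->
  (forall x : R, is_derive x 1 F2 (f2 x)) -> continuous f2 ->
  (forall x, 0 < x -> f x = f1 x) -> (forall x, x < 0 -> f x = f2 x) ->
  integrableR f ->
  F1 n%:R @[n --> \oo] --> r -> F2 (- n%:R) @[n --> \oo] --> l ->
  intR f = (r - F1 0) + (F2 0 - l).
Proof.
move=> dF1 cf1 dF2 cf2 ff1 ff2 sf F1r F2l.
apply: cvg_unique (intR_itv_cvg sf) _ => //.
rewrite (_ : (fun n => _) = fun n => (F1 n%:R - F1 0) + (F2 0 - F2 (- n%:R))); last first.
  apply/funext => n.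
  have cint (h : R -> R) a b : continuous h -> mu.-integrable `[a, b] (EFin \o h).
    move=> ch; apply: continuous_compact_integrable; first exact: segment_compact.
    exact: continuous_subspaceT.
  have /(@Rintegral_itvB _ f (BLeft (- n%:R)) (BRight n%:R) 0) : mu.-integrable `[- n%:R, n%:R] (EFin \o f).
    exact: integrableR_on.
  rewrite !bnd_simp oppr_le0 ler0n => /(_ isT isT)/eqP.
  rewrite subr_eq addrC => /eqP ->.
  rewrite addrC; congr (_ + _).
    rewrite -(Rintegral_FTC _ dF1 cf1)//.
    rewrite -(Rintegral_itv_obnd_cbnd (f:=f1)); last first.
      by apply: (integrableS _ _ _ (cint _ 0 n%:R cf1)) => //; exact: subset_itv_oc_cc.
    by apply: eq_Rintegral => x; rewrite inE/= in_itv/= => /andP[x0 _]; rewrite ff1.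
  rewrite -(Rintegral_FTC _ dF2 cf2) ?oppr_le0//.
  rewrite -!Rintegral_itv_bndo_bndc.
  - by apply: eq_Rintegral => x; rewrite inE/= in_itv/= => /andP[_ x0]; rewrite ff2.
  - exact: integrableR_on.
  - by apply: (integrableS _ _ _ (cint _ (- n%:R) 0 cf2)) => //; exact: subset_itv_co_cc.
by apply: cvgD; apply: cvgB => //; exact: cvg_cst.
Qed.

(** The common majorant of everything integrated below. *)
Definition cauchy_weight (x : R) : R := (1 + x ^+ 2)^-1.

Lemma cauchy_weight_gt0 x : 0 < cauchy_weight x.
Proof. by rewrite invr_gt0 ltr_wpDr// sqr_ge0. Qed.

Lemma continuous_cauchy_weight : continuous cauchy_weight.
Proof. by move=> x; exact: continuous_oneDsqrV. Qed.

Lemma intR_cauchy_weightE : (\int[mu]_x (cauchy_weight x)%:E = pi%:E)%E.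
Proof.
rewrite ge0_symfun_integralT; last 3 first.
- by move=> x; exact/ltW/cauchy_weight_gt0.
- exact: continuous_cauchy_weight.
- by move=> x; rewrite /cauchy_weight /= sqrrN.
by rewrite -set_itvcy integral0y_oneDsqr -EFinM mulrC divfK.
Qed.

Lemma integrableR_cauchy_weight : integrableR cauchy_weight.
Proof.
apply/integrableP; split.
  by apply/measurable_EFinP; exact: continuous_measurable_fun continuous_cauchy_weight.
apply: le_lt_trans (ltry pi); rewrite -intR_cauchy_weightE le_eqVlt.
apply/orP; left; apply/eqP; apply: eq_integral => x _ /=.
by rewrite ger0_norm// ltW// cauchy_weight_gt0.
Qed.

Lemma intR_cauchy_weight : intR cauchy_weight = pi.
Proof. by rewrite /intR /Rintegral intR_cauchy_weightE. Qed.

Lemma measurable_away (e : R) : measurable [set k : R | e < `|k|].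
Proof.
rewrite (_ : [set k | _] = (fun k : R => `|k|) @^-1` `]e, +oo[); last first.
  by apply/seteqP; split => x /=; rewrite in_itv/= andbT.
by rewrite -[X in measurable X]setTI; exact: normr_measurable.
Qed.

(** For an integrable function the principal value at 0 is the integral, by
    dominated convergence; all the multipliers reduce to this case. *)
Lemma Rintegral_away_cvg f : integrableR f ->
  Rintegral mu [set k | e < `|k|] f @[e --> 0^'+] --> intR f.
Proof.
move=> sf; apply/cvg_at_rightP => u [u0 ucvg].
pose f0 := f \_ (~` [set (0 : R)]).
have mC : measurable (~` [set (0 : R)]) by exact: measurableC.
have sf0 : integrableR f0.
  apply: integrableR_le (integrableR_norm sf) _ => [|x].
    by apply/(measurable_restrictT _ mC); exact: measurable_funTS (integrableR_measurable sf).
  by rewrite /f0 patchE; case: ifP => // _; rewrite normr0.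
have -> : intR f = intR f0.
  rewrite /intR -Rintegral_mkcond -(setvU [set (0 : R)]) Rintegral_setU//.
  - by rewrite Rintegral_set1 addr0.
  - by rewrite setvU.
  - exact/disj_setPCr.
rewrite (_ : (fun n => _) = fun n => Rintegral mu [set k | u n < `|k|] f0); last first.
  apply/funext => n; apply: eq_Rintegral => k; rewrite inE/= => uk.
  rewrite mem_set//= => k0; move: uk; rewrite k0 normr0 => /(lt_trans (u0 n)).
  by rewrite ltxx.
apply: intR_restrict_cvg => // [n|x]; first exact: measurable_away.
apply: cvg_near_cst.
have [->|x0] := eqVneq x 0.
  near=> n; rewrite patchE; case: ifP => // _.
  by rewrite /f0 patchE memNset// => /(_ erefl).
have : \forall n \near \oo, u n < `|x|.
  move/cvgrPdist_lt : ucvg => /(_ `|x|); rewrite normr_gt0 => /(_ x0).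
  by apply: filterS => n; rewrite sub0r normrN ger0_norm// ltW.
by apply: filterS => n ux; rewrite patchE mem_set.
Unshelve. all: by end_near. Qed.

(** A majorant of product form makes both iterated integrals absolutely convergent
    by Tonelli. *)
Lemma intR_Fubini (h : R -> R -> R) a b :
  measurable_fun [set: measurableTypeR R * measurableTypeR R] (fun z => h z.1 z.2) ->
  integrableR a -> integrableR b -> (forall x y, `|h x y| <= a x * b y) ->
  intR (fun x => intR (h x)) = intR (fun y => intR (h ^~ y)).
Proof.
move=> mh sa sb hab.
have mhx x : measurable_fun setT (h x) by exact: (measurable_fun_pair2 x mh).
have mhy y : measurable_fun setT (h ^~ y) by exact: (measurable_fun_pair1 y mh).
have shx x : integrableR (h x).
  by apply: integrableR_le (integrableRZ (a x) sb) _ => // y; exact: hab.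
have shy y : integrableR (h ^~ y).
  by apply: integrableR_le (integrableRZ (b y) sa) _ => // x; have := hab x y; rewrite mulrC.
have E1 x : (intR (h x))%:E = (\int[mu]_y (h x y)%:E)%E.
  by rewrite /intR /Rintegral fineK//; apply: integrable_fin_num => //; exact: shx.
have E2 y : (intR (h ^~ y))%:E = (\int[mu]_x (h x y)%:E)%E.
  by rewrite /intR /Rintegral fineK//; apply: integrable_fin_num => //; exact: shy.
rewrite /intR {1}/Rintegral [in RHS]/Rintegral.
under eq_integral do rewrite E1.
under [in RHS]eq_integral do rewrite E2.
congr fine.
apply: (@Fubini _ _ (measurableTypeR R) (measurableTypeR R) R mu mu (fun z => (h z.1 z.2)%:E)).
apply/integrable12ltyP; first exact/measurable_EFinP.
pose B := intR (fun y => `|b y|).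
have sB : integrableR (B *: (fun x => `|a x|)) by apply: integrableRZ; exact: integrableR_norm.
apply: le_lt_trans (integrable_lty measurableT sB) => /=.
apply: ge0_le_integral => //.
- by move=> x _; exact: integral_ge0.
- have := @measurable_fun_fubini_tonelli_F _ _ (measurableTypeR R)
    (measurableTypeR R) R mu (fun z => `|(h z.1 z.2)%:E|%E); apply => //.
  by apply: measurableT_comp => //; exact/measurable_EFinP.
- exact: (measurable_int mu sB).
move=> x _.
have sbx := integrableRZ `|a x| (integrableR_norm sb).
have -> : (((B *: (fun x => `|a x|)) x)%:E = \int[mu]_y ((`|a x| *: (fun y => `|b y|)) y)%:E)%E.
  have -> : (B *: (fun x => `|a x|)) x = intR (`|a x| *: (fun y => `|b y|)).
    rewrite intRZ; last exact: integrableR_norm.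
    exact: (mulrC B `|a x|).
  by rewrite /intR /Rintegral fineK//; apply: integrable_fin_num => //; exact: sbx.
apply: ge0_le_integral => //.
- apply: (@measurableT_comp _ _ _ _ _ _ abse _ (EFin \o h x)) => //.
  by apply/measurable_EFinP; exact: mhx.
- exact: (measurable_int mu sbx).
move=> y _; rewrite lee_fin; apply: le_trans (hab x y) _.
by apply: le_trans (ler_norm _) _; rewrite normrM.
Qed.

Lemma is_derive_intR (f f' : R -> R -> R) (G : R -> R) (a : R) :
  (forall x y : R, is_derive x 1 (f ^~ y) (f' x y)) ->
  (forall x, integrableR (f x)) -> integrableR G ->
  (forall x y, `|f' x y| <= G y) ->
  is_derive a 1 (fun x => intR (f x)) (intR (f' a)).
Proof.
move=> df sf sG fG.
have d1E x y : partial1of2 f x y = f' x y.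
  by rewrite partial1of2E; apply: derive_val.
have G0 y : 0 <= G y by exact: le_trans (fG a y).
have Ia : `]a - 1, a + 1[%classic a by rewrite /= in_itv/= ltrBlDr ltrDl ltr01.
have dd x y : `]a - 1, a + 1[%classic x -> setT y -> derivable (f^~ y) x 1.
  by move=> _ _; apply: (@ex_derive _ _ _ _ _ _ _ (df x y)).
have GG x y : `]a - 1, a + 1[%classic x -> setT y -> `|partial1of2 f x y| <= G y.
  by move=> _ _; rewrite d1E.
apply: DeriveDef.
  apply: (@derivable_under_integral _ _ _ mu f setT measurableT a (a - 1) (a + 1) Ia _ dd G G0 sG GG).
  by move=> x _; exact: sf.
rewrite -derive1E.
rewrite (@differentiation_under_integral _ _ _ mu f setT measurableT a (a - 1) (a + 1) Ia _ dd G G0 sG GG).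
  by apply: eq_Rintegral => y _; exact: d1E.
by move=> x _; exact: sf.
Qed.

Lemma intR_reflect f : continuous f -> integrableR f ->
  integrableR (fun x => f (- x)) -> intR (fun x => f (- x)) = intR f.
Proof.
move=> cf sf sf'; apply: cvg_unique (intR_itv_cvg sf') _ => //.
rewrite (_ : (fun n => _) = fun n => Rintegral mu `[(- n%:R), n%:R] f).
  exact: intR_itv_cvg.
apply/funext => n; rewrite /Rintegral; congr fine.
have := @integration_by_substitution_oppr R f (- n%:R) n%:R.
rewrite opprK => <- //; first by rewrite -subr_ge0 opprK.
exact: continuous_subspaceT.
Qed.

End Integration.

(** * Smooth functions with polynomial decay *)

Section Decay.
Variable R : realType.
Implicit Types (f g h : R -> R) (a b n : nat) (x : R).
Local Notation mu := (@lebesgue_measure R).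

Definition decay a f : Prop := exists C, forall x, `|f x| * (1 + `|x|) ^+ a <= C.

Fixpoint Cdec n a f : Prop :=
  [/\ continuous f, decay a f &
      if n is m.+1 then (forall x, derivable f x 1) /\ Cdec m a f^' else True].

(** The analogue of a symbol class: unlike in the definition of symbols, derivatives
    are not required to decay faster than the function.  This makes the class stable
    under products and under the Hilbert transform. *)
Definition dec a f : Prop := forall n, Cdec n a f.

Definition rapid f : Prop := forall a, dec a f.

Lemma one_norm_ge1 x : 1 <= 1 + `|x|.
Proof. by rewrite lerDl. Qed.

Lemma dec_decay a f : dec a f -> decay a f.
Proof. by move=> /(_ 0%N) []. Qed.

Lemma dec_continuous a f : dec a f -> continuous f.
Proof. by move=> /(_ 0%N) []. Qed.

Lemma dec_derivable a f : dec a f -> forall x, derivable f x 1.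
Proof. by move=> /(_ 1%N) [_ _ []]. Qed.

Lemma dec_derive1 a f : dec a f -> dec a f^'.
Proof. by move=> df n; have [_ _ []] := df n.+1. Qed.

Lemma dec_is_derive a f : dec a f -> forall x, is_derive x 1 f (f^' x).
Proof.
by move=> df x; rewrite derive1E; apply: DeriveDef => //; exact: dec_derivable df _.
Qed.

Lemma dec_intro a f : (forall x, derivable f x 1) -> decay a f ->
  dec a f^' -> dec a f.
Proof.
move=> df fa df'; have cf : continuous f.
  by move=> x; exact/differentiable_continuous/derivable1_diffP.
by move=> [|n]; split.
Qed.

Lemma is_derive_derive1 f (f' : R -> R) : (forall x, is_derive x 1 f (f' x)) -> f^' = f'.
Proof. by move=> df; apply/funext => x; rewrite derive1E; apply: derive_val. Qed.

Lemma dec_intro_is_derive a f (f' : R -> R) : (forall x, is_derive x 1 f (f' x)) ->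
  decay a f -> dec a f' -> dec a f.
Proof.
move=> df fa df'; apply: dec_intro => //.
by rewrite (is_derive_derive1 df).
Qed.

Lemma decayS a b f : (a <= b)%N -> decay b f -> decay a f.
Proof.
move=> ab [C fC]; exists C => x; apply: le_trans (fC x).
by rewrite ler_wpM2l// ler_weXn2l// one_norm_ge1.
Qed.

Lemma decS a b f : (a <= b)%N -> dec b f -> dec a f.
Proof.
move=> ab + n; elim: n f => [|n IHn] f df.
  by split; [exact: dec_continuous df|exact: decayS ab (dec_decay df)|].
split; [exact: dec_continuous df|exact: decayS ab (dec_decay df)|].
by split; [exact: dec_derivable df|apply: IHn; exact: dec_derive1].
Qed.

Lemma decayD a f g : decay a f -> decay a g -> decay a (f + g).
Proof.
move=> [C fC] [D gD]; exists (C + D) => x.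
by apply: le_trans (lerD (fC x) (gD x)); rewrite -mulrDl ler_wpM2r// ?ler_normD// exprn_ge0// addr_ge0.
Qed.

Lemma decayM a b f g : decay a f -> decay b g -> decay (a + b) (f * g).
Proof.
move=> [C fC] [D gD]; exists (C * D) => x.
rewrite [(f * g) x]/(f x * g x) normrM exprD mulrACA.
by rewrite ler_pM// mulr_ge0// exprn_ge0// addr_ge0.
Qed.

Lemma decay_cst c : decay 0 (cst c).
Proof. by exists `|c| => x; rewrite expr0 mulr1. Qed.

Lemma derive1D f g : (forall x, derivable f x 1) -> (forall x, derivable g x 1) ->
  (f + g)^' = f^' + g^'.
Proof. by move=> df dg; apply/funext => x; rewrite [RHS]/(f^' x + g^' x) !derive1E deriveD. Qed.

Lemma derive1M f g : (forall x, derivable f x 1) -> (forall x, derivable g x 1) ->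
  (f * g)^' = f^' * g + f * g^'.
Proof.
move=> df dg; apply/funext => x; rewrite !derive1E deriveM//.
rewrite [RHS]/(f^' x * g x + f x * g^' x) !derive1E.
by rewrite addrC [X in X + _]mulrC.
Qed.

Lemma CdecD n a f g : Cdec n a f -> Cdec n a g -> Cdec n a (f + g).
Proof.
elim: n f g => [|n IHn] f g [cf fa f'] [cg ga g'].
  by split => //; [move=> x; exact: cvgD (cf x) (cg x)|exact: decayD].
case: f' => df f'; case: g' => dg g'; split.
- by move=> x; exact: cvgD (cf x) (cg x).
- exact: decayD.
- split; first by move=> x; exact: derivableD.
  by rewrite derive1D//; exact: IHn.
Qed.

Lemma decD a f g : dec a f -> dec a g -> dec a (f + g).
Proof. by move=> df dg n; exact: CdecD. Qed.

Lemma Cdec_pred n a f : Cdec n.+1 a f -> Cdec n a f.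
Proof. by elim: n f => [|n IHn] f [cf fa [df f']]; split => //; split => //; exact: IHn. Qed.

Lemma CdecM n a b f g : Cdec n a f -> Cdec n b g -> Cdec n (a + b) (f * g).
Proof.
elim: n f g => [|n IHn] f g Cf Cg; case: (Cf) => cf fa f'; case: (Cg) => cg gb g'.
  by split => //; [move=> x; exact: cvgM (cf x) (cg x)|exact: decayM].
case: f' => df f'; case: g' => dg g'; split.
- by move=> x; exact: cvgM (cf x) (cg x).
- exact: decayM.
- split; first by move=> x; exact: derivableM.
  by rewrite derive1M//; apply: CdecD; apply: IHn => //; exact: Cdec_pred.
Qed.

Lemma decM a b f g : dec a f -> dec b g -> dec (a + b) (f * g).
Proof. by move=> df dg n; exact: CdecM. Qed.

Lemma derive1_cstE c : (cst c : R -> R)^' = cst 0.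
Proof. by apply/funext => x; rewrite derive1_cst. Qed.

Lemma dec0 a : dec a (cst 0).
Proof.
move=> n; elim: n => [|n IHn]; split => //; try by [move=> x; exact: cvg_cst|exists 0 => x; rewrite normr0 mul0r].
by split => //; rewrite derive1_cstE.
Qed.

Lemma dec_cst c : dec 0 (cst c).
Proof.
apply: dec_intro => //; first exact: decay_cst.
by rewrite derive1_cstE; exact: dec0.
Qed.

Lemma decZ a c f : dec a f -> dec a (c *: f).
Proof. exact: decM (dec_cst c). Qed.

Lemma decN a f : dec a f -> dec a (- f).
Proof. by move=> df; rewrite -scaleN1r; exact: decZ. Qed.

Lemma decB a f g : dec a f -> dec a g -> dec a (f - g).
Proof. by move=> df dg; apply: decD => //; exact: decN. Qed.

Lemma derive1Z c a f : dec a f -> (c *: f)^' = c *: f^'.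
Proof. move=> df; apply/funext => x; rewrite [RHS]/(c * f^' x) !derive1E deriveZ//.
exact: dec_derivable df x. Qed.

Lemma rapidD f g : rapid f -> rapid g -> rapid (f + g).
Proof. by move=> rf rg a; exact: decD. Qed.

Lemma rapidZ c f : rapid f -> rapid (c *: f).
Proof. by move=> rf a; exact: decZ. Qed.

Lemma rapidN f : rapid f -> rapid (- f).
Proof. by move=> rf a; exact: decN. Qed.

Lemma rapid_derive1 f : rapid f -> rapid f^'.
Proof. by move=> rf a; exact: dec_derive1. Qed.

Lemma rapidMl f g : rapid f -> dec 0 g -> rapid (f * g).
Proof. by move=> rf dg a; rewrite -(addn0 a); exact: decM. Qed.

Lemma rapidMr f g : dec 0 f -> rapid g -> rapid (f * g).
Proof. by move=> df rg a; rewrite -(add0n a); exact: decM. Qed.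

Lemma decay_mulx a f : decay a.+1 f -> decay a (fun x => x * f x).
Proof.
move=> [C fC]; exists C => x; apply: le_trans (fC x).
rewrite normrM [`|x| * _]mulrC -mulrA ler_wpM2l// exprS.
by rewrite ler_wpM2r ?exprn_ge0 ?addr_ge0// lerDr.
Qed.

Lemma dec_mulx a f : dec a.+1 f -> dec a (fun x => x * f x).
Proof.
move=> + n; elim: n f => [|n IHn] f df.
  split => //; last exact/decay_mulx/dec_decay.
  by move=> x; apply: cvgM; [exact: cvg_id|exact: dec_continuous df x].
have dxf x : is_derive x 1 (fun x => x * f x) (f x + x * f^' x).
  have ? := dec_is_derive df x; apply: is_derive_eq.
  by rewrite /GRing.scale/= mulr1 addrC.
split.
- by move=> x; apply: cvgM; [exact: cvg_id|exact: dec_continuous df x].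
- exact/decay_mulx/dec_decay.
- split; first by move=> x; apply: (@ex_derive _ _ _ _ _ _ _ (dxf x)).
  rewrite (is_derive_derive1 dxf); apply: CdecD; first exact: decS df _.
  exact/IHn/dec_derive1.
Qed.

Lemma rapid_mulx f : rapid f -> rapid (fun x => x * f x).
Proof. by move=> rf a; exact: dec_mulx. Qed.

Lemma decay_reflect a f : decay a f -> decay a (fun x => f (- x)).
Proof. by move=> [C fC]; exists C => x; rewrite -(normrN x). Qed.

Lemma dec_reflect a f : dec a f -> dec a (fun x => f (- x)).
Proof.
move=> + n; elim: n f => [|n IHn] f df.
  split => //; last exact/decay_reflect/dec_decay.
  by move=> x; apply: continuous_comp; [exact: oppr_continuous|exact: dec_continuous df _].
have dfN x : is_derive x 1 (fun x => f (- x)) (- f^' (- x)).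
  have := dec_is_derive df (- x) => fd.
  have := @is_derive1_comp _ f -%R x _ _ fd (is_deriveNid x 1).
  by rewrite mulrN1.
split.
- by move=> x; apply: continuous_comp; [exact: oppr_continuous|exact: dec_continuous df _].
- exact/decay_reflect/dec_decay.
- split; first by move=> x; apply: (@ex_derive _ _ _ _ _ _ _ (dfN x)).
  rewrite (is_derive_derive1 dfN).
  apply: (IHn (- f^')); exact/decN/dec_derive1.
Qed.

(** From |f| and |x|^a |f| bounded, since (1 + |x|)^a <= 2^a max(1, |x|^a). *)
Lemma schwartz_rapid f : schwartz f -> rapid f.
Proof.
move=> [df fb] a.
have db m : decay a (derive1n m f).
  have [C hC] := fb 0%N m; have [D hD] := fb a m.
  have C0 : 0 <= C by exact: le_trans (hC 0).
  have D0 : 0 <= D by exact: le_trans (hD 0).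
  exists (2 ^+ a * (C + D)) => x.
  have [x1|x1] := lerP `|x| 1.
    rewrite mulrC; apply: ler_pM => //.
      by rewrite lerXn2r ?nnegrE ?addr_ge0//; lra.
    have := hC x; rewrite expr0 mul1r => /le_trans; apply.
    by rewrite lerDl.
  apply: (@le_trans _ _ (2 ^+ a * `|x ^+ a * derive1n m f x|)).
    rewrite mulrC normrM normrX mulrA -exprMn ler_wpM2r//.
    by rewrite lerXn2r ?nnegrE ?addr_ge0 ?mulr_ge0//; lra.
  by rewrite ler_wpM2l ?exprn_ge0// (le_trans (hD x))// lerDr.
move=> n; rewrite -[f]/(derive1n 0 f).
elim: n 0%N => [|n IHn] m.
  by split => // x; exact/differentiable_continuous/derivable1_diffP.
split => //; first by move=> x; exact/differentiable_continuous/derivable1_diffP.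
by split; [exact: df|exact: (IHn m.+1)].
Qed.

Lemma decay_weight f : decay 2 f -> exists C, 0 <= C /\ forall x, `|f x| <= C * cauchy_weight x.
Proof.
move=> [C fC]; exists C; split; first by apply: le_trans (fC 0); rewrite mulr_ge0// exprn_ge0// addr_ge0.
move=> x; rewrite /cauchy_weight ler_pdivlMr ?ltr_wpDr ?sqr_ge0//.
apply: le_trans (fC x); rewrite ler_wpM2l//.
by rewrite -[x ^+ 2]real_normK ?num_real//; have := normr_ge0 x; nra.
Qed.

Lemma integrableR_decay f : measurable_fun setT f -> decay 2 f -> integrableR f.
Proof.
move=> mf /decay_weight[C [_ fC]].
by apply: integrableR_le (integrableRZ C (integrableR_cauchy_weight R)) _.
Qed.

Lemma dec_integrableR f : dec 2 f -> integrableR f.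
Proof.
move=> df; apply: integrableR_decay; last exact: dec_decay df.
exact: continuous_measurable_fun (dec_continuous df).
Qed.

Lemma rapid_integrableR f : rapid f -> integrableR f.
Proof. by move=> rf; exact: dec_integrableR. Qed.

Lemma decay_cvg0 f : decay 1 f ->
  f x @[x --> +oo] --> (0 : R) /\ f (- x) @[x --> +oo] --> (0 : R).
Proof.
move=> [C fC].
suff h (g : R -> R) : (forall x, `|g x| * (1 + `|x|) <= C) -> g x @[x --> +oo] --> (0 : R).
  split; apply: h => x; first by have := fC x; rewrite expr1.
  by have := fC (- x); rewrite expr1 normrN.
move=> gC; apply/cvgrPdist_le => e e0.
near=> x; rewrite sub0r normrN.
have x0 : C / e <= x by near: x; apply: nbhs_pinfty_ge; exact: num_real.
have x1 : 0 < x by near: x; apply: nbhs_pinfty_gt; exact: num_real.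
rewrite -(@ler_pM2r _ (1 + `|x|)) ?ltr_wpDr//; apply: le_trans (gC x) _.
rewrite gtr0_norm// mulrDr mulr1.
by move: x0; rewrite ler_pdivrMr// mulrC => /le_trans; apply; rewrite lerDr ltW.
Unshelve. all: by end_near. Qed.

Lemma decay_seq_cvg0 f : decay 1 f ->
  f n%:R @[n --> \oo] --> (0 : R) /\ f (- n%:R) @[n --> \oo] --> (0 : R).
Proof.
move=> /decay_cvg0[h1 h2].
by split; [apply: (cvg_comp _ _ (@cvgr_idn R) h1)|apply: (cvg_comp _ _ (@cvgr_idn R) h2)].
Qed.

(** A total derivative has zero integral: this is how every integration by parts
    below is performed. *)
Lemma intR_derive f (f' : R -> R) : (forall x, is_derive x 1 f (f' x)) ->
  continuous f' -> integrableR f' -> decay 1 f -> intR f' = 0.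
Proof.
move=> df cf' sf' /decay_seq_cvg0[h1 h2].
by rewrite (intR_FTC df cf' sf' h1 h2) subrr.
Qed.

Lemma intR_derive1 f : dec 2 f -> intR f^' = 0.
Proof.
move=> df; apply: (@intR_derive f).
- exact: dec_is_derive df.
- exact: dec_continuous (dec_derive1 df).
- exact/dec_integrableR/dec_derive1.
- exact: decayS (dec_decay df).
Qed.

Definition primitive f x : R := Rintegral mu `]-oo, x] f.

Lemma is_derive_primitive f : continuous f -> integrableR f ->
  forall x, is_derive x 1 (primitive f) (f x).
Proof.
move=> cf sf x.
have x1 : x < x + 1 by rewrite ltrDl.
have ix : mu.-integrable [set` Interval -oo%O (BRight (x + 1))] (EFin \o f).
  exact: integrableR_on.
have [] := continuous_FTC1 x1 ix (ltNyr _) (cf x).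
by move=> dF dFE; apply: DeriveDef; [exact: dF|rewrite -derive1E; exact: dFE].
Qed.

(** Left of the origin the integral from -oo is small because its domain is far
    away; right of it the zero mean lets it be replaced by minus the integral to
    +oo.  Two powers of decay are spent on the integrability of the rest. *)
Lemma dec_primitive a f : dec a.+2 f -> intR f = 0 -> dec a (primitive f).
Proof.
move=> df f0.
have sf : integrableR f by apply/dec_integrableR/(decS _ df).
apply: (dec_intro_is_derive (is_derive_primitive (dec_continuous df) sf)); last first.
  by apply: decS df; rewrite -addn2 leq_addr.
have [C hC] := dec_decay df.
have C0 : 0 <= C by apply: le_trans (hC 0); rewrite mulr_ge0// exprn_ge0// addr_ge0.
exists (C * pi) => x.
(* The estimate shared by the two half-lines: on A the weight (1 + |t|)^a is
   at least (1 + |x|)^a, and the two remaining powers dominate the Cauchy weight. *)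
have half (A : set R) : measurable A -> (forall t, A t -> `|x| <= `|t|) ->
    `|Rintegral mu A f| * (1 + `|x|) ^+ a <= C * pi.
  move=> mA At.
  have p0 : 0 < (1 + `|x|) ^+ a by rewrite exprn_gt0// ltr_wpDr.
  rewrite -ler_pdivlMr//.
  pose k := C / (1 + `|x|) ^+ a.
  have sk := integrableRZ k (integrableR_cauchy_weight R).
  have -> : C * pi / (1 + `|x|) ^+ a = intR (k *: @cauchy_weight R).
    by rewrite (intRZ _ (integrableR_cauchy_weight R)) intR_cauchy_weight /k mulrAC.
  rewrite Rintegral_mkcond; apply: normr_intR_le => //.
    apply: integrableR_le (integrableR_norm sf) _ => [|t].
      by apply/(measurable_restrictT _ mA); exact: measurable_funTS (integrableR_measurable sf).
    by rewrite patchE; case: ifP => // _; rewrite normr0.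
  move=> t; rewrite patchE; case: ifP => [|_].
    rewrite inE => /At xt.
    rewrite (_ : (k *: _) t = k * cauchy_weight t)// /k /cauchy_weight -mulrA -invfM ler_pdivlMr; last first.
      by rewrite mulr_gt0// ltr_wpDr ?sqr_ge0.
    apply: le_trans (hC t); rewrite ler_wpM2l// -(addn2 a) (exprD _ a 2) ler_pM ?exprn_ge0 ?addr_ge0 ?sqr_ge0//.
      by rewrite lerXn2r ?nnegrE ?addr_ge0// lerD2l.
    by rewrite -[t ^+ 2]real_normK ?num_real//; have := normr_ge0 t; nra.
  by rewrite normr0 mulr_ge0 ?divr_ge0// ?ltW ?cauchy_weight_gt0.
have [x0|x0] := lerP x 0.
  apply: half => // t; rewrite /= in_itv/= => tx.
  by rewrite !ler0_norm ?lerN2// (le_trans tx).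
have -> : primitive f x = - Rintegral mu `]x, +oo[ f.
  apply/eqP; rewrite -addr_eq0 -[X in _ == X]f0 /intR.
  rewrite -(setUv `]-oo, x]%classic) setCitvl Rintegral_setU//.
  - by rewrite -setCitvl setUv.
  - by apply/disj_setPLR; rewrite -setCitvl setCK.
rewrite normrN; apply: half => // t; rewrite /= in_itv/= andbT => xt.
by rewrite !gtr0_norm ?ltW// (lt_trans x0).
Qed.

Lemma derive1_primitive a f : dec a.+2 f -> (primitive f)^' = f.
Proof.
move=> df; apply: is_derive_derive1; apply: is_derive_primitive.
  exact: dec_continuous df.
by apply/dec_integrableR/(decS _ df).
Qed.

Lemma rapid_primitive f : rapid f -> intR f = 0 -> rapid (primitive f).
Proof. by move=> rf f0 a; exact: dec_primitive. Qed.

End Decay.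

(** * Cosine and sine transforms *)

Section FourierTransform.
Variable R : realType.
Implicit Types (f g h : R -> R) (k x y u e : R).
Local Notation mu := (@lebesgue_measure R).
Local Notation w := (@cauchy_weight R).

(** The transform of a real f is (2 pi)^(-1/2) (cosft f - i sinft f); working with
    the two real functions avoids complex-valued integrals. *)
Definition cosft f k : R := intR (fun y => f y * cos (k * y)).
Definition sinft f k : R := intR (fun y => f y * sin (k * y)).

Lemma is_derive_cosM u k : is_derive k 1 (fun k => cos (k * u)) (- (u * sin (k * u))).
Proof.
have dM : is_derive k 1 (fun k : R => k * u) u.
  by apply: is_derive_eq; rewrite /GRing.scale/= mulr0 add0r mulr1.
have := @is_derive1_comp _ cos (fun k => k * u) k _ _ (is_derive_cos _) dM.
by rewrite mulNr mulrC.
Qed.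

Lemma is_derive_sinM u k : is_derive k 1 (fun k => sin (k * u)) (u * cos (k * u)).
Proof.
have dM : is_derive k 1 (fun k : R => k * u) u.
  by apply: is_derive_eq; rewrite /GRing.scale/= mulr0 add0r mulr1.
have := @is_derive1_comp _ sin (fun k => k * u) k _ _ (is_derive_sin _) dM.
by rewrite mulrC.
Qed.

Lemma is_derive_expM u k : is_derive k 1 (fun k => expR (k * u)) (u * expR (k * u)).
Proof.
have dM : is_derive k 1 (fun k : R => k * u) u.
  by apply: is_derive_eq; rewrite /GRing.scale/= mulr0 add0r mulr1.
have := @is_derive1_comp _ expR (fun k => k * u) k _ _ (is_derive_expR _) dM.
by rewrite mulrC.
Qed.

Lemma is_derive_continuous f (f' : R -> R) :
  (forall x, is_derive x 1 f (f' x)) -> continuous f.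
Proof.
by move=> df x; apply/differentiable_continuous/derivable1_diffP.
Qed.

Lemma continuous_cosM u : continuous (fun k => cos (k * u)).
Proof. exact: is_derive_continuous (is_derive_cosM u). Qed.

Lemma continuous_sinM u : continuous (fun k => sin (k * u)).
Proof. exact: is_derive_continuous (is_derive_sinM u). Qed.

Lemma continuous_cosMr k : continuous (fun y => cos (k * y)).
Proof.
rewrite (_ : (fun y => _) = fun y => cos (y * k)); first exact: continuous_cosM.
by apply/funext => y; rewrite mulrC.
Qed.

Lemma continuous_sinMr k : continuous (fun y => sin (k * y)).
Proof.
rewrite (_ : (fun y => _) = fun y => sin (y * k)); first exact: continuous_sinM.
by apply/funext => y; rewrite mulrC.
Qed.

Lemma normr_cos_le1 x : `|cos x| <= 1.
Proof. by rewrite ler_norml cos_geN1 cos_le1. Qed.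

Lemma normr_sin_le1 x : `|sin x| <= 1.
Proof. by rewrite ler_norml sin_geN1 sin_le1. Qed.

Lemma integrableR_Ml f (b : R -> R) : integrableR f -> measurable_fun setT b ->
  (forall x, `|b x| <= 1) -> integrableR (fun x => f x * b x).
Proof.
move=> sf mb b1; apply: integrableR_le (integrableR_norm sf) _ => [|x].
  exact: measurable_funM (integrableR_measurable sf) mb.
by rewrite normrM ler_piMr.
Qed.

Lemma measurable_cosM k : measurable_fun setT (fun y => cos (k * y)).
Proof. exact: continuous_measurable_fun (@continuous_cosMr k). Qed.

Lemma measurable_sinM k : measurable_fun setT (fun y => sin (k * y)).
Proof. exact: continuous_measurable_fun (@continuous_sinMr k). Qed.

Lemma integrableR_cos f k : integrableR f -> integrableR (fun y => f y * cos (k * y)).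
Proof.
move=> sf; apply: integrableR_Ml => //; first exact: measurable_cosM.
by move=> x; exact: normr_cos_le1.
Qed.

Lemma integrableR_sin f k : integrableR f -> integrableR (fun y => f y * sin (k * y)).
Proof.
move=> sf; apply: integrableR_Ml => //; first exact: measurable_sinM.
by move=> x; exact: normr_sin_le1.
Qed.

Lemma cosftD f g k : integrableR f -> integrableR g -> cosft (f + g) k = cosft f k + cosft g k.
Proof.
move=> sf sg; rewrite /cosft -intRD; [|exact: integrableR_cos..].
by congr intR; apply/funext => y; rewrite [(f + g) y]/(f y + g y) mulrDl.
Qed.

Lemma sinftD f g k : integrableR f -> integrableR g -> sinft (f + g) k = sinft f k + sinft g k.
Proof.
move=> sf sg; rewrite /sinft -intRD; [|exact: integrableR_sin..].
by congr intR; apply/funext => y; rewrite [(f + g) y]/(f y + g y) mulrDl.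
Qed.

Lemma cosftZ c f k : integrableR f -> cosft (c *: f) k = c * cosft f k.
Proof.
move=> sf; rewrite /cosft -intRZ; last exact: integrableR_cos.
by congr intR; apply/funext => y; rewrite (_ : (c *: f) y = c * f y)// -mulrA.
Qed.

Lemma sinftZ c f k : integrableR f -> sinft (c *: f) k = c * sinft f k.
Proof.
move=> sf; rewrite /sinft -intRZ; last exact: integrableR_sin.
by congr intR; apply/funext => y; rewrite (_ : (c *: f) y = c * f y)// -mulrA.
Qed.

Lemma cosftN f k : cosft f (- k) = cosft f k.
Proof. by congr intR; apply/funext => y; rewrite mulNr cosN. Qed.

Lemma sinftN f k : integrableR f -> sinft f (- k) = - sinft f k.
Proof.
move=> sf; rewrite /sinft -intRN; last exact: integrableR_sin.
by congr intR; apply/funext => y; rewrite mulNr sinN mulrN.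
Qed.

Lemma cosft_reflect f k : continuous f -> integrableR f -> integrableR (fun y => f (- y)) ->
  cosft (fun y => f (- y)) k = cosft f k.
Proof.
move=> cf sf sfN; rewrite /cosft -(@intR_reflect _ (fun y => f y * cos (k * y))).
- by congr intR; apply/funext => y; rewrite mulrN cosN.
- by move=> y; apply: cvgM; [exact: cf|exact: continuous_cosMr].
- exact: integrableR_cos.
- rewrite (_ : (fun x => _) = fun y => f (- y) * cos (k * y)); first exact: (integrableR_cos k sfN).
  by apply/funext => y; rewrite mulrN cosN.
Qed.

Lemma sinft_reflect f k : continuous f -> integrableR f -> integrableR (fun y => f (- y)) ->
  sinft (fun y => f (- y)) k = - sinft f k.
Proof.
move=> cf sf sfN.
have E : (fun y => f (- y) * sin (k * - y)) = - (fun y => f (- y) * sin (k * y)).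
  by apply/funext => y; rewrite mulrN sinN mulrN.
have sE : integrableR (fun y => f (- y) * sin (k * - y)).
  by rewrite E; exact/integrableRN/(integrableR_sin k sfN).
rewrite /sinft -(@intR_reflect _ (fun y => f y * sin (k * y))) ?E ?intRN ?opprK//.
- exact: (integrableR_sin k sfN).
- by move=> y; apply: cvgM; [exact: cf|exact: continuous_sinMr].
- exact: integrableR_sin.
- by rewrite -E.
Qed.

Lemma cosft0 f : cosft f 0 = intR f.
Proof. by congr intR; apply/funext => y; rewrite mul0r cos0 mulr1. Qed.

Lemma sinft0 f : sinft f 0 = 0.
Proof.
rewrite /sinft (_ : (fun y => _) = cst 0).
  by rewrite /intR Rintegral_cst// mul0r.
by apply/funext => y; rewrite mul0r sin0 mulr0.
Qed.

Lemma normr_cosft_le f k : integrableR f -> `|cosft f k| <= intR (fun y => `|f y|).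
Proof.
move=> sf; apply: normr_intR_le; [exact: integrableR_cos|exact: integrableR_norm|].
by move=> y; rewrite normrM ler_piMr// normr_cos_le1.
Qed.

Lemma normr_sinft_le f k : integrableR f -> `|sinft f k| <= intR (fun y => `|f y|).
Proof.
move=> sf; apply: normr_intR_le; [exact: integrableR_sin|exact: integrableR_norm|].
by move=> y; rewrite normrM ler_piMr// normr_sin_le1.
Qed.

Lemma continuous_cosft f : integrableR f -> continuous (cosft f).
Proof.
move=> sf k; apply/(@cvg_nbhsP _ R^o) => u_ uk.
apply: (@intR_dominated_cvg R (fun n y => f y * cos (u_ n * y)) _ (fun y => `|f y|)).
- by move=> n; exact: integrableR_measurable (integrableR_cos _ sf).
- exact: integrableR_norm.
- by move=> n y; rewrite normrM ler_piMr// normr_cos_le1.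
- move=> y; apply: cvgM; first exact: cvg_cst.
  exact: (cvg_comp _ _ uk (@continuous_cosM y k)).
Qed.

Lemma continuous_sinft f : integrableR f -> continuous (sinft f).
Proof.
move=> sf k; apply/(@cvg_nbhsP _ R^o) => u_ uk.
apply: (@intR_dominated_cvg R (fun n y => f y * sin (u_ n * y)) _ (fun y => `|f y|)).
- by move=> n; exact: integrableR_measurable (integrableR_sin _ sf).
- exact: integrableR_norm.
- by move=> n y; rewrite normrM ler_piMr// normr_sin_le1.
- move=> y; apply: cvgM; first exact: cvg_cst.
  exact: (cvg_comp _ _ uk (@continuous_sinM y k)).
Qed.

Lemma decay_Mbounded a f (b : R -> R) : (forall x, `|b x| <= 1) ->
  decay a f -> decay a (fun x => f x * b x).
Proof.
move=> b1 [C fC]; exists C => x; apply: le_trans (fC x).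
by rewrite ler_wpM2r ?exprn_ge0 ?addr_ge0// normrM ler_piMr.
Qed.

Lemma cosft_derive1 f k : dec 2 f -> cosft f^' k = k * sinft f k.
Proof.
move=> df; have sf := dec_integrableR df; have sf' := dec_integrableR (dec_derive1 df).
have E : intR ((fun y => f^' y * cos (k * y)) + - k *: (fun y => f y * sin (k * y))) = 0.
  apply: (@intR_derive _ (fun y => f y * cos (k * y))).
  - move=> y; have df1 := dec_is_derive df y.
    rewrite (_ : (fun y => f y * cos (k * y)) = fun y => f y * cos (y * k)); last first.
      by apply/funext => z; rewrite (mulrC k).
    have dc := is_derive_cosM k y; apply: is_derive_eq.
    rewrite (_ : ((fun y => _) + _) y = f^' y * cos (k * y) + - k * (f y * sin (k * y)))//.
    by rewrite (mulrC k y) /GRing.scale/=; ring.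
  - rewrite (_ : _ + _ = fun y => f^' y * cos (y * k) + - k * (f y * sin (y * k))).
      move=> y; apply: cvgD.
        by apply: cvgM; [exact: (dec_continuous (dec_derive1 df))|exact: continuous_cosM].
      apply: cvgM; first (exact: cvg_cst); apply: cvgM; [exact: (dec_continuous df)|exact: continuous_sinM].
    by apply/funext => y; rewrite (mulrC y).
  - by apply: integrableRD; [|apply: integrableRZ]; [exact: integrableR_cos|exact: integrableR_sin].
  - apply: decay_Mbounded => [y|]; first exact: normr_cos_le1.
    exact: decayS (dec_decay df).
move: E; rewrite intRD ?intRZ; [|exact: integrableR_sin|exact: integrableR_cos|by apply: integrableRZ; exact: integrableR_sin].
by move=> /eqP; rewrite mulNr subr_eq0 => /eqP.
Qed.

Lemma sinft_derive1 f k : dec 2 f -> sinft f^' k = - (k * cosft f k).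
Proof.
move=> df; have sf := dec_integrableR df; have sf' := dec_integrableR (dec_derive1 df).
have E : intR ((fun y => f^' y * sin (k * y)) + k *: (fun y => f y * cos (k * y))) = 0.
  apply: (@intR_derive _ (fun y => f y * sin (k * y))).
  - move=> y; have df1 := dec_is_derive df y.
    rewrite (_ : (fun y => f y * sin (k * y)) = fun y => f y * sin (y * k)); last first.
      by apply/funext => z; rewrite (mulrC k).
    have dc := is_derive_sinM k y; apply: is_derive_eq.
    rewrite (_ : ((fun y => _) + _) y = f^' y * sin (k * y) + k * (f y * cos (k * y)))//.
    by rewrite (mulrC k y) /GRing.scale/=; ring.
  - rewrite (_ : _ + _ = fun y => f^' y * sin (y * k) + k * (f y * cos (y * k))).
      move=> y; apply: cvgD.
        by apply: cvgM; [exact: (dec_continuous (dec_derive1 df))|exact: continuous_sinM].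
      apply: cvgM; first (exact: cvg_cst); apply: cvgM; [exact: (dec_continuous df)|exact: continuous_cosM].
    by apply/funext => y; rewrite (mulrC y).
  - by apply: integrableRD; [|apply: integrableRZ]; [exact: integrableR_sin|exact: integrableR_cos].
  - apply: decay_Mbounded => [y|]; first exact: normr_sin_le1.
    exact: decayS (dec_decay df).
move: E; rewrite intRD ?intRZ; [|exact: integrableR_cos|exact: integrableR_sin|by apply: integrableRZ; exact: integrableR_cos].
by move=> /eqP; rewrite addr_eq0 => /eqP.
Qed.

Definition fast g : Prop := exists M, forall k, `|g k| <= M * w k.

(** (1 + k^2) cosft f is the transform of f - f'', hence bounded. *)
Lemma cosft_fast f : dec 2 f -> fast (cosft f).
Proof.
move=> df; have sf := dec_integrableR df.
have df2 := dec_derive1 (dec_derive1 df); have sf2 := dec_integrableR df2.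
exists (intR (fun y => `|(f - f^'^') y|)) => k.
rewrite /cauchy_weight ler_pdivlMr; last by rewrite ltr_wpDr ?sqr_ge0.
have -> : `|cosft f k| * (1 + k ^+ 2) = `|cosft (f - f^'^') k|.
  rewrite -[1 + _]ger0_norm ?addr_ge0 ?sqr_ge0// -normrM; congr `|_|.
  rewrite cosftD//; last exact: integrableRN.
  rewrite -scaleN1r cosftZ// cosft_derive1 ?sinft_derive1//; last exact: dec_derive1.
  ring.
by apply: normr_cosft_le; apply: integrableRD => //; exact: integrableRN.
Qed.

Lemma sinft_fast f : dec 2 f -> fast (sinft f).
Proof.
move=> df; have sf := dec_integrableR df.
have df2 := dec_derive1 (dec_derive1 df); have sf2 := dec_integrableR df2.
exists (intR (fun y => `|(f - f^'^') y|)) => k.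
rewrite /cauchy_weight ler_pdivlMr; last by rewrite ltr_wpDr ?sqr_ge0.
have -> : `|sinft f k| * (1 + k ^+ 2) = `|sinft (f - f^'^') k|.
  rewrite -[1 + _]ger0_norm ?addr_ge0 ?sqr_ge0// -normrM; congr `|_|.
  rewrite sinftD//; last exact: integrableRN.
  rewrite -scaleN1r sinftZ// sinft_derive1 ?cosft_derive1//; last exact: dec_derive1.
  ring.
by apply: normr_sinft_le; apply: integrableRD => //; exact: integrableRN.
Qed.

Lemma fast_integrableR g : measurable_fun setT g -> fast g -> integrableR g.
Proof.
move=> mg [M gM].
exact: integrableR_le (integrableRZ M (integrableR_cauchy_weight R)) _.
Qed.

Lemma is_derive_cosft f k : continuous f -> decay 3 f ->
  is_derive k 1 (cosft f) (- sinft (fun y => y * f y) k).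
Proof.
move=> cf f3.
have mf := continuous_measurable_fun cf.
have sf : integrableR f by apply: integrableR_decay => //; exact: decayS f3.
have sxf : integrableR (fun y => y * f y).
  by apply: integrableR_decay; [exact: measurable_funM|exact: decay_mulx].
rewrite /sinft -intRN; last exact: integrableR_sin.
apply: (@is_derive_intR _ (fun k y => f y * cos (k * y))
  (fun k => - (fun y => y * f y * sin (k * y))) (fun y => `|y * f y|)).
- move=> x y; have dc := is_derive_cosM y x; apply: is_derive_eq.
  by rewrite (_ : (- (fun y => _)) y = - (y * f y * sin (x * y)))// /GRing.scale/=; ring.
- by move=> x; exact: integrableR_cos.
- exact: integrableR_norm.
- move=> x y; rewrite (_ : (- (fun y => _)) y = - (y * f y * sin (x * y)))//.
  by rewrite normrN normrM ler_piMr// normr_sin_le1.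
Qed.

Lemma is_derive_sinft f k : continuous f -> decay 3 f ->
  is_derive k 1 (sinft f) (cosft (fun y => y * f y) k).
Proof.
move=> cf f3.
have mf := continuous_measurable_fun cf.
have sf : integrableR f by apply: integrableR_decay => //; exact: decayS f3.
have sxf : integrableR (fun y => y * f y).
  by apply: integrableR_decay; [exact: measurable_funM|exact: decay_mulx].
apply: (@is_derive_intR _ (fun k y => f y * sin (k * y))
  (fun k y => y * f y * cos (k * y)) (fun y => `|y * f y|)).
- move=> x y; have dc := is_derive_sinM y x; apply: is_derive_eq.
  by rewrite /GRing.scale/=; ring.
- by move=> x; exact: integrableR_sin.
- exact: integrableR_norm.
- by move=> x y; rewrite normrM ler_piMr// normr_cos_le1.
Qed.

End FourierTransform.

(** * The Abel and Poisson kernels *)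

Section Inversion.
Variable R : realType.
Implicit Types (f g h : R -> R) (k x y u e : R).
Local Notation mu := (@lebesgue_measure R).
Local Notation w := (@cauchy_weight R).

(** From exp t >= (1 + t / 2)^2. *)
Lemma expRN_le_weight e k : 0 < e ->
  expR (- (e * `|k|)) <= (1 + 4 / e ^+ 2) * w k.
Proof.
move=> e0; rewrite expRN /cauchy_weight -[leLHS]mul1r.
rewrite ler_pdivrMr ?expR_gt0// mulrAC ler_pdivlMr ?ltr_wpDr ?sqr_ge0// mul1r.
have k0 := normr_ge0 k.
have h : (1 + e * `|k| / 2) ^+ 2 <= expR (e * `|k|).
  rewrite [X in expR X](splitr (e * `|k|)) expRD -expr2.
  have a0 : 0 <= e * `|k| / 2 by rewrite divr_ge0// mulr_ge0// ltW.
  by rewrite lerXn2r ?nnegrE ?expR_ge1Dx ?expR_ge0// addr_ge0.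
have e1 : (1 + k ^+ 2) <= (1 + 4 / e ^+ 2) * (1 + e ^+ 2 * k ^+ 2 / 4).
  have -> : (1 + 4 / e ^+ 2) * (1 + e ^+ 2 * k ^+ 2 / 4) =
      1 + k ^+ 2 + 4 / e ^+ 2 + e ^+ 2 * k ^+ 2 / 4 by field; rewrite gt_eqF.
  have : 0 <= 4 / e ^+ 2 by rewrite divr_ge0// sqr_ge0.
  have : 0 <= e ^+ 2 * k ^+ 2 / 4 by rewrite divr_ge0// mulr_ge0// sqr_ge0.
  lra.
apply: le_trans e1 _; rewrite ler_wpM2l ?addr_ge0 ?divr_ge0 ?sqr_ge0//.
apply: le_trans h; rewrite -[k ^+ 2]real_normK ?num_real//.
have : 0 <= e * `|k| by rewrite mulr_ge0// ltW.
nra.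
Qed.

Lemma continuous_expN_norm e : continuous (fun k => expR (- (e * `|k|))).
Proof.
move=> k; apply: continuous_comp; last exact: continuous_expR.
apply: cvgN; apply: cvgM; first exact: cvg_cst.
exact: (@norm_continuous _ R^o).
Qed.

Lemma integrableR_expN_norm e : 0 < e -> integrableR (fun k => expR (- (e * `|k|))).
Proof.
move=> e0; apply: fast_integrableR.
  exact: continuous_measurable_fun (@continuous_expN_norm e).
by exists (1 + 4 / e ^+ 2) => k; rewrite ger0_norm ?expR_ge0//; exact: expRN_le_weight.
Qed.

Lemma decay_cauchy_weight : decay 2 w.
Proof.
exists 2 => x; rewrite gtr0_norm ?cauchy_weight_gt0//.
rewrite /cauchy_weight mulrC ler_pdivrMr ?ltr_wpDr ?sqr_ge0//.
rewrite -[x ^+ 2]real_normK ?num_real//; have := sqr_ge0 (1 - `|x|); nra.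
Qed.

Lemma decay_fast g : decay 2 g <-> fast g.
Proof.
split=> [/decay_weight[C [_ gC]]|[M gM]]; first by exists C.
have [D wD] := decay_cauchy_weight.
exists (M * D) => x.
have M0 : 0 <= M.
  have := le_trans (normr_ge0 _) (gM 0).
  by rewrite pmulr_lge0// cauchy_weight_gt0.
apply: le_trans (_ : M * w x * (1 + `|x|) ^+ 2 <= _).
  by rewrite ler_wpM2r// exprn_ge0// addr_ge0.
rewrite -mulrA ler_wpM2l//.
by have := wD x; rewrite gtr0_norm ?cauchy_weight_gt0.
Qed.

Lemma decay_expN e : 0 < e -> decay 1 (fun k => expR (- (e * `|k|))).
Proof.
move=> e0; apply: (@decayS _ _ 2) => //; apply/decay_fast.
by exists (1 + 4 / e ^+ 2) => k; rewrite ger0_norm ?expR_ge0//; exact: expRN_le_weight.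
Qed.

Lemma exp_seq_cvg0 e (b : R -> R) C : 0 < e -> (forall k, `|b k| <= C) ->
  expR (n%:R * - e) * b n%:R @[n --> \oo] --> (0 : R) /\
  expR (- n%:R * e) * b (- n%:R) @[n --> \oo] --> (0 : R).
Proof.
move=> e0 bC.
have [D hD] := decay_expN e0.
have : decay 1 (fun k => expR (- (e * `|k|)) * b k).
  exists (D * C) => x; rewrite normrM mulrAC; apply: ler_pM => //.
move=> /decay_seq_cvg0[h1 h2]; split.
  rewrite (_ : (fun n => _) = fun n : nat => expR (- (e * `|n%:R|)) * b n%:R)//.
  by apply/funext => n; rewrite ger0_norm// mulrN (mulrC e).
rewrite (_ : (fun n => _) = fun n : nat => expR (- (e * `|- n%:R|)) * b (- n%:R))//.
by apply/funext => n; rewrite normrN ger0_norm// mulNr (mulrC e).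
Qed.

(** The transform of the Abel factor is the Poisson kernel.  On k > 0 an
    antiderivative of exp(- e k) cos(k u) is
    exp(- e k) (u sin(k u) - e cos(k u)) / (e^2 + u^2). *)
Lemma intR_expN_cos e u : 0 < e ->
  intR (fun k => expR (- (e * `|k|)) * cos (k * u)) = 2 * e / (e ^+ 2 + u ^+ 2).
Proof.
move=> e0.
have d0 : e ^+ 2 + u ^+ 2 != 0 by rewrite gt_eqF// ltr_wpDr ?sqr_ge0// exprn_gt0.
pose F1 k := expR (k * - e) * ((u * sin (k * u) - e * cos (k * u)) / (e ^+ 2 + u ^+ 2)).
pose F2 k := expR (k * e) * ((u * sin (k * u) + e * cos (k * u)) / (e ^+ 2 + u ^+ 2)).
pose f1 k := expR (k * - e) * cos (k * u).
pose f2 k := expR (k * e) * cos (k * u).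
have cE c : continuous (fun k => expR (k * c)).
  exact: is_derive_continuous (is_derive_expM c).
have -> : intR (fun k => expR (- (e * `|k|)) * cos (k * u)) = (0 - F1 0) + (F2 0 - 0).
  apply: (@intR_FTC2 _ F1 F2 f1 f2).
  - move=> k; have h1 := is_derive_expM (- e) k.
    have h2 := is_derive_sinM u k; have h3 := is_derive_cosM u k.
    by apply: is_derive_eq; rewrite /GRing.scale/= /f1; field.
  - by move=> k; apply: cvgM; [exact: cE|exact: continuous_cosM].
  - move=> k; have h1 := is_derive_expM e k.
    have h2 := is_derive_sinM u k; have h3 := is_derive_cosM u k.
    by apply: is_derive_eq; rewrite /GRing.scale/= /f2; field.
  - by move=> k; apply: cvgM; [exact: cE|exact: continuous_cosM].
  - by move=> k k0; rewrite /f1 gtr0_norm// mulrN (mulrC e).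
  - by move=> k k0; rewrite /f2 ltr0_norm// mulrN opprK (mulrC e).
  - apply: integrableR_Ml; first exact: integrableR_expN_norm.
      exact: continuous_measurable_fun (@continuous_cosM R u).
    by move=> k; exact: normr_cos_le1.
  - apply: (@exp_seq_cvg0 e (fun k => (u * sin (k * u) - e * cos (k * u)) / (e ^+ 2 + u ^+ 2))
      ((`|u| + `|e|) / (e ^+ 2 + u ^+ 2)) e0 _).1 => k.
    rewrite normrM normfV [`|e ^+ 2 + _|]ger0_norm ?addr_ge0 ?sqr_ge0//.
    rewrite ler_wpM2r ?invr_ge0 ?addr_ge0 ?sqr_ge0//.
    rewrite (le_trans (ler_normB _ _))// !normrM.
    by rewrite lerD// ler_piMr// ?normr_sin_le1 ?normr_cos_le1.
  - apply: (@exp_seq_cvg0 e (fun k => (u * sin (k * u) + e * cos (k * u)) / (e ^+ 2 + u ^+ 2))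
      ((`|u| + `|e|) / (e ^+ 2 + u ^+ 2)) e0 _).2 => k.
    rewrite normrM normfV [`|e ^+ 2 + _|]ger0_norm ?addr_ge0 ?sqr_ge0//.
    rewrite ler_wpM2r ?invr_ge0 ?addr_ge0 ?sqr_ge0//.
    rewrite (le_trans (ler_normD _ _))// !normrM.
    by rewrite lerD// ler_piMr// ?normr_sin_le1 ?normr_cos_le1.
by rewrite /F1 /F2 !mul0r expR0 sin0 cos0 !mulr0 !mulr1 !mul1r add0r; field.
Qed.

Lemma is_derive_atan_scale e x y : e != 0 ->
  is_derive y 1 (fun y => 2 * atan ((y - x) / e)) (2 * e / (e ^+ 2 + (x - y) ^+ 2)).
Proof.
move=> e0.
have dM : is_derive y 1 (fun y : R => (y - x) / e) e^-1.
  by apply: is_derive_eq; rewrite /GRing.scale/= !mulr0 add0r subr0 mulr1.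
have dA : is_derive y 1 (fun y => atan ((y - x) / e)) ((1 + ((y - x) / e) ^+ 2)^-1 * e^-1).
  exact: (@is_derive1_comp _ atan (fun y => (y - x) / e) y _ _ (is_derive1_atan _) dM).
apply: is_derive_eq; rewrite /GRing.scale/=.
have d0 : e ^+ 2 + (x - y) ^+ 2 != 0 by rewrite gt_eqF// ltr_wpDr ?sqr_ge0// exprn_even_gt0.
by field; rewrite d0 e0.
Qed.

Lemma atan_seq_cvg e x : 0 < e ->
  2 * atan ((n%:R - x) / e) @[n --> \oo] --> (pi : R) /\
  2 * atan ((- n%:R - x) / e) @[n --> \oo] --> (- pi : R).
Proof.
move=> e0.
have h z : atan ((n%:R + z) / e) @[n --> \oo] --> (pi / 2 : R).
  apply: (cvg_comp _ _ _ (@cvgy_atan R)); apply/cvgryPge => A.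
  near=> n; rewrite ler_pdivlMr// -lerBlDr.
  by near: n; exact: nbhs_infty_ger.
split.
  rewrite (_ : pi = 2 * (pi / 2)); last by rewrite mulrC divfK.
  by apply: cvgM; [exact: cvg_cst|exact: h].
rewrite (_ : - pi = 2 * - (pi / 2)); last by rewrite mulrN (mulrC 2) divfK.
apply: cvgM; first exact: cvg_cst.
rewrite (_ : (fun n => _) = (fun n : nat => - atan ((n%:R + x) / e))).
  by apply: cvgN; exact: h.
by apply/funext => n; rewrite -opprD mulNr atanN.
Unshelve. all: by end_near. Qed.

Definition poisson e u : R := 2 * e / (e ^+ 2 + u ^+ 2).

Lemma poisson_ge0 e u : 0 < e -> 0 <= poisson e u.
Proof. by move=> e0; rewrite divr_ge0// ?addr_ge0 ?sqr_ge0// mulr_ge0// ltW. Qed.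

Lemma continuous_poisson e x : 0 < e -> continuous (fun y => poisson e (x - y)).
Proof.
move=> e0 y; apply: cvgM; first exact: cvg_cst.
apply: cvgV; first by rewrite gt_eqF// ltr_wpDr ?sqr_ge0// exprn_gt0.
apply: cvgD; first exact: cvg_cst.
have h : x - z @[z --> y] --> x - y by apply: cvgB; [exact: cvg_cst|exact: cvg_id].
by rewrite expr2; under eq_fun do rewrite expr2; exact: (cvgM h h).
Qed.

Lemma integrableR_poisson e x : 0 < e -> integrableR (fun y => poisson e (x - y)).
Proof.
move=> e0; have e20 : 0 < e ^+ 2 by rewrite exprn_gt0.
apply: fast_integrableR; first exact: continuous_measurable_fun (@continuous_poisson e x e0).
exists (2 * e * ((1 + 2 * x ^+ 2) / e ^+ 2 + 2)) => y.
rewrite ger0_norm ?poisson_ge0// /poisson /cauchy_weight -[leRHS]mulrA.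
rewrite ler_pM2l ?mulr_gt0// ler_pdivlMr ?ltr_wpDr ?sqr_ge0//.
rewrite mulrC ler_pdivrMr ?ltr_wpDr ?sqr_ge0//.
have -> : ((1 + 2 * x ^+ 2) / e ^+ 2 + 2) * (e ^+ 2 + (x - y) ^+ 2) =
  (1 + 2 * x ^+ 2) + 2 * e ^+ 2 + (1 + 2 * x ^+ 2) / e ^+ 2 * (x - y) ^+ 2 + 2 * (x - y) ^+ 2.
  by field; rewrite gt_eqF.
have h : 0 <= (1 + 2 * x ^+ 2) / e ^+ 2 * (x - y) ^+ 2.
  by rewrite mulr_ge0 ?sqr_ge0// divr_ge0 ?sqr_ge0// addr_ge0// mulr_ge0// sqr_ge0.
have := sqr_ge0 (2 * x - y); have := sqr_ge0 x; have := sqr_ge0 y; nra.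
Qed.

Lemma intR_poisson e x : 0 < e -> intR (fun y => poisson e (x - y)) = 2 * pi.
Proof.
move=> e0; have [h1 h2] := atan_seq_cvg x e0.
rewrite (_ : 2 * pi = pi - - pi); last by rewrite opprK mulr_natl mulr2n.
apply: (intR_FTC (F := fun y => 2 * atan ((y - x) / e))) h1 h2.
- by move=> y; apply: is_derive_atan_scale; rewrite gt_eqF.
- exact: continuous_poisson.
- exact: integrableR_poisson.
Qed.

End Inversion.

(** * Fourier inversion *)

Section InversionTheorem.
Variable R : realType.
Implicit Types (f g h : R -> R) (k x y u e : R).
Local Notation mu := (@lebesgue_measure R).
Local Notation w := (@cauchy_weight R).

(** With sinwave below, the value at k of the transform of f, shifted by x: they are
    the integrals of f(y) cos(k (x - y)) and of f(y) sin(k (x - y)). *)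
Definition coswave f k x : R := cosft f k * cos (k * x) + sinft f k * sin (k * x).

Lemma coswaveE f k x : integrableR f ->
  coswave f k x = intR (fun y => f y * cos (k * (x - y))).
Proof.
move=> sf; rewrite /coswave /cosft /sinft mulrC [X in _ + X]mulrC -!intRZ; [|exact: integrableR_sin|exact: integrableR_cos].
rewrite -intRD; [|by apply: integrableRZ; exact: integrableR_cos|by apply: integrableRZ; exact: integrableR_sin].
congr intR; apply/funext => y.
rewrite (_ : (_ + _) y = cos (k * x) * (f y * cos (k * y)) + sin (k * x) * (f y * sin (k * y)))//.
by rewrite mulrBr cosB; ring.
Qed.

Lemma integrableR_coswave f x : integrableR (cosft f) -> integrableR (sinft f) -> integrableR (coswave f ^~ x).
Proof.
move=> sc ss; rewrite /coswave; apply: (@integrableRD _ (fun k => cosft f k * cos (k * x)) (fun k => sinft f k * sin (k * x))).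
  apply: integrableR_Ml => //; first exact: continuous_measurable_fun (@continuous_cosM R x).
  by move=> k; exact: normr_cos_le1.
apply: integrableR_Ml => //; first exact: continuous_measurable_fun (@continuous_sinM R x).
by move=> k; exact: normr_sin_le1.
Qed.

Let eps (n : nat) : R := n.+1%:R^-1.

Let eps_gt0 n : 0 < eps n. Proof. by rewrite invr_gt0. Qed.

Let eps_le1 n : eps n <= 1. Proof. by rewrite invf_le1// ler1n. Qed.

Let eps_cvg : eps n @[n --> \oo] --> (0 : R).
Proof. exact: cvg_harmonic. Qed.

Lemma abel_cvg g : integrableR g ->
  intR (fun k => expR (- (eps n * `|k|)) * g k) @[n --> \oo] --> intR g.
Proof.
move=> sg; apply: (@intR_dominated_cvg _ (fun n k => expR (- (eps n * `|k|)) * g k) _ (fun k => `|g k|)).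
- move=> n; apply: measurable_funM; last exact: integrableR_measurable.
  exact: continuous_measurable_fun (@continuous_expN_norm R (eps n)).
- exact: integrableR_norm.
- move=> n k; rewrite normrM ler_piMl// ger0_norm ?expR_ge0//.
  by rewrite -expR0 ler_expR oppr_le0 mulr_ge0// ltW.
- move=> k; rewrite -[X in _ --> X]mul1r -expR0; apply: cvgM; last exact: cvg_cst.
  apply: continuous_cvg; first exact: continuous_expR.
  by rewrite -oppr0 -(mul0r `|k|); apply: cvgN; apply: cvgM => //; exact: cvg_cst.
Qed.

Lemma poisson_Fubini f x e : 0 < e -> integrableR f ->
  intR (fun k => expR (- (e * `|k|)) * coswave f k x) =
  intR (fun y => f y * poisson e (x - y)).
Proof.
move=> e0 sf.
rewrite (_ : (fun k => _) = fun k => intR (fun y => expR (- (e * `|k|)) * (f y * cos (k * (x - y))))); last first.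
  apply/funext => k; rewrite coswaveE// -intRZ//.
  apply: integrableR_Ml => //; last by move=> y; exact: normr_cos_le1.
  apply: continuous_measurable_fun => y.
  apply: continuous_comp; last exact: continuous_cos.
  by apply: cvgM; [exact: cvg_cst|apply: cvgB; [exact: cvg_cst|exact: cvg_id]].
rewrite (@intR_Fubini _ (fun k y => expR (- (e * `|k|)) * (f y * cos (k * (x - y))))
  (fun k => expR (- (e * `|k|))) (fun y => `|f y|)).
- congr intR; apply/funext => y.
  rewrite /poisson -(intR_expN_cos (x - y) e0) -intRZ; last first.
    apply: integrableR_Ml; first exact: integrableR_expN_norm.
      exact: continuous_measurable_fun (@continuous_cosM R (x - y)).
    by move=> k; exact: normr_cos_le1.
  congr intR; apply/funext => k; rewrite mulrCA.
  by [].
- apply: measurable_funM.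
    apply: (measurableT_comp (continuous_measurable_fun (@continuous_expN_norm R e))).
    exact: measurable_fst.
  apply: measurable_funM.
    by apply: (measurableT_comp (integrableR_measurable sf)); exact: measurable_snd.
  apply: (measurableT_comp (continuous_measurable_fun (@continuous_cos R))).
  apply: measurable_funM; first exact: measurable_fst.
  by apply: measurable_funB => //; exact: measurable_snd.
- exact: integrableR_expN_norm.
- exact: integrableR_norm.
- move=> k y; rewrite normrM ger0_norm ?expR_ge0// ler_wpM2l ?expR_ge0//.
  by rewrite normrM ler_piMr// normr_cos_le1.
Qed.

(** Since the total mass of the kernel is 2 pi, one has to show that f - f x
    integrates to 0 in the limit.  Lipschitz continuity at x and the boundedness of
    f bound the integrand by a fixed multiple of the kernel with parameter 1, so that
    dominated convergence applies without a change of variables. *)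
Lemma poisson_cvg f x M L : measurable_fun setT f ->
  (forall y, `|f y| <= M * w y) -> (forall y, `|f y - f x| <= L * `|y - x|) ->
  intR (fun y => f y * poisson (eps n) (x - y)) @[n --> \oo] --> f x * (2 * pi).
Proof.
move=> mf fM fL.
have M0 : 0 <= M.
  by have := le_trans (normr_ge0 _) (fM 0); rewrite pmulr_lge0// cauchy_weight_gt0.
have L0 : 0 <= L.
  by have := le_trans (normr_ge0 _) (fL (x + 1)); rewrite addrAC subrr add0r normr1 mulr1.
have fM' y : `|f y| <= M.
  apply: le_trans (fM y) _; rewrite ler_piMr// /cauchy_weight invf_le1 ?ltr_wpDr ?sqr_ge0//.
  by rewrite lerDl sqr_ge0.
pose d n y := (f y - f x) * poisson (eps n) (x - y).
have md n : measurable_fun setT (d n).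
  apply: measurable_funM; first by apply: measurable_funB.
  exact: continuous_measurable_fun (@continuous_poisson R _ x (eps_gt0 n)).
pose G y := (L + 4 * M) * poisson 1 (x - y).
have sG : integrableR G by apply: integrableRZ; exact: integrableR_poisson.
have dG n y : `|d n y| <= G y.
  rewrite /d /G normrM [`|poisson _ _|]ger0_norm ?poisson_ge0// /poisson.
  have e0 := eps_gt0 n; have e1 := eps_le1 n; set e := eps n in e0 e1 *.
  have := fL y; rewrite (distrC y x); set t := `|x - y| => Lt.
  have e2 : 0 <= 2 * e by rewrite mulr_ge0// ltW.
  have t0 : 0 <= t by exact: normr_ge0.
  have -> : (x - y) ^+ 2 = t ^+ 2 by rewrite real_normK ?num_real.
  have p1 : 0 < e ^+ 2 + t ^+ 2 by rewrite ltr_wpDr ?sqr_ge0// exprn_gt0.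
  have p2 : 0 < 1 ^+ 2 + t ^+ 2 by rewrite ltr_wpDr ?sqr_ge0// exprn_gt0.
  rewrite !mulrA ler_pdivrMr// [leRHS]mulrAC ler_pdivlMr// mulr1 expr1n.
  rewrite -[_ * 2 * e]mulrA.
  have [t1|t1] := lerP t 1.
    (* Near x the factor t gained from the Lipschitz bound is absorbed by
       2 t e <= e^2 + t^2. *)
    apply: (@le_trans _ _ (L * (e ^+ 2 + t ^+ 2) * (1 + t ^+ 2))).
      rewrite ler_wpM2r ?addr_ge0 ?sqr_ge0//.
      apply: (@le_trans _ _ (L * t * (2 * e))).
        by rewrite ler_wpM2r.
      by rewrite -mulrA ler_wpM2l//; have := sqr_ge0 (t - e); nra.
    rewrite mulrAC ler_wpM2r ?(ltW p1)//.
    have : t ^+ 2 <= 1 by rewrite expr_le1.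
    nra.
  have h2 : `|f y - f x| <= 2 * M.
    by rewrite (le_trans (ler_normB _ _))// mulr_natl mulr2n lerD.
  have t2 : 1 <= t ^+ 2 by nra.
  (* Away from x only the boundedness of f is used. *)
  apply: (@le_trans _ _ (2 * M * 2 * (1 + t ^+ 2))).
    rewrite ler_wpM2r ?addr_ge0 ?sqr_ge0//.
    by apply: ler_pM => //; lra.
  apply: (@le_trans _ _ (4 * M * 2 * t ^+ 2)); first nra.
  have := sqr_ge0 e; have := sqr_ge0 t => *.
  by apply: ler_pM => //; lra.
have d0 : intR (d n) @[n --> \oo] --> intR (cst 0 : R -> R).
  apply: (intR_dominated_cvg md sG dG) => y.
  have [->|yx] := eqVneq y x.
    by rewrite /d subrr; under eq_fun do rewrite mul0r; exact: cvg_cst.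
  have u0 : 0 ^+ 2 + (x - y) ^+ 2 != 0.
    by rewrite expr0n add0r expf_neq0// subr_eq0 eq_sym.
  rewrite (_ : cst 0 y = (f y - f x) * (2 * 0 / (0 ^+ 2 + (x - y) ^+ 2))); last first.
    by rewrite mulr0 mul0r mulr0.
  apply: cvgM; first exact: cvg_cst.
  apply: cvgM; first by apply: cvgM => //; exact: cvg_cst.
  apply: cvgV => //; apply: cvgD; last exact: cvg_cst.
  by rewrite expr2; under eq_fun do rewrite expr2; exact: (cvgM eps_cvg eps_cvg).
rewrite (_ : (fun n => _) = fun n => intR (d n) + f x * (2 * pi)); last first.
  apply/funext => n; rewrite -(intR_poisson x (eps_gt0 n)) -intRZ; last exact: integrableR_poisson.
  rewrite -intRD.
  - by congr intR; apply/funext => y; rewrite (_ : (_ + _) y = d n y + f x * poisson (eps n) (x - y))// /d; ring.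
  - exact: integrableR_le (md n) sG (dG n).
  - by apply: integrableRZ; exact: integrableR_poisson.
rewrite -[X in _ --> X]add0r; apply: cvgD; last exact: cvg_cst.
have z0 : intR (cst 0 : R -> R) = 0 by rewrite /intR Rintegral_cst// mul0r.
by rewrite z0 in d0.
Qed.

(** Insert the Abel factor exp(- e |k|) and let e tend to 0.  The left side tends to
    the inversion integral by dominated convergence; by Fubini it is also the Poisson
    integral of f at x.  Regularity is asked at the point x only, because the theorem
    is also applied to functions such as |k| g(k). *)
Theorem fourier_inversion f x M L : measurable_fun setT f ->
  (forall y, `|f y| <= M * w y) -> (forall y, `|f y - f x| <= L * `|y - x|) ->
  integrableR (cosft f) -> integrableR (sinft f) ->
  intR (coswave f ^~ x) = 2 * pi * f x.
Proof.
move=> mf fM fL sc ss.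
have sf : integrableR f by apply: fast_integrableR => //; exists M.
apply: cvg_unique (abel_cvg (integrableR_coswave x sc ss)) _ => //.
rewrite (_ : (fun n => _) = fun n => intR (fun y => f y * poisson (eps n) (x - y))).
  by rewrite mulrC; exact: poisson_cvg fM fL.
by apply/funext => n; exact: poisson_Fubini.
Qed.

Lemma lipschitz_derive f (f' : R -> R) L : (forall x, is_derive x 1 f (f' x)) ->
  (forall x, `|f' x| <= L) -> forall x y, `|f y - f x| <= L * `|y - x|.
Proof.
move=> df f'L x y.
wlog xy : x y / x < y => [hw|].
  have [yx|xy|->] := ltgtP y x.
  - by rewrite distrC (distrC y); exact: hw.
  - exact: hw.
  - by rewrite !subrr normr0 mulr0.
have [c _ ->] := MVT xy (fun x _ => df x)
  (@continuous_subspaceT _ _ _ _ (is_derive_continuous df)).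
by rewrite normrM ler_wpM2r.
Qed.

Lemma dec_lipschitz a f : dec a f -> exists L, forall x y, `|f y - f x| <= L * `|y - x|.
Proof.
move=> df; have [L hL] := dec_decay (decS (leq0n a) (dec_derive1 df)).
exists L; apply: lipschitz_derive (dec_is_derive df) _ => x.
by have := hL x; rewrite expr0 mulr1.
Qed.

Corollary fourier_inversion_dec f x : dec 2 f -> intR (coswave f ^~ x) = 2 * pi * f x.
Proof.
move=> df; have [M fM] := (decay_fast f).1 (dec_decay df).
have [L fL] := dec_lipschitz df.
have sf := dec_integrableR df.
apply: (fourier_inversion (M := M) (L := L)) => //.
- exact: integrableR_measurable.
- by apply: fast_integrableR; [exact: continuous_measurable_fun (continuous_cosft sf)|exact: cosft_fast].
- by apply: fast_integrableR; [exact: continuous_measurable_fun (continuous_sinft sf)|exact: sinft_fast].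
Qed.

End InversionTheorem.

(** * The multipliers in real form *)

Section Multipliers.
Variable R : realType.
Implicit Types (f g h : R -> R) (k x y u e : R).
Local Notation mu := (@lebesgue_measure R).
Local Notation w := (@cauchy_weight R).

Definition sinwave f k x : R := cosft f k * sin (k * x) - sinft f k * cos (k * x).

Let s : R := (Num.sqrt (2 * pi))^-1.

Let pi2_gt0 : 0 < 2 * pi :> R. Proof. by rewrite mulr_gt0// pi_gt0. Qed.

Let s2 : s * s = (2 * pi)^-1.
Proof. by rewrite /s -invfM -expr2 sqr_sqrtr// ltW. Qed.

Lemma fourierE f k : integrableR f ->
  fourier f k = ((s * cosft f k) +i* - (s * sinft f k))%C.
Proof.
move=> sf; rewrite /fourier /cintegral -/s.
have -> : Rintegral mu setT (fun x => complex.Re ((f x)%:C%C * cis (- (k * x)))) = cosft f k.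
  by congr intR; apply/funext => y /=; rewrite mul0r subr0 cosN.
have -> : Rintegral mu setT (fun x => complex.Im ((f x)%:C%C * cis (- (k * x)))) = - sinft f k.
  rewrite /sinft -intRN; last exact: integrableR_sin.
  by congr intR; apply/funext => y /=; rewrite mul0r addr0 sinN mulrN.
by rewrite /GRing.mul/= !mul0r subr0 addr0 mulrN.
Qed.

(** The real form of a multiplier m: with f_k exp(i k x) proportional to
    coswave + i sinwave, only the real part of m (coswave + i sinwave) matters, and
    only for k <> 0. *)
Lemma fmultE (m : R -> R[i]) f x (Q : R -> R) : integrableR f -> integrableR Q ->
  (forall k, k != 0 -> complex.Re (m k * (coswave f k x +i* sinwave f k x)%C) = Q k) ->
  fmult m f x = (2 * pi)^-1 * intR Q.
Proof.
move=> sf sQ mQ; apply/cvg_lim => //.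
have : (2 * pi)^-1 * Rintegral mu [set k | e < `|k|] Q @[e --> 0^'+] --> (2 * pi)^-1 * intR Q.
  by apply: cvgM; [exact: cvg_cst|exact: Rintegral_away_cvg].
apply: cvg_trans; apply: near_eq_cvg; near=> e.
have e0 : 0 < e by near: e; exact: nbhs_right_gt.
rewrite /= -/s mul0r subr0 -s2 -mulrA; congr (_ * _).
rewrite -RintegralZl//; [|exact: measurable_away|by apply: integrableR_on => //; exact: measurable_away].
apply: eq_Rintegral => k; rewrite inE/= => ek.
have k0 : k != 0 by rewrite -normr_gt0 (lt_trans e0).
rewrite -mQ// fourierE//.
have -> : m k * (s * cosft f k +i* - (s * sinft f k))%C * cis (k * x) =
    s%:C%C * (m k * (coswave f k x +i* sinwave f k x)%C).
  rewrite -mulrA [RHS]mulrCA; congr (_ * _).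
  by rewrite /cis /coswave /sinwave; simpc; congr (_ +i* _)%C; ring.
by case: (m k * (coswave f k x +i* sinwave f k x)%C) => a b /=; rewrite mul0r subr0.
Unshelve. all: by end_near. Qed.

Lemma sinwave_derive1 f k x : dec 2 f -> sinwave f^' k x = k * coswave f k x.
Proof. by move=> df; rewrite /sinwave cosft_derive1// sinft_derive1// /coswave; ring. Qed.

Lemma coswave_derive1 f k x : dec 2 f -> coswave f^' k x = - (k * sinwave f k x).
Proof. by move=> df; rewrite /coswave cosft_derive1// sinft_derive1// /sinwave; ring. Qed.

Lemma sinwaveD f g k x : integrableR f -> integrableR g -> sinwave (f + g) k x = sinwave f k x + sinwave g k x.
Proof. by move=> sf sg; rewrite /sinwave cosftD// sinftD//; ring. Qed.

Lemma sinwaveZ c f k x : integrableR f -> sinwave (c *: f) k x = c * sinwave f k x.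
Proof. by move=> sf; rewrite /sinwave cosftZ// sinftZ//; ring. Qed.

(** A majorant of the integrands of all the multipliers that does not depend on x. *)
Definition spectral_bound f k : R := `|cosft f k| + `|sinft f k|.

Lemma normr_sinwave_le f k x : `|sinwave f k x| <= spectral_bound f k.
Proof.
rewrite (le_trans (ler_normB _ _))// !normrM.
by rewrite lerD// ler_piMr// ?normr_sin_le1 ?normr_cos_le1.
Qed.

Lemma normr_coswave_le f k x : `|coswave f k x| <= spectral_bound f k.
Proof.
rewrite (le_trans (ler_normD _ _))// !normrM.
by rewrite lerD// ler_piMr// ?normr_sin_le1 ?normr_cos_le1.
Qed.

Lemma integrableR_cosft f : dec 2 f -> integrableR (cosft f).
Proof.
move=> df; have sf := dec_integrableR df.
by apply: fast_integrableR; [exact: continuous_measurable_fun (continuous_cosft sf)|exact: cosft_fast].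
Qed.

Lemma integrableR_sinft f : dec 2 f -> integrableR (sinft f).
Proof.
move=> df; have sf := dec_integrableR df.
by apply: fast_integrableR; [exact: continuous_measurable_fun (continuous_sinft sf)|exact: sinft_fast].
Qed.

Lemma integrableR_spectral_bound f : dec 2 f -> integrableR (spectral_bound f).
Proof.
move=> df; apply: (@integrableRD _ (fun k => `|cosft f k|) (fun k => `|sinft f k|)).
  exact/integrableR_norm/integrableR_cosft.
exact/integrableR_norm/integrableR_sinft.
Qed.

Lemma continuous_sinwave f x : integrableR f -> continuous (sinwave f ^~ x).
Proof.
move=> sf k; apply: cvgB; apply: cvgM.
- exact: continuous_cosft.
- exact: continuous_sinM.
- exact: continuous_sinft.
- exact: continuous_cosM.
Qed.

Lemma normr_sg_le1 k : `|Num.sg k| <= 1.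
Proof. by rewrite normr_sg; case: eqVneq. Qed.

Lemma measurable_sg : measurable_fun setT (@Num.sg R).
Proof.
rewrite (_ : @Num.sg R = fun x => if x == 0 then 0 else if x < 0 then -1 else 1); last first.
  by apply/funext => x; case: sgrP => x0; rewrite ?eqxx ?x0//; case: ltgtP x0.
apply: measurable_fun_ifT => //; first exact: measurable_fun_eqr.
apply: measurable_fun_ifT => //; exact: measurable_fun_ltr.
Qed.

Lemma integrableR_sg_sinwave f x : dec 2 f -> integrableR (fun k => Num.sg k * sinwave f k x).
Proof.
move=> df; apply: integrableR_le (integrableR_spectral_bound df) _ => [|k].
  apply: measurable_funM; first exact: measurable_sg.
  exact: continuous_measurable_fun (@continuous_sinwave f x (dec_integrableR df)).
by rewrite normrM (le_trans _ (normr_sinwave_le f k x))// ler_piMl// normr_sg_le1.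
Qed.

Lemma hilbertE f x : dec 2 f ->
  hilbert f x = (2 * pi)^-1 * intR (fun k => Num.sg k * sinwave f k x).
Proof.
move=> df; apply: fmultE; [exact: dec_integrableR|exact: integrableR_sg_sinwave|].
by move=> k _; simpc; rewrite /=; ring.
Qed.

Lemma absDE f : dec 2 f -> absD f = hilbert f^'.
Proof.
move=> df; have df' := dec_derive1 df; apply/funext => x; rewrite hilbertE//.
apply: fmultE; [exact: dec_integrableR|exact: integrableR_sg_sinwave|].
move=> k _; rewrite sinwave_derive1// mulrA -normrEsg.
by simpc; rewrite /=; ring.
Qed.

Let iV k : k != 0 -> ('i%C * k%:C%C)^-1 = (0 +i* - k^-1)%C :> R[i].
Proof.
move=> k0; apply: mulr1_eq; simpc; congr (_ +i* _)%C.
by rewrite mulfV.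
Qed.

Let absV k : k != 0 -> (`|k|%:C%C)^-1 = (`|k|^-1)%:C%C :> R[i].
Proof. by move=> k0; apply: mulr1_eq; rewrite -rmorphM/= mulfV ?normr_eq0. Qed.

Lemma dxinvE f x (Q : R -> R) : integrableR f -> integrableR Q ->
  (forall k, k != 0 -> sinwave f k x = k * Q k) ->
  dxinv f x = (2 * pi)^-1 * intR Q.
Proof.
move=> sf sQ fQ; apply: fmultE => // k k0.
by rewrite iV//; simpc => /=; rewrite fQ//; field.
Qed.

(** The factor 1/k cancels the factor k brought by the derivative, and the inversion
    theorem is left. *)
Lemma dxinv_derive1 f : dec 2 f -> dxinv f^' = f.
Proof.
move=> df; have df' := dec_derive1 df; apply/funext => x.
have pi0 : 2 * pi != 0 :> R by rewrite gt_eqF.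
rewrite -[RHS](mulKf pi0) -fourier_inversion_dec//.
apply: dxinvE; first exact: dec_integrableR.
  by apply: integrableR_coswave; [exact: integrableR_cosft|exact: integrableR_sinft].
by move=> k k0; rewrite sinwave_derive1.
Qed.

Lemma absDinvE f x (Q : R -> R) : integrableR f -> integrableR Q ->
  (forall k, k != 0 -> coswave f k x = `|k| * Q k) ->
  absDinv f x = (2 * pi)^-1 * intR Q.
Proof.
move=> sf sQ fQ; apply: fmultE => // k k0.
by rewrite absV//; simpc => /=; rewrite fQ//; field; rewrite normr_eq0.
Qed.

Lemma absDinv_derive1 f : dec 2 f -> absDinv f^' = - hilbert f.
Proof.
move=> df; have df' := dec_derive1 df; apply/funext => x.
rewrite (_ : (- hilbert f) x = - hilbert f x)// hilbertE// -mulrN -intRN; last exact: integrableR_sg_sinwave.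
apply: absDinvE; first exact: dec_integrableR.
  by apply: integrableRN; exact: integrableR_sg_sinwave.
move=> k k0; rewrite coswave_derive1//.
rewrite (_ : (- (fun k => _)) k = - (Num.sg k * sinwave f k x))// mulrN; congr (- _).
by rewrite mulrA normrEsg (mulrC (_ * k)) mulrA -expr2 sqr_sg k0 mul1r.
Qed.

Lemma hilbertD f g : dec 2 f -> dec 2 g -> hilbert (f + g) = hilbert f + hilbert g.
Proof.
move=> df dg; apply/funext => x.
rewrite (_ : (hilbert f + hilbert g) x = hilbert f x + hilbert g x)//.
rewrite !hilbertE//; last exact: decD.
rewrite -mulrDr -intRD; [|exact: integrableR_sg_sinwave..].
congr (_ * intR _); by apply/funext => k; rewrite (sinwaveD _ _ (dec_integrableR df) (dec_integrableR dg)) mulrDr.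
Qed.

Lemma hilbertZ c f : dec 2 f -> hilbert (c *: f) = c *: hilbert f.
Proof.
move=> df; apply/funext => x.
rewrite (_ : (c *: hilbert f) x = c * hilbert f x)//.
rewrite !hilbertE//; last exact: decZ.
rewrite [RHS]mulrCA; congr (_ * _); rewrite -intRZ; last exact: integrableR_sg_sinwave.
congr intR; by apply/funext => k; rewrite (sinwaveZ _ _ _ (dec_integrableR df)) mulrCA.
Qed.

(** Differentiation under the integral sign: the factor k it brings is that of the
    transform of f'. *)
Lemma is_derive_hilbert f x : dec 2 f -> is_derive x 1 (hilbert f) (hilbert f^' x).
Proof.
move=> df; have df' := dec_derive1 df.
rewrite (_ : hilbert f = (2 * pi)^-1 *: (fun x => intR (fun k => Num.sg k * sinwave f k x))); last first.
  by apply/funext => y; rewrite hilbertE.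
rewrite hilbertE//.
have dI : is_derive x 1 (fun x => intR (fun k => Num.sg k * sinwave f k x))
    (intR (fun k => Num.sg k * sinwave f^' k x)).
  apply: (@is_derive_intR _ (fun x k => Num.sg k * sinwave f k x)
    (fun x k => Num.sg k * sinwave f^' k x) (spectral_bound f^')).
  - move=> y k; rewrite sinwave_derive1// /sinwave.
    rewrite (_ : (fun y => _) = fun y => Num.sg k * (cosft f k * sin (y * k) - sinft f k * cos (y * k))); last first.
      by apply/funext => z; rewrite (mulrC k).
    have h1 := is_derive_sinM k y; have h2 := is_derive_cosM k y.
    apply: is_derive_eq; rewrite /GRing.scale/= /coswave (mulrC k y); ring.
  - by move=> y; exact: integrableR_sg_sinwave.
  - exact: integrableR_spectral_bound.
  - by move=> y k; rewrite normrM (le_trans _ (normr_sinwave_le _ k y))// ler_piMl// normr_sg_le1.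
exact: is_deriveZ.
Qed.

Lemma derive1_hilbert f : dec 2 f -> (hilbert f)^' = hilbert f^'.
Proof. by move=> df; apply: is_derive_derive1 => x; exact: is_derive_hilbert. Qed.

Lemma hilbert_bounded f : dec 2 f -> decay 0 (hilbert f).
Proof.
move=> df; exists ((2 * pi)^-1 * intR (spectral_bound f)) => x.
rewrite expr0 mulr1 hilbertE// normrM gtr0_norm ?invr_gt0//.
rewrite ler_pM2l ?invr_gt0//; apply: normr_intR_le.
- exact: integrableR_sg_sinwave.
- exact: integrableR_spectral_bound.
- by move=> k; rewrite normrM (le_trans _ (normr_sinwave_le _ k x))// ler_piMl// normr_sg_le1.
Qed.

Lemma dec_hilbert f : dec 2 f -> dec 0 (hilbert f).
Proof.
move=> + n; elim: n f => [|n IHn] f df.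
  split => //; last exact: hilbert_bounded.
  exact: is_derive_continuous (fun x => is_derive_hilbert x df).
split.
- exact: is_derive_continuous (fun x => is_derive_hilbert x df).
- exact: hilbert_bounded.
- split; last by rewrite derive1_hilbert//; apply: IHn; exact: dec_derive1.
  by move=> x; apply: (@ex_derive _ _ _ _ _ _ _ (is_derive_hilbert x df)).
Qed.

Lemma decay_coswave f x : dec 2 f -> decay 1 (coswave f ^~ x).
Proof.
move=> df; apply: (@decayS _ _ 2) => //.
apply: decayD; apply: decay_Mbounded.
- by move=> k; exact: normr_cos_le1.
- by apply/decay_fast; exact: cosft_fast.
- by move=> k; exact: normr_sin_le1.
- by apply/decay_fast; exact: sinft_fast.
Qed.

(** Multiplication by x is differentiation in frequency:
    x sinwave f - sinwave (y f) is minus the derivative in k of coswave f.  The sign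
    sgn k in front of it makes the integral over the line twice the boundary value at
    k = 0, which is the integral of f. *)
Lemma mulx_hilbert f x : dec 3 f ->
  x * hilbert f x = hilbert (fun y => y * f y) x + pi^-1 * intR f.
Proof.
move=> df; have df2 : dec 2 f by exact: decS df.
have dxf : dec 2 (fun y => y * f y) by exact: dec_mulx.
rewrite !hilbertE// mulrCA -intRZ; last exact: integrableR_sg_sinwave.
have sL := integrableRZ x (integrableR_sg_sinwave x df2); have sR := integrableR_sg_sinwave x dxf.
pose f1 k := x * sinwave f k x - sinwave (fun y => y * f y) k x.
have df1 k : is_derive k 1 (coswave f ^~ x) (- f1 k).
  have h1 := is_derive_cosft k (dec_continuous df) (dec_decay df).
  have h2 := is_derive_sinft k (dec_continuous df) (dec_decay df).
  have h3 := is_derive_cosM x k; have h4 := is_derive_sinM x k.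
  by apply: is_derive_eq; rewrite /GRing.scale/= /f1 /sinwave; ring.
have cf1 : continuous f1.
  move=> k; apply: cvgB; last exact: (@continuous_sinwave _ x (dec_integrableR dxf)).
  by apply: cvgM; [exact: cvg_cst|exact: (@continuous_sinwave _ x (dec_integrableR df2))].
have [l1 l2] := decay_seq_cvg0 (decay_coswave x df2).
have : intR ((x *: (fun k => Num.sg k * sinwave f k x)) - (fun k => Num.sg k * sinwave (fun y => y * f y) k x)) =
    (0 - - coswave f 0 x) + (coswave f 0 x - 0).
  apply: (@intR_FTC2 _ (fun k => - coswave f k x) (coswave f ^~ x) f1 (fun k => - f1 k)).
  - by move=> k; have := df1 k => dk; apply: is_derive_eq; rewrite opprK.
  - exact: cf1.
  - by move=> k; apply: cvgN; exact: cf1.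
  - move=> k k0; rewrite (_ : (_ - _) k = x * (Num.sg k * sinwave f k x) - Num.sg k * sinwave (fun y => y * f y) k x)//.
    by rewrite gtr0_sg// !mul1r.
  - move=> k k0; rewrite (_ : (_ - _) k = x * (Num.sg k * sinwave f k x) - Num.sg k * sinwave (fun y => y * f y) k x)//.
    by rewrite ltr0_sg// /f1; ring.
  - by apply: integrableRD => //; exact: integrableRN.
  - by rewrite -oppr0; apply: cvgN.
  - exact: l2.
rewrite intRD ?intRN//; last exact: integrableRN.
have -> : coswave f 0 x = intR f.
  by rewrite /coswave cosft0 !mul0r cos0 sin0 mulr0 addr0 mulr1.
move=> /eqP; rewrite subr_eq => /eqP ->.
have : pi != 0 :> R by rewrite gt_eqF// pi_gt0.
by move: (pi : R) => p p0; field.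
Qed.

(** The pairing of H(f) with g in frequency space; its antisymmetry in f and g is
    visible. *)
Definition hilbert_form f g k : R := Num.sg k * (cosft f k * sinft g k - sinft f k * cosft g k).

Lemma integrableR_hilbert_form f g : dec 2 f -> dec 2 g -> integrableR (hilbert_form f g).
Proof.
move=> df dg; have sf := dec_integrableR df; have sg := dec_integrableR dg.
have sb := integrableRZ (intR (fun y => `|g y|)) (integrableR_spectral_bound df).
apply: integrableR_le sb _ => [|k].
  apply: measurable_funM; first exact: measurable_sg.
  by apply: measurable_funB; apply: measurable_funM; apply: integrableR_measurable;
    do ?[exact: integrableR_cosft|exact: integrableR_sinft].
rewrite (_ : (_ *: _) k = intR (fun y => `|g y|) * spectral_bound f k)//.
rewrite normrM (le_trans (ler_piMl _ (normr_sg_le1 _)))//.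
rewrite (le_trans (ler_normB _ _))// !normrM mulrDr mulrC lerD// ?[_ * `|cosft g k|]mulrC.
  by rewrite ler_wpM2r// normr_sinft_le.
by rewrite ler_wpM2r// normr_cosft_le.
Qed.

Lemma intR_hilbertM_form f g : dec 2 f -> dec 2 g ->
  intR (hilbert f * g) = (2 * pi)^-1 * intR (hilbert_form f g).
Proof.
move=> df dg; have sg := dec_integrableR dg; have sf := dec_integrableR df.
have sgk y k : integrableR (fun k => g y * (Num.sg k * sinwave f k y)).
  exact: (integrableRZ (g y) (integrableR_sg_sinwave y df)).
have ghE : (fun x => g x * hilbert f x) =
    (2 * pi)^-1 *: (fun x => intR (fun k => g x * (Num.sg k * sinwave f k x))).
  apply/funext => x; rewrite hilbertE// mulrCA; congr (_ * _).
  by rewrite -intRZ//; exact: integrableR_sg_sinwave.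
have mh : measurable_fun [set: measurableTypeR R * measurableTypeR R]
    (fun z => g z.1 * (Num.sg z.2 * sinwave f z.2 z.1)).
  apply: measurable_funM.
    by apply: (measurableT_comp (integrableR_measurable sg)); exact: measurable_fst.
  apply: measurable_funM.
    by apply: (measurableT_comp measurable_sg); exact: measurable_snd.
  apply: measurable_funB; apply: measurable_funM.
  - apply: (measurableT_comp (integrableR_measurable (integrableR_cosft df))); exact: measurable_snd.
  - apply: (measurableT_comp (continuous_measurable_fun (@continuous_sin R))).
    by apply: measurable_funM; [exact: measurable_snd|exact: measurable_fst].
  - apply: (measurableT_comp (integrableR_measurable (integrableR_sinft df))); exact: measurable_snd.
  - apply: (measurableT_comp (continuous_measurable_fun (@continuous_cos R))).
    by apply: measurable_funM; [exact: measurable_snd|exact: measurable_fst].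
have hb x k : `|g x * (Num.sg k * sinwave f k x)| <= `|g x| * spectral_bound f k.
  rewrite normrM ler_wpM2l// normrM (le_trans _ (normr_sinwave_le f k x))//.
  by rewrite ler_piMl// normr_sg_le1.
have smooth : integrableR (fun x => intR (fun k => g x * (Num.sg k * sinwave f k x))).
  have := integrableRZ (2 * pi) (dec_integrableR (decM dg (dec_hilbert df))).
  by rewrite (_ : g * hilbert f = (fun x => g x * hilbert f x))// ghE scalerA mulfV ?scale1r// gt_eqF.
rewrite mulrC (_ : g * hilbert f = (fun x => g x * hilbert f x))// ghE intRZ//.
congr (_ * _).
rewrite (intR_Fubini mh (integrableR_norm sg) (integrableR_spectral_bound df) hb).
congr intR; apply/funext => k; rewrite /hilbert_form /sinwave /cosft /sinft -/(cosft f k) -/(sinft f k).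
have -> : (fun x => g x * (Num.sg k * (cosft f k * sin (k * x) - sinft f k * cos (k * x)))) =
    (Num.sg k * cosft f k) *: (fun x => g x * sin (k * x)) + (- (Num.sg k * sinft f k)) *: (fun x => g x * cos (k * x)).
  apply/funext => x; rewrite (_ : (_ + _) x = (Num.sg k * cosft f k) * (g x * sin (k * x)) + - (Num.sg k * sinft f k) * (g x * cos (k * x)))//.
  by ring.
rewrite intRD ?intRZ -/(cosft g k) -/(sinft g k); first ring.
- exact: integrableR_cos.
- exact: integrableR_sin.
- by apply: integrableRZ; exact: integrableR_sin.
- by apply: integrableRZ; exact: integrableR_cos.
Qed.

Lemma intR_hilbertM f g : dec 2 f -> dec 2 g ->
  intR (hilbert f * g) = - intR (f * hilbert g).
Proof.
move=> df dg; rewrite [f * _]mulrC !intR_hilbertM_form// -mulrN -intRN.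
  congr (_ * intR _); apply/funext => k.
  by rewrite (_ : (- hilbert_form _ _) k = - hilbert_form g f k)// /hilbert_form; ring.
exact: integrableR_hilbert_form.
Qed.

End Multipliers.

(** * Decay of Hilbert transforms *)

Section NonlocalOperators.
Variable R : realType.
Implicit Types (f g h p : R -> R) (k x y u e : R) (a n : nat).
Local Notation mu := (@lebesgue_measure R).
Local Notation w := (@cauchy_weight R).

Lemma derive1_mulx a p : dec a.+1 p ->
  (fun y => y * p y)^' = p + (fun y => y * p^' y).
Proof.
move=> dp; apply: is_derive_derive1 => x; have dp1 := dec_is_derive dp x.
apply: is_derive_eq.
by rewrite (_ : (p + _) x = p x + x * p^' x)// /GRing.scale/= mulr1 addrC.
Qed.

(** One power of decay is gained if x H(f) = H(x f) + const decays like H(f). *)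
Lemma decay_hilbert_step a f : dec 3 f ->
  decay a (hilbert f) -> decay a (hilbert (fun y => y * f y) + cst (pi^-1 * intR f)) ->
  decay a.+1 (hilbert f).
Proof.
move=> rf [C hC] [D hD]; exists (C + D) => x.
rewrite exprS mulrA mulrDr mulr1 mulrDl lerD//.
rewrite -normrM [hilbert f x * x]mulrC mulx_hilbert//.
exact: hD.
Qed.

(** As H commutes with derivatives, decay of all derivatives of H(f) follows from
    decay of H on a family of functions stable under differentiation. *)
Lemma dec_hilbert_stable a (P : (R -> R) -> Prop) :
  (forall f, P f -> [/\ dec 2 f, decay a (hilbert f) & P f^']) ->
  forall f, P f -> dec a (hilbert f).
Proof.
move=> hP f Pf n; elim: n f Pf => [|n IHn] f Pf; have [df fa Pf'] := hP f Pf;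
  have d0 := dec_hilbert df.
  by split => //; exact: dec_continuous d0.
split => //; first exact: dec_continuous d0.
split; first exact: dec_derivable d0.
by rewrite derive1_hilbert//; exact: IHn.
Qed.

Lemma decay_hilbert1 p : dec 3 p -> decay 1 (hilbert p).
Proof.
move=> rp; apply: decay_hilbert_step => //; first by apply/dec_decay/dec_hilbert/(decS _ rp).
by apply: decayD; [exact/dec_decay/dec_hilbert/dec_mulx|exact: decay_cst].
Qed.

Lemma decay_hilbert_mean0 a f : rapid f -> intR f = 0 ->
  decay a (hilbert f) -> decay a (hilbert (fun y => y * f y)) ->
  decay a.+1 (hilbert f).
Proof.
move=> rf f0 ha hb; apply: decay_hilbert_step => //.
rewrite f0 mulr0 (_ : _ + cst 0 = hilbert (fun y => y * f y))//.
exact: addr0.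
Qed.

Lemma rapid_intR_derive1 p : rapid p -> intR p^' = 0.
Proof. by move=> rp; exact: intR_derive1. Qed.

Lemma decay_hilbert2 p : rapid p -> decay 2 (hilbert p^').
Proof.
move=> rp; have rp' := rapid_derive1 rp; apply: decay_hilbert_mean0 => //.
- exact: rapid_intR_derive1.
- exact: decay_hilbert1.
- exact/decay_hilbert1/rapid_mulx.
Qed.

(** The second moment condition is used through y p'' = (y p' - p)', which brings
    back the case of a first derivative. *)
Lemma decay_hilbert3 p : rapid p -> decay 3 (hilbert p^'^').
Proof.
move=> rp; have rp' := rapid_derive1 rp; have rp'' := rapid_derive1 rp'.
apply: decay_hilbert_mean0 => //.
- exact: rapid_intR_derive1.
- exact: decay_hilbert2.
have rxp := rapid_mulx rp'.
have -> : (fun y => y * p^'^' y) = ((fun y => y * p^' y) - p)^'.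
  rewrite (@derive1D _ _ (- p)); [|exact: dec_derivable (rxp 0%N)|exact: dec_derivable (rapidN rp 0%N)].
  rewrite (derive1_mulx (rp' 1%N)) -scaleN1r (derive1Z _ (rp 0%N)) scaleN1r.
  by rewrite addrC addKr.
by apply: decay_hilbert2; apply: rapidD => //; exact: rapidN.
Qed.

Lemma dec_hilbert1 p : rapid p -> dec 1 (hilbert p).
Proof.
apply: (dec_hilbert_stable (P := @rapid R)) => f rf.
by split => //; [exact: decay_hilbert1|exact: rapid_derive1].
Qed.

Lemma dec_hilbert2 p : rapid p -> dec 2 (hilbert p^').
Proof.
move=> rp; apply: (dec_hilbert_stable (P := fun f => exists2 q, rapid q & f = q^')); last by exists p.
move=> _ [q rq ->]; split; first exact: rapid_derive1 rq 2%N.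
  exact: decay_hilbert2.
by exists q^' => //; exact: rapid_derive1.
Qed.

Lemma dec_hilbert3 p : rapid p -> dec 3 (hilbert p^'^').
Proof.
move=> rp; apply: (dec_hilbert_stable (P := fun f => exists2 q, rapid q & f = q^'^')); last by exists p.
move=> _ [q rq ->]; split; first exact: rapid_derive1 (rapid_derive1 rq) 2%N.
  exact: decay_hilbert3.
by exists q^' => //; exact: rapid_derive1.
Qed.

Lemma intR_odd f : continuous f -> integrableR f -> (forall x, f (- x) = - f x) ->
  intR f = 0.
Proof.
move=> cf sf fN; have E : (fun x => f (- x)) = - f by apply/funext => x; rewrite fN.
have := intR_reflect cf sf; rewrite E intRN// => /(_ (integrableRN sf))/eqP.
by rewrite eq_sym -addr_eq0 -mulr2n mulrn_eq0 => /= /eqP.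
Qed.

Lemma cosft_odd f x : continuous f -> integrableR f -> (forall k, f (- k) = - f k) -> cosft f x = 0.
Proof.
move=> cf sf fN; apply: intR_odd; last by move=> k; rewrite fN mulrN cosN mulNr.
  by move=> k; apply: cvgM; [exact: cf|exact: continuous_cosMr].
exact: integrableR_cos.
Qed.

Lemma sinft_even f x : continuous f -> integrableR f -> (forall k, f (- k) = f k) -> sinft f x = 0.
Proof.
move=> cf sf fN; apply: intR_odd; last by move=> k; rewrite fN mulrN sinN mulrN.
  by move=> k; apply: cvgM; [exact: cf|exact: continuous_sinMr].
exact: integrableR_sin.
Qed.

(** The function |k| g(k) is not differentiable at 0, but it is Lipschitz at every
    point, which is what the inversion theorem asks. *)
Lemma lipschitz_normM g x M L : (forall y, `|g y| <= M) ->
  (forall y, `|g y - g x| <= L * `|y - x|) ->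
  forall y, `| `|y| * g y - `|x| * g x| <= (M + `|x| * L) * `|y - x|.
Proof.
move=> gM gL y.
have -> : `|y| * g y - `|x| * g x = (`|y| - `|x|) * g y + `|x| * (g y - g x) by ring.
rewrite (le_trans (ler_normD _ _))// !normrM normr_id mulrDl lerD//.
  by rewrite mulrC ler_pM// ler_dist_dist.
by rewrite -mulrA ler_wpM2l.
Qed.

(** * The inverse derivative of a Hilbert transform *)

Section HilbertDerivative.
Variable p : R -> R.
Hypothesis rp : rapid p.
Let rp' : rapid p^'. Proof. exact: rapid_derive1. Qed.
Let sp : integrableR p. Proof. exact: rapid_integrableR. Qed.
Let s k := `|k| * cosft p k.
Let c k := `|k| * sinft p k.
Let u := hilbert p^'.

Let cs : continuous s.
Proof. by move=> k; apply: cvgM; [exact: (@norm_continuous _ R^o)|exact: continuous_cosft]. Qed.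

Let cc : continuous c.
Proof. by move=> k; apply: cvgM; [exact: (@norm_continuous _ R^o)|exact: continuous_sinft]. Qed.

Let fast_s : fast s.
Proof.
have [M hM] := sinft_fast (rp' 2%N); exists M => k; apply: le_trans (hM k).
by rewrite sinft_derive1 ?normrN ?normrM ?normr_id//; exact: rp.
Qed.

Let fast_c : fast c.
Proof.
have [M hM] := cosft_fast (rp' 2%N); exists M => k; apply: le_trans (hM k).
by rewrite cosft_derive1 ?normrM ?normr_id//; exact: rp.
Qed.

Let ss : integrableR s.
Proof. by apply: fast_integrableR => //; exact: continuous_measurable_fun. Qed.

Let sc : integrableR c.
Proof. by apply: fast_integrableR => //; exact: continuous_measurable_fun. Qed.

Let sN k : s (- k) = s k. Proof. by rewrite /s normrN cosftN. Qed.
Let cN k : c (- k) = - c k. Proof. by rewrite /c normrN sinftN// mulrN. Qed.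

Let uE x : u x = (2 * pi)^-1 * (cosft s x + sinft c x).
Proof.
rewrite /u hilbertE; last exact: rp'.
rewrite /cosft /sinft -intRD; [|exact: integrableR_cos|exact: integrableR_sin].
congr (_ * intR _); apply/funext => k.
rewrite (_ : (_ + _) k = s k * cos (x * k) + c k * sin (x * k))//.
rewrite sinwave_derive1; last exact: rp.
by rewrite mulrA -normrEsg /coswave /s /c (mulrC x); ring.
Qed.

Let du : dec 2 u. Proof. exact: dec_hilbert2. Qed.

Let pi2_neq0 : 2 * pi != 0 :> R. Proof. by rewrite gt_eqF// mulr_gt0// pi_gt0. Qed.

Let ctsE x : cosft s x = pi * (u x + u (- x)).
Proof.
rewrite !uE cosftN sinftN//; have := pi2_neq0; move: (pi : R) => q q0.
by field; apply: contra_neq q0 => ->; rewrite mulr0.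
Qed.

Let stcE x : sinft c x = pi * (u x - u (- x)).
Proof.
rewrite !uE cosftN sinftN//; have := pi2_neq0; move: (pi : R) => q q0.
by field; apply: contra_neq q0 => ->; rewrite mulr0.
Qed.

Let su : integrableR u. Proof. exact: dec_integrableR. Qed.
Let suN : integrableR (fun x => u (- x)). Proof. by apply: dec_integrableR; exact: dec_reflect. Qed.

Let scts : integrableR (cosft s).
Proof.
rewrite (_ : cosft s = pi *: (u + (fun x => u (- x)))).
  by apply/integrableRZ/integrableRD.
by apply/funext => x; rewrite ctsE.
Qed.

Let sstc : integrableR (sinft c).
Proof.
rewrite (_ : sinft c = pi *: (u - (fun x => u (- x)))).
  by apply/integrableRZ/integrableRD => //; exact: integrableRN.
by apply/funext => x; rewrite stcE.
Qed.

Let lip_s x : exists L, forall y, `|s y - s x| <= L * `|y - x|.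
Proof.
have [M hM] : exists M, forall y, `|cosft p y| <= M.
  by exists (intR (fun y => `|p y|)) => y; exact: normr_cosft_le.
have := lipschitz_derive (fun k => is_derive_cosft k (dec_continuous (rp 3%N)) (dec_decay (rp 3%N))).
move=> /(_ (intR (fun y => `|y * p y|))) hL; eexists; apply: lipschitz_normM hM _ => y.
by apply: hL => k; rewrite normrN; apply: normr_sinft_le; exact/rapid_integrableR/rapid_mulx.
Qed.

Let lip_c x : exists L, forall y, `|c y - c x| <= L * `|y - x|.
Proof.
have [M hM] : exists M, forall y, `|sinft p y| <= M.
  by exists (intR (fun y => `|p y|)) => y; exact: normr_sinft_le.
have := lipschitz_derive (fun k => is_derive_sinft k (dec_continuous (rp 3%N)) (dec_decay (rp 3%N))).
move=> /(_ (intR (fun y => `|y * p y|))) hL; eexists; apply: lipschitz_normM hM _ => y.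
by apply: hL => k; apply: normr_cosft_le; exact/rapid_integrableR/rapid_mulx.
Qed.

Let ctct x : cosft (cosft s) x = 2 * pi * s x.
Proof.
have [M hM] := fast_s; have [L hL] := lip_s x.
rewrite -(fourier_inversion (integrableR_measurable ss) hM hL scts); last first.
  rewrite (_ : sinft s = cst 0); last by apply/funext => y; exact: sinft_even.
  exact: dec_integrableR (@dec0 R 2).
congr intR; apply/funext => k; rewrite /coswave (sinft_even k cs ss sN) mul0r addr0.
by rewrite (mulrC x).
Qed.

Let stst x : sinft (sinft c) x = 2 * pi * c x.
Proof.
have [M hM] := fast_c; have [L hL] := lip_c x.
rewrite -(fourier_inversion (integrableR_measurable sc) hM hL _ sstc); last first.
  rewrite (_ : cosft c = cst 0); last by apply/funext => y; exact: cosft_odd.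
  exact: dec_integrableR (@dec0 R 2).
congr intR; apply/funext => k; rewrite /coswave (cosft_odd k cc sc cN) mul0r add0r.
by rewrite (mulrC x).
Qed.

Let uE' : u = (2 * pi)^-1 *: (cosft s + sinft c).
Proof. by apply/funext => x; rewrite uE. Qed.

(** Together with the next lemma: the transform of H(p') is - i sgn k times that of
    p'.  By definition u = H(p') is an inverse transform, u = (cosft s + sinft c) /
    (2 pi) with s even and c odd; inversion applied to s and c gives the transform of
    u back, the mixed terms vanishing by parity.  This needs the integrability of
    cosft s and sinft c, which are 2 pi times the even and odd parts of u. *)
Lemma cosft_hilbert_derive1 k : cosft u k = s k.
Proof.
rewrite uE' cosftZ; last exact: integrableRD.
rewrite cosftD// ctct (cosft_odd _ (continuous_sinft sc) sstc) ?addr0 ?mulKf//.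
by move=> x; rewrite sinftN.
Qed.

Lemma sinft_hilbert_derive1 k : sinft u k = c k.
Proof.
rewrite uE' sinftZ; last exact: integrableRD.
rewrite sinftD// stst (sinft_even _ (continuous_cosft ss) scts) ?add0r ?mulKf//.
by move=> x; rewrite cosftN.
Qed.

(** Both sides have the same expression in frequency, by the previous two lemmas.
    The rule for derivatives does not apply, because H(p) is in general not
    integrable. *)
Lemma dxinv_hilbert_derive1 : dxinv (hilbert p^') = hilbert p.
Proof.
apply/funext => x; rewrite [RHS]hilbertE; last exact: rp.
apply: dxinvE; [exact: su|by apply: integrableR_sg_sinwave; exact: rp|].
move=> k _; rewrite /sinwave -/u cosft_hilbert_derive1 sinft_hilbert_derive1 /s /c normrEsg.
by ring.
Qed.

End HilbertDerivative.

End NonlocalOperators.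

(** * The inverse derivative of a function of nonzero mean *)

Section InverseDerivative.
Variable R : realType.
Implicit Types (f g h p : R -> R) (k x y u e : R) (a n : nat).
Local Notation mu := (@lebesgue_measure R).
Local Notation w := (@cauchy_weight R).

(** The inverse is the pointwise limit of k / (k^2 + 1/n), which also gives the value
    0 at k = 0. *)
Lemma measurable_invr : measurable_fun setT (fun k : R => k^-1).
Proof.
pose e n : R := n.+1%:R^-1.
have e0 n : 0 < e n by rewrite invr_gt0.
have pos n k : k ^+ 2 + e n != 0 by rewrite gt_eqF// ltr_wpDl ?sqr_ge0.
have sqc k : z ^+ 2 @[z --> k] --> k ^+ 2.
  rewrite expr2; under eq_fun do rewrite expr2.
  by apply: cvgM; exact: cvg_id.
apply: (@measurable_fun_cvg _ _ _ _ (fun n k => k / (k ^+ 2 + e n))).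
  move=> n; apply: continuous_measurable_fun => k.
  apply: cvgM; first exact: cvg_id.
  by apply: cvgV => //; apply: cvgD; [exact: sqc|exact: cvg_cst].
move=> k _; have [->|k0] := eqVneq k 0.
  by under eq_fun do rewrite mul0r; rewrite invr0; exact: cvg_cst.
rewrite (_ : k^-1 = k * (k ^+ 2 + 0)^-1); last by rewrite addr0; field.
apply: cvgM; first exact: cvg_cst.
apply: cvgV; first by rewrite addr0 expf_neq0.
by apply: cvgD; [exact: cvg_cst|exact: cvg_harmonic].
Qed.

Lemma intR_eq_away0 f g : integrableR f -> integrableR g ->
  (forall k, k != 0 -> f k = g k) -> intR f = intR g.
Proof.
move=> sf sg fg; apply: cvg_unique (Rintegral_away_cvg sf) _ => //.
apply: cvg_trans (Rintegral_away_cvg sg); apply: near_eq_cvg; near=> e.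
have e0 : 0 < e by near: e; exact: nbhs_right_gt.
apply: eq_Rintegral => k; rewrite inE/= => ek; apply/esym/fg.
by rewrite -normr_gt0 (lt_trans e0).
Unshelve. all: by end_near. Qed.

Let pi2_gt0 : 0 < 2 * pi :> R. Proof. by rewrite mulr_gt0// pi_gt0. Qed.

Section AntiDerivative.
Variable f : R -> R.
Hypothesis df : dec 4 f.
Let df3 : dec 3 f. Proof. exact: decS df. Qed.
Let df2 : dec 2 f. Proof. exact: decS df. Qed.
Let sf : integrableR f. Proof. exact: dec_integrableR. Qed.

Let normr_sin_le k : `|sin k| <= `|k|.
Proof.
have := @lipschitz_derive R sin cos 1 (fun x => is_derive_sin x) (@normr_cos_le1 R) 0 k.
by rewrite sin0 !subr0 mul1r.
Qed.

Let bound x : R := `|x| * intR (fun y => `|f y|) + intR (fun y => `|y * f y|).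

(* The integrand sinwave f k x / k is bounded near k = 0 although f may have a
   nonzero mean: f_0 / (i k), the singular part of f_k / (i k), is purely imaginary. *)
Let normr_sinwave_small k x : `|sinwave f k x| <= bound x * `|k|.
Proof.
have sxf : integrableR (fun y => y * f y) by apply/dec_integrableR/dec_mulx.
have st_lip : `|sinft f k| <= intR (fun y => `|y * f y|) * `|k|.
  have := lipschitz_derive (fun k => is_derive_sinft k (dec_continuous df3) (dec_decay df3)).
  move=> /(_ (intR (fun y => `|y * f y|)) _ 0 k); rewrite sinft0 !subr0; apply => z.
  exact: normr_cosft_le.
rewrite (le_trans (ler_normB _ _))// !normrM /bound mulrDl lerD//.
  apply: le_trans (ler_pM _ _ (normr_cosft_le k sf) (normr_sin_le (k * x))) _ => //.
  by rewrite normrM le_eqVlt; apply/orP; left; apply/eqP; ring.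
by rewrite (le_trans (ler_piMr _ (normr_cos_le1 _))).
Qed.

Let quot x k : R := sinwave f k x * k^-1.

Let bound_ge0 x : 0 <= bound x.
Proof. by rewrite addr_ge0// ?mulr_ge0// Rintegral_ge0. Qed.

Let normr_mulV_le1 k : `|k * k^-1| <= 1.
Proof. by have [->|k0] := eqVneq k 0; rewrite ?mul0r ?normr0// mulfV// normr1. Qed.

Let squot x : integrableR (quot x).
Proof.
have sb := integrableRD (integrableRZ (2 * bound x) (integrableR_cauchy_weight R)) (integrableR_spectral_bound df2).
apply: integrableR_le sb _ => [|k].
  apply: measurable_funM; last exact: measurable_invr.
  exact: continuous_measurable_fun (@continuous_sinwave R f x sf).
rewrite (_ : (_ + _) k = 2 * bound x * w k + spectral_bound f k)//.
have w0 := cauchy_weight_gt0 k.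
have sb0 : 0 <= spectral_bound f k by rewrite addr_ge0.
have [k1|k1] := lerP `|k| 1.
  apply: (@le_trans _ _ (bound x)).
    rewrite /quot normrM (le_trans (ler_wpM2r _ (normr_sinwave_small k x)))//.
    by rewrite -mulrA -normrM ler_piMr.
  rewrite -[leLHS]addr0 lerD// mulrAC ler_peMl// /cauchy_weight.
  rewrite ler_pdivlMr ?mul1r ?ltr_wpDr ?sqr_ge0//.
  have : k ^+ 2 <= 1 by rewrite -[k ^+ 2]real_normK ?num_real// expr_le1.
  lra.
rewrite -[leLHS]add0r lerD// ?mulr_ge0//; first exact: ltW.
rewrite /quot normrM (le_trans _ (normr_sinwave_le f k x))// ler_piMr// normfV.
by rewrite invf_le1 ?ltW// (lt_trans _ k1).
Qed.

Let dxinvQ x : dxinv f x = (2 * pi)^-1 * intR (quot x).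
Proof. by apply: dxinvE => // k k0; rewrite /quot mulrC divfK. Qed.

(** Differentiating under the integral sign leaves the inversion integral of f, up to
    the value of the integrand at k = 0. *)
Lemma is_derive_dxinv x : is_derive x 1 (dxinv f) (f x).
Proof.
have pi0 : 2 * pi != 0 :> R by rewrite gt_eqF.
rewrite (_ : dxinv f = (2 * pi)^-1 *: (fun x => intR (quot x))); last first.
  by apply/funext => y; rewrite dxinvQ.
have -> : f x = (2 * pi)^-1 * intR (coswave f ^~ x).
  by rewrite fourier_inversion_dec// mulKf.
pose quot' y k := k * coswave f k y * k^-1.
have sfc y : integrableR (coswave f ^~ y) by apply: integrableR_coswave; [exact: integrableR_cosft|exact: integrableR_sinft].
have quot'_le y k : `|quot' y k| <= spectral_bound f k.
  by rewrite /quot' mulrAC normrM (le_trans _ (normr_coswave_le f k y))// ler_piMl.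
have -> : intR (coswave f ^~ x) = intR (quot' x).
  apply: intR_eq_away0 => //; last by move=> k k0; rewrite /quot' mulrAC mulfV// mul1r.
  apply: integrableR_le (integrableR_spectral_bound df2) (quot'_le x).
  apply: measurable_funM; last exact: measurable_invr.
  by apply: measurable_funM => //; exact: integrableR_measurable (sfc x).
have dI : is_derive x 1 (fun x => intR (quot x)) (intR (quot' x)).
  apply: (@is_derive_intR _ quot quot' (spectral_bound f)).
  - move=> y k; rewrite /quot' /quot /sinwave /coswave.
    rewrite (_ : (fun y => _) = fun y => (cosft f k * sin (y * k) - sinft f k * cos (y * k)) * k^-1); last first.
      by apply/funext => z; rewrite (mulrC k).
    have h1 := is_derive_sinM k y; have h2 := is_derive_cosM k y.
    by apply: is_derive_eq; rewrite /GRing.scale/= (mulrC k y); ring.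
  - exact: squot.
  - exact: integrableR_spectral_bound.
  - exact: quot'_le.
exact: is_deriveZ.
Qed.

(** The inverse derivative differs from the primitive vanishing at -oo by a constant. *)
Lemma dec_dxinv : dec 0 (dxinv f).
Proof.
have dP := is_derive_primitive (dec_continuous df) sf.
have dD x : is_derive x 1 (dxinv f - primitive f) 0.
  have h := is_derive_dxinv x; have h' := dP x.
  by apply: is_derive_eq; rewrite subrr.
apply: (dec_intro_is_derive is_derive_dxinv); last exact: decS df.
exists (intR (fun y => `|f y|) + `|(dxinv f - primitive f) 0|) => x.
rewrite expr0 mulr1.
have -> : dxinv f x = primitive f x + (dxinv f - primitive f) 0.
  by rewrite (is_derive_0_is_cst 0 x dD) addrC subrK.
rewrite (le_trans (ler_normD _ _))// lerD//.
rewrite /primitive Rintegral_mkcond; apply: normr_intR_le.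
- have mx : measurable [set` `]-oo, x]] by [].
  apply: integrableR_le (integrableR_norm sf) _ => [|y].
    by apply/(measurable_restrictT _ mx); exact: measurable_funTS (integrableR_measurable sf).
  by rewrite patchE; case: ifP => // _; rewrite normr0.
- exact: integrableR_norm.
- by move=> y; rewrite patchE; case: ifP => // _; rewrite normr0.
Qed.

(** With fN(x) = f(- x) one has d^-1 fN (x) = - d^-1 f (- x), so the sum is
    d^-1 (f - fN).  This function has zero mean, so the sum is its primitive, which
    tends to 0. *)
Lemma dxinv_sym_cvg0 : dxinv f x + dxinv f (- x) @[x --> +oo] --> (0 : R).
Proof.
pose fN x := f (- x).
have dfN : dec 4 fN by exact: dec_reflect.
have sfN : integrableR fN by apply/dec_integrableR/(decS _ dfN).
pose q := primitive (f - fN).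
have int0 : intR (f - fN) = 0.
  rewrite intRD ?intRN//; last exact: integrableRN.
  by rewrite (intR_reflect (dec_continuous df))// subrr.
have dq : dec 2 q by apply: dec_primitive => //; exact: decB.
have q' : q^' = f - fN by apply: (@derive1_primitive _ 2); exact: decB.
have -> : (fun x => dxinv f x + dxinv f (- x)) = q.
  apply/funext => x; rewrite -(dxinv_derive1 dq) q' !dxinvQ -mulrDr -intRD//.
  apply/esym/dxinvE; [by apply: integrableRD => //; exact: integrableRN|exact: integrableRD|].
  move=> k k0; rewrite (_ : (_ + _) k = quot x k + quot (- x) k)// /quot -mulrDl mulrC divfK//.
  have ctfN : cosft fN k = cosft f k by apply: cosft_reflect => //; exact: (dec_continuous df).
  have stfN : sinft fN k = - sinft f k by apply: sinft_reflect => //; exact: (dec_continuous df).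
  rewrite /sinwave cosftD ?sinftD//; try exact: integrableRN.
  by rewrite -scaleN1r cosftZ// sinftZ// ctfN stfN !mulrN sinN cosN; ring.
by have [] := decay_cvg0 (dec_decay (decS _ dq)).
Qed.

End AntiDerivative.

Lemma derive1_dxinv f : dec 4 f -> (dxinv f)^' = f.
Proof. by move=> df; apply: is_derive_derive1; exact: is_derive_dxinv. Qed.

End InverseDerivative.

(** * First variations and functions of zero integral *)

Section FirstVariation.
Variable R : realType.
Implicit Types (f h p q u v : R -> R) (x e c : R) (a : nat).

(** The coefficients of a cubic polynomial are combinations of its values at -1, 0, 1
    and 2.  Their integrability is thus inherited from the integrand, and only the
    first-order coefficient has to be known. *)
Lemma is_derive_cubic (I : R -> R -> R) (k1 : R -> R) :
  (forall e, integrableR (I e)) ->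
  (forall x, exists k : R * R * R, forall e,
     I e x = k.1.1 + e * k1 x + e ^+ 2 * k.1.2 + e ^+ 3 * k.2) ->
  is_derive (0 : R) (1 : R) (fun e => intR (I e)) (intR k1).
Proof.
move=> sI /choice[k kE].
pose k2 x := (k x).1.2; pose k3 x := (k x).2.
have IE e x : I e x = I 0 x + e * k1 x + e ^+ 2 * k2 x + e ^+ 3 * k3 x.
  by rewrite !kE -/(k2 x) -/(k3 x); ring.
have s3 : integrableR k3.
  have -> : k3 = 6^-1 *: (I 2 + (-3) *: I 1 + 3 *: I 0 - I (-1)).
    apply/funext => x.
    rewrite (_ : (6^-1 *: _) x = 6^-1 * (I 2 x + (-3) * I 1 x + 3 * I 0 x - I (-1) x))//.
    by rewrite (IE 2) (IE 1) (IE (-1)); field.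
  by apply: integrableRZ; do ?[apply: integrableRD|apply: integrableRN|apply: integrableRZ].
have s2 : integrableR k2.
  have -> : k2 = 2^-1 *: (I 1 + I (-1)) - I 0.
    apply/funext => x; rewrite (_ : (_ - _) x = 2^-1 * (I 1 x + I (-1) x) - I 0 x)//.
    by rewrite (IE 1) (IE (-1)); field.
  by do ?[apply: integrableRD|apply: integrableRN|apply: integrableRZ].
have s1 : integrableR k1.
  have -> : k1 = I 1 - I 0 - k2 - k3.
    apply/funext => x; rewrite (_ : (_ - k3) x = I 1 x - I 0 x - k2 x - k3 x)//.
    by rewrite (IE 1); ring.
  by do ?[apply: integrableRD|apply: integrableRN|apply: integrableRZ].
have JE : (fun e => intR (I e)) = fun e => intR (I 0) + e * intR k1 +
    e ^+ 2 * intR k2 + e ^+ 3 * intR k3.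
  apply/funext => e.
  have -> : I e = I 0 + e *: k1 + e ^+ 2 *: k2 + e ^+ 3 *: k3.
    by apply/funext => x; rewrite IE.
  by rewrite !intRD ?intRZ//; do ?[apply: integrableRD|apply: integrableRZ].
rewrite JE; apply: is_derive_eq.
by rewrite /GRing.scale/=; ring.
Qed.

(** The functions by which an integrand may be modified.  The lemmas below express in
    this form the adjoint of each operator. *)
Definition null u : Prop := integrableR u /\ intR u = 0.

Lemma nullD u v : null u -> null v -> null (u + v).
Proof. by move=> [su u0] [sv v0]; split; [exact: integrableRD|rewrite intRD// u0 v0 addr0]. Qed.

Lemma nullZ c u : null u -> null (c *: u).
Proof. by move=> [su u0]; split; [exact: integrableRZ|rewrite intRZ// u0 mulr0]. Qed.

Lemma intR_null u v h : integrableR v -> null h -> (forall x, u x = v x + h x) ->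
  intR u = intR v.
Proof.
move=> sv [sh h0] uvh; have -> : u = v + h by apply/funext.
by rewrite intRD// h0 addr0.
Qed.

Lemma decMl a f h : dec a f -> dec 0 h -> dec a (f * h).
Proof. by move=> df dh; rewrite -(addn0 a); exact: decM. Qed.

Lemma decMr a f h : dec 0 f -> dec a h -> dec a (f * h).
Proof. by move=> df dh; rewrite -(add0n a); exact: decM. Qed.

Lemma dec_sqr a f : dec a f -> dec a (f ^+ 2).
Proof. by move=> df; rewrite expr2; apply: decMl => //; exact: decS df. Qed.

Lemma rapid_sqr f : rapid f -> rapid (f ^+ 2).
Proof. by move=> rf a; exact: dec_sqr. Qed.

Lemma null_hilbert q f : dec 2 q -> dec 2 f -> null (hilbert q * f + q * hilbert f).
Proof.
move=> dq df.
have s1 : integrableR (hilbert q * f) by apply/dec_integrableR/decMr => //; exact: dec_hilbert.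
have s2 : integrableR (q * hilbert f) by apply/dec_integrableR/decMl => //; exact: dec_hilbert.
by split; [exact: integrableRD|rewrite intRD// intR_hilbertM// addNr].
Qed.

Lemma null_derive1 f h : dec 2 f -> dec 0 h -> null (f^' * h + f * h^').
Proof.
move=> df dh; have dfh := decMl df dh.
rewrite -derive1M; [|exact: dec_derivable df|exact: dec_derivable dh].
by split; [exact/dec_integrableR/dec_derive1|exact: intR_derive1].
Qed.

(** The operator |D| = H d/dx is symmetric. *)
Lemma null_hilbert_derive1 q f : dec 2 q -> dec 2 f ->
  null (hilbert q^' * f - q * hilbert f^').
Proof.
move=> dq df; have n1 := null_hilbert (dec_derive1 dq) df.
have n2 := null_derive1 dq (dec_hilbert df).
have := nullD n1 (nullZ (-1) n2); congr null; apply/funext => x.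
rewrite derive1_hilbert//.
change (hilbert q^' x * f x + q^' x * hilbert f x +
  -1 * (q^' x * hilbert f x + q x * hilbert f^' x) =
  hilbert q^' x * f x - q x * hilbert f^' x).
move: (hilbert q^' x) (hilbert f^' x) (hilbert f x) (q^' x) (q x) (f x).
by move=> *; ring.
Qed.

Lemma null_dxinv q f : dec 2 q -> dec 4 f -> null (q^' * dxinv f + q * f).
Proof.
by move=> dq df; have := null_derive1 dq (dec_dxinv df); rewrite derive1_dxinv.
Qed.

(** With q' = phi and f' = h this is the symmetry of |D|^-1 = - H d^-1 between phi
    and h. *)
Lemma null_absDinv q f h : dec 2 q -> dec 2 f -> f^' = h ->
  null (hilbert q * h + q^' * absDinv h).
Proof.
move=> dq df <-; rewrite absDinv_derive1// mulrN.
have n1 := null_hilbert_derive1 df dq.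
have n2 := null_hilbert dq (dec_derive1 df).
have n3 := null_derive1 dq (dec_hilbert df).
have := nullD n2 (nullZ (-1) n3); congr null; apply/funext => x.
rewrite derive1_hilbert//.
change (hilbert q x * f^' x + q x * hilbert f^' x +
  -1 * (q^' x * hilbert f x + q x * hilbert f^' x) =
  hilbert q x * f^' x - q^' x * hilbert f x).
move: (hilbert q x) (hilbert f^' x) (hilbert f x) (q^' x) (q x) (f^' x).
by move=> *; ring.
Qed.

(** The condition that selects the representative of the gradient in eta. *)
Definition sym0 f : Prop := f x + f (- x) @[x --> +oo] --> (0 : R).

Lemma sym0D f h : sym0 f -> sym0 h -> sym0 (f + h).
Proof.
move=> f0 h0; rewrite /sym0 -(addr0 0).
rewrite (_ : (fun x => _) = fun x => (f x + f (- x)) + (h x + h (- x))).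
  exact: cvgD.
apply/funext => x; change ((f x + h x) + (f (- x) + h (- x)) = (f x + f (- x)) + (h x + h (- x))).
by ring.
Qed.

Lemma sym0Z c f : sym0 f -> sym0 (c *: f).
Proof.
move=> f0; rewrite /sym0 -(mulr0 c).
rewrite (_ : (fun x => _) = fun x => c * (f x + f (- x))); last first.
  by apply/funext => x; rewrite mulrDr.
by apply: cvgM => //; exact: cvg_cst.
Qed.

Lemma sym0N f : sym0 f -> sym0 (- f).
Proof. by rewrite -scaleN1r; exact: sym0Z. Qed.

Lemma sym0_decay f : decay 1 f -> sym0 f.
Proof. by move=> /decay_cvg0[h1 h2]; rewrite /sym0 -(addr0 0); exact: (cvgD h1 h2). Qed.

Lemma eta_space_rapid f : eta_space f -> rapid f /\ intR f = 0.
Proof.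
move=> [/schwartz_rapid rf f0 _]; split => //; move: f0.
rewrite fourierE; last exact: rapid_integrableR.
move=> /(congr1 (@complex.Re R)) /= /eqP; rewrite mulf_eq0 cosft0 => /orP[|/eqP//].
by rewrite invr_eq0 sqrtr_eq0 leNgt mulr_gt0 ?pi_gt0.
Qed.

End FirstVariation.

(** * The density of the Hamiltonian and its first variations *)

Section Density.
Variable R : realType.
Implicit Types (g gamma : R).

(** The pointwise density of K3 as a function of the values at one point of the
    fields and of their images: n, dn for eta and its derivative, p for d^-1 eta,
    E, dE for H(eta) and its derivative, P for H(p), and z, Z, Z1 for zeta, H(zeta)
    and the derivative of H(zeta).  Separating the values from the operators makes
    the algebra below a matter of polynomial identities. *)
Definition density g gamma (n dn p E dE P z Z Z1 : R) : R :=
  2^-1 * (E ^+ 2 * Z1)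
  - gamma / (4 * g) * (g * (n ^+ 2 * E) - z ^+ 2 * dn + 2 * (z * E * Z1))
  - gamma ^+ 2 / (4 * g ^+ 2) *
      (g * (p * dn * z) + g * (n * E * Z) - g * (E * Z1 * p) - 2^-1 * (z ^+ 2 * Z1))
  - gamma ^+ 3 / (16 * g ^+ 2) *
      (z ^+ 2 * E + 2 * (z * Z1 * p) - (2 * g) * (p * dE * P))
  - gamma ^+ 4 / (16 * g ^+ 2) * ((n * Z - E * z) * p)
  - gamma ^+ 5 / (64 * g ^+ 2) * (E * p ^+ 2).

(** The first variation in z, with y, Y, Y1 the variations of z, Z, Z1. *)
Definition density_zeta g gamma (n dn p E dE P z Z Z1 y Y Y1 : R) : R :=
  2^-1 * (E ^+ 2 * Y1)
  - gamma / (4 * g) * (2 * (y * E * Z1 + z * E * Y1) - 2 * z * y * dn)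
  - gamma ^+ 2 / (4 * g ^+ 2) *
      (g * (p * dn * y) + g * (n * E * Y) - g * (E * Y1 * p)
       - 2^-1 * (2 * z * y * Z1 + z ^+ 2 * Y1))
  - gamma ^+ 3 / (16 * g ^+ 2) * (2 * z * y * E + 2 * (y * Z1 * p + z * Y1 * p))
  - gamma ^+ 4 / (16 * g ^+ 2) * ((n * Y - E * y) * p).

Lemma density_expand_zeta g gamma (n dn p E dE P z Z Z1 y Y Y1 : R) :
  exists k : R * R * R, forall e,
  density g gamma n dn p E dE P (z + e * y) (Z + e * Y) (Z1 + e * Y1) =
  k.1.1 + e * density_zeta g gamma n dn p E dE P z Z Z1 y Y Y1 + e ^+ 2 * k.1.2 + e ^+ 3 * k.2.
Proof.
exists (density g gamma n dn p E dE P z Z Z1,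
  - (gamma / (4 * g)) * (2 * (y * E * Y1) - y ^+ 2 * dn)
     + gamma ^+ 2 / (4 * g ^+ 2) * (2^-1 * (y ^+ 2 * Z1 + 2 * z * y * Y1))
     - gamma ^+ 3 / (16 * g ^+ 2) * (y ^+ 2 * E + 2 * (y * Y1 * p)),
  gamma ^+ 2 / (4 * g ^+ 2) * (2^-1 * (y ^+ 2 * Y1))) => e /=.
by rewrite /density /density_zeta; ring.
Qed.

(** The first variation in eta, with f, df, q, X, X1, Q the variations of n, dn, p,
    E, dE, P. *)
Definition density_eta g gamma (n dn p E dE P z Z Z1 f df q X X1 Q : R) : R :=
  2^-1 * (2 * E * X * Z1)
  - gamma / (4 * g) * (g * (2 * n * f * E + n ^+ 2 * X) - z ^+ 2 * df + 2 * (z * X * Z1))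
  - gamma ^+ 2 / (4 * g ^+ 2) *
      (g * ((q * dn + p * df) * z) + g * ((f * E + n * X) * Z) - g * ((X * p + E * q) * Z1))
  - gamma ^+ 3 / (16 * g ^+ 2) *
      (z ^+ 2 * X + 2 * (z * Z1 * q) - (2 * g) * (q * dE * P + p * X1 * P + p * dE * Q))
  - gamma ^+ 4 / (16 * g ^+ 2) * ((f * Z - X * z) * p + (n * Z - E * z) * q)
  - gamma ^+ 5 / (64 * g ^+ 2) * (X * p ^+ 2 + 2 * E * p * q).

Lemma density_expand_eta g gamma (n dn p E dE P z Z Z1 f df q X X1 Q : R) :
  exists k : R * R * R, forall e,
  density g gamma (n + e * f) (dn + e * df) (p + e * q) (E + e * X) (dE + e * X1)
    (P + e * Q) z Z Z1 =
  k.1.1 + e * density_eta g gamma n dn p E dE P z Z Z1 f df q X X1 Q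
  + e ^+ 2 * k.1.2 + e ^+ 3 * k.2.
Proof.
exists (density g gamma n dn p E dE P z Z Z1,
  2^-1 * (X ^+ 2 * Z1)
     - gamma / (4 * g) * (g * (f ^+ 2 * E + 2 * n * f * X))
     - gamma ^+ 2 / (4 * g ^+ 2) * (g * (q * df * z) + g * (f * X * Z) - g * (X * Z1 * q))
     + gamma ^+ 3 / (16 * g ^+ 2) * ((2 * g) * (q * X1 * P + q * dE * Q + p * X1 * Q))
     - gamma ^+ 4 / (16 * g ^+ 2) * ((f * Z - X * z) * q)
     - gamma ^+ 5 / (64 * g ^+ 2) * (2 * X * p * q + E * q ^+ 2),
  - (gamma / (4 * g)) * (g * (f ^+ 2 * X))
     + gamma ^+ 3 / (16 * g ^+ 2) * ((2 * g) * (q * X1 * Q))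
     - gamma ^+ 5 / (64 * g ^+ 2) * (X * q ^+ 2)) => e /=.
by rewrite /density /density_eta; ring.
Qed.

(** The first factor on the right is the gradient in zeta, in which the letters h and
    a stand for the values of the Hilbert transforms and of |D|.  Each further line
    has zero integral when these letters are given that meaning. *)
Lemma density_zeta_adjoint g gamma (n dn p E dE P z Z Z1 y Y Y1 h1 a1 a2 h2 a3 a4 h3 : R) :
  g != 0 ->
  density_zeta g gamma n dn p E dE P z Z Z1 y Y Y1 =
  (2^-1 * h1 + gamma / (2 * g) * (z * dn - E * Z1 - a1)
   + gamma ^+ 2 / (4 * g ^+ 2) * (z * Z1 + 2^-1 * a2)
   + gamma ^+ 2 / (4 * g) * (- (p * dn) + h2 + a3)
   - gamma ^+ 3 / (8 * g ^+ 2) * (z * E + Z1 * p + a4)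
   + gamma ^+ 4 / (16 * g ^+ 2) * (h3 + E * p)) * y
  + (2^-1 * (Y1 * E ^+ 2 - y * h1)
     + (- (gamma / (2 * g))) * (Y1 * (z * E) - y * a1)
     + (- (gamma ^+ 2 / (4 * g))) * (Y * (n * E) + y * h2)
     + gamma ^+ 2 / (4 * g) * (Y1 * (E * p) - y * a3)
     + gamma ^+ 2 / (8 * g ^+ 2) * (Y1 * z ^+ 2 - y * a2)
     + (- (gamma ^+ 3 / (8 * g ^+ 2))) * (Y1 * (z * p) - y * a4)
     + (- (gamma ^+ 4 / (16 * g ^+ 2))) * (Y * (n * p) + y * h3)).
Proof. by move=> g0; rewrite /density_zeta; field. Qed.

(** Likewise for eta, with i standing for the inverse derivatives and s for |D|^-1. *)
Lemma density_eta_adjoint g gamma (n dn p E dE P z dz Z Z1 f df q X X1 Q : R)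
  (h1 h2 h3 i1 h4 h5 i2 i3 a1 s h6 i4 h7 i5 i6 h8 i7 : R) : g != 0 ->
  density_eta g gamma n dn p E dE P z Z Z1 f df q X X1 Q =
  - (h1 + gamma / 2 * (n * E - 2^-1 * h2) + gamma / (2 * g) * (z * dz - h3)
     - gamma ^+ 2 / (4 * g) * (dz * p + z * n + i1 - Z * E + h4 - h5 - i2)
     + gamma ^+ 3 / (8 * g) * (i3 - a1 + s)
     - gamma ^+ 3 / (16 * g ^+ 2) * (h6 + 2 * i4)
     + gamma ^+ 4 / (16 * g ^+ 2) * (Z * p - i5 + h7 + i6)
     - gamma ^+ 5 / (64 * g ^+ 2) * (h8 + 2 * i7)) * f
  + (1 * (X * (E * Z1) + f * h1)
     + (- (gamma / 4)) * (X * n ^+ 2 + f * h2)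
     + (- (gamma / (2 * g))) * (X * (z * Z1) + f * h3)
     + (- (gamma ^+ 2 / (4 * g))) * (X * (n * Z) + f * h4)
     + gamma ^+ 2 / (4 * g) * (X * (Z1 * p) + f * h5)
     + (- (gamma ^+ 3 / (16 * g ^+ 2))) * (X * z ^+ 2 + f * h6)
     + gamma ^+ 4 / (16 * g ^+ 2) * (X * (z * p) + f * h7)
     + (- (gamma ^+ 5 / (64 * g ^+ 2))) * (X * p ^+ 2 + f * h8)
     + gamma / (4 * g) * (df * (z * z) + f * (dz * z + z * dz))
     + (- (gamma ^+ 2 / (4 * g))) * (df * (z * p) + f * (dz * p + z * n))
     + (- (gamma ^+ 2 / (4 * g))) * (f * i1 + q * (z * dn))
     + gamma ^+ 2 / (4 * g) * (f * i2 + q * (Z1 * E))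
     + (- (gamma ^+ 3 / (8 * g ^+ 2))) * (f * i4 + q * (z * Z1))
     + gamma ^+ 3 / (8 * g) * (f * i3 + q * (dE * P))
     + (- (gamma ^+ 4 / (16 * g ^+ 2))) * (f * i5 + q * (n * Z))
     + gamma ^+ 4 / (16 * g ^+ 2) * (f * i6 + q * (z * E))
     + (- (gamma ^+ 5 / (32 * g ^+ 2))) * (f * i7 + q * (E * p))
     + gamma ^+ 3 / (8 * g) * (X1 * (p * P) - f * a1)
     + gamma ^+ 3 / (8 * g) * (Q * (dE * p) + f * s)).
Proof. by move=> g0; rewrite /density_eta; field. Qed.

End Density.

(** * The Hamiltonian on a line *)

Ltac decsolve :=
  match goal with
  | |- dec _ (_ + _) => apply: decD; decsolve
  | |- dec _ (- _) => apply: decN; decsolve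
  | |- dec _ (_ *: _) => apply: decZ; decsolve
  | |- dec _ (_ ^+ 2) => apply: dec_sqr; decsolve
  | H : rapid ?f |- dec _ ?f => exact (H _)
  | H : dec _ ?f |- dec _ ?f => solve [apply: decS H; done]
  | |- dec _ (_ * _) => first [apply: decMl; decsolve | apply: decMr; decsolve]
  | |- dec 0 (hilbert _) => apply: dec_hilbert; decsolve
  | |- dec 0 (dxinv _) => apply: dec_dxinv; decsolve
  | |- dec _ (derive1 _) => apply: dec_derive1; decsolve
  end.

Section HamiltonianDensity.
Variables (R : realType) (g gamma : R).
Implicit Types (p z f h q : R -> R) (e x : R).

(** The density once more, on functions: K3 is its integral by mere unfolding, and
    its decay follows factor by factor. *)
Definition density_fun (n dn p E dE P z Z Z1 : R -> R) : R -> R :=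
  2^-1 *: (E ^+ 2 * Z1)
  - (gamma / (4 * g)) *: (g *: (n ^+ 2 * E) - z ^+ 2 * dn + 2 *: (z * E * Z1))
  - (gamma ^+ 2 / (4 * g ^+ 2)) *:
      (g *: (p * dn * z) + g *: (n * E * Z) - g *: (E * Z1 * p)
       - 2^-1 *: (z ^+ 2 * Z1))
  - (gamma ^+ 3 / (16 * g ^+ 2)) *:
      (z ^+ 2 * E + 2 *: (z * Z1 * p) - (2 * g) *: (p * dE * P))
  - (gamma ^+ 4 / (16 * g ^+ 2)) *: ((n * Z - E * z) * p)
  - (gamma ^+ 5 / (64 * g ^+ 2)) *: (E * p ^+ 2).

Definition density_at p z : R -> R :=
  density_fun p^' p^'^' p (hilbert p^') (hilbert p^'^') (hilbert p) z (hilbert z) (hilbert z^').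

Lemma density_atE p z x : density_at p z x =
  density g gamma (p^' x) (p^'^' x) (p x) (hilbert p^' x) (hilbert p^'^' x)
    (hilbert p x) (z x) (hilbert z x) (hilbert z^' x).
Proof. by []. Qed.

Lemma K3_density_fun eta z : K3 g gamma eta z = intR (density_fun eta eta^' (dxinv eta)
  (hilbert eta) (hilbert eta)^' (dxinv (hilbert eta)) z (hilbert z) (hilbert z)^').
Proof. by []. Qed.

(** As all admissible eta are derivatives, K3 is best seen as a function of a
    primitive p of eta; its nonlocal factors are then Hilbert transforms of p, p' and
    p''. *)
Lemma K3E p z : rapid p -> rapid z -> K3 g gamma p^' z = intR (density_at p z).
Proof.
move=> rp rz; have rp' := rapid_derive1 rp; rewrite K3_density_fun /density_at.
have E1 : (hilbert z)^' = hilbert z^' by apply: derive1_hilbert; exact: rz.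
have E2 : (hilbert p^')^' = hilbert p^'^' by apply: derive1_hilbert; exact: rp'.
have E3 : dxinv (hilbert p^') = hilbert p by exact: dxinv_hilbert_derive1.
have E4 : dxinv p^' = p by apply: dxinv_derive1; exact: rp.
move: (hilbert p^') (dxinv p^') E1 E2 E3 E4 => E q.
move: (E^') (dxinv E) ((hilbert z)^') => E' q' Z'.
by move=> -> -> -> ->.
Qed.

Lemma dec_density_fun n dn p E dE P z Z Z1 : rapid n -> rapid dn -> rapid p ->
  dec 2 E -> dec 3 dE -> dec 1 P -> rapid z -> dec 1 Z -> dec 2 Z1 ->
  dec 2 (density_fun n dn p E dE P z Z Z1).
Proof. by move=> *; rewrite /density_fun; decsolve. Qed.

Lemma integrableR_density_at p z : rapid p -> rapid z -> integrableR (density_at p z).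
Proof.
move=> rp rz; have rp' := rapid_derive1 rp; have rp'' := rapid_derive1 rp'.
apply: dec_integrableR; apply: dec_density_fun => //.
- exact: dec_hilbert2.
- exact: dec_hilbert3.
- exact: dec_hilbert1.
- exact: dec_hilbert1.
- exact: dec_hilbert2.
Qed.

Lemma hilbert_line f h e x : rapid f -> rapid h ->
  hilbert (f + e *: h) x = hilbert f x + e * hilbert h x.
Proof.
by move=> rf rh; rewrite hilbertD ?hilbertZ//; apply: decZ; exact: rh.
Qed.

Lemma derive1_line f h e : rapid f -> rapid h ->
  (f + e *: h)^' = f^' + e *: h^'.
Proof.
move=> rf rh; rewrite derive1D; [|exact: dec_derivable (rf 0%N)|exact: dec_derivable (rapidZ e rh 0%N)].
by rewrite (derive1Z _ (rh 0%N)).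
Qed.

Lemma density_at_line_zeta p z h e x : rapid z -> rapid h ->
  density_at p (z + e *: h) x =
  density g gamma (p^' x) (p^'^' x) (p x) (hilbert p^' x) (hilbert p^'^' x)
    (hilbert p x) (z x + e * h x) (hilbert z x + e * hilbert h x)
    (hilbert z^' x + e * hilbert h^' x).
Proof.
move=> rz rh; rewrite density_atE derive1_line// !hilbert_line//; exact: rapid_derive1.
Qed.

Lemma density_at_line_eta p q z e x : rapid p -> rapid q ->
  density_at (p + e *: q) z x =
  density g gamma (p^' x + e * q^' x) (p^'^' x + e * q^'^' x) (p x + e * q x)
    (hilbert p^' x + e * hilbert q^' x) (hilbert p^'^' x + e * hilbert q^'^' x)
    (hilbert p x + e * hilbert q x) (z x) (hilbert z x) (hilbert z^' x).
Proof.
move=> rp rq; have rp' := rapid_derive1 rp; have rq' := rapid_derive1 rq.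
rewrite density_atE !derive1_line// !hilbert_line//; exact: rapid_derive1.
Qed.

End HamiltonianDensity.

(** * The gradient in zeta *)

Section Variations.
Variables (R : realType) (g gamma : R).
Hypothesis g_neq0 : g != 0.
Implicit Types (p z f h q y : R -> R) (e x : R).

(** The gradient in zeta with its nonlocal terms as parameters; it is instantiated in
    zeta_variation. *)
Definition zeta_gradient (dn E Z1 p z h1 a1 a2 h2 a3 a4 h3 : R -> R) : R -> R :=
  2^-1 *: h1
  + (gamma / (2 * g)) *: (z * dn - E * Z1 - a1)
  + (gamma ^+ 2 / (4 * g ^+ 2)) *: (z * Z1 + 2^-1 *: a2)
  + (gamma ^+ 2 / (4 * g)) *: (- (p * dn) + h2 + a3)
  - (gamma ^+ 3 / (8 * g ^+ 2)) *: (z * E + Z1 * p + a4)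
  + (gamma ^+ 4 / (16 * g ^+ 2)) *: (h3 + E * p).

Lemma intR_density_zeta (n dn p E dE P z Z Z1 y Y Y1 h1 a1 a2 h2 a3 a4 h3 : R -> R) :
  null (Y1 * E ^+ 2 - y * h1) -> null (Y1 * (z * E) - y * a1) ->
  null (Y * (n * E) + y * h2) -> null (Y1 * (E * p) - y * a3) ->
  null (Y1 * z ^+ 2 - y * a2) -> null (Y1 * (z * p) - y * a4) ->
  null (Y * (n * p) + y * h3) ->
  integrableR (zeta_gradient dn E Z1 p z h1 a1 a2 h2 a3 a4 h3 * y) ->
  intR (fun x => density_zeta g gamma (n x) (dn x) (p x) (E x) (dE x) (P x)
    (z x) (Z x) (Z1 x) (y x) (Y x) (Y1 x)) =
  intR (zeta_gradient dn E Z1 p z h1 a1 a2 h2 a3 a4 h3 * y).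
Proof.
move=> n1 n2 n3 n4 n5 n6 n7 sV; apply: (intR_null (h :=
  2^-1 *: (Y1 * E ^+ 2 - y * h1)
     + (- (gamma / (2 * g))) *: (Y1 * (z * E) - y * a1)
     + (- (gamma ^+ 2 / (4 * g))) *: (Y * (n * E) + y * h2)
     + (gamma ^+ 2 / (4 * g)) *: (Y1 * (E * p) - y * a3)
     + (gamma ^+ 2 / (8 * g ^+ 2)) *: (Y1 * z ^+ 2 - y * a2)
     + (- (gamma ^+ 3 / (8 * g ^+ 2))) *: (Y1 * (z * p) - y * a4)
     + (- (gamma ^+ 4 / (16 * g ^+ 2))) *: (Y * (n * p) + y * h3)) sV).
  by do !(apply: nullD; last exact: nullZ); exact: nullZ.
by move=> x; exact: density_zeta_adjoint.
Qed.

Lemma null_absD q f : dec 2 q -> dec 2 f -> null (hilbert q^' * f - q * absD f).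
Proof. by move=> dq df; rewrite absDE//; exact: null_hilbert_derive1. Qed.

Lemma dec_absD f : dec 2 f -> dec 0 (absD f).
Proof. by move=> df; rewrite absDE//; apply: dec_hilbert; exact: dec_derive1. Qed.

Lemma dec_zeta_gradient (dn E Z1 p z h1 a1 a2 h2 a3 a4 h3 : R -> R) :
  dec 0 dn -> dec 0 E -> dec 0 Z1 -> dec 0 p -> dec 0 z -> dec 0 h1 -> dec 0 a1 ->
  dec 0 a2 -> dec 0 h2 -> dec 0 a3 -> dec 0 a4 -> dec 0 h3 ->
  dec 0 (zeta_gradient dn E Z1 p z h1 a1 a2 h2 a3 a4 h3).
Proof. by move=> *; rewrite /zeta_gradient; decsolve. Qed.

Lemma zeta_variation p z : rapid p -> rapid z ->
  let E := hilbert p^' in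
  is_variational_derivative (@zeta_space R) (fun h => K3 g gamma p^' h) z
    (zeta_gradient p^'^' E (hilbert z^') p z
       (hilbert (E ^+ 2)^') (absD (z * E)) (absD (z ^+ 2)) (hilbert (p^' * E))
       (absD (E * p)) (absD (z * p)) (hilbert (p^' * p))).
Proof.
move=> rp rz E; have rp' := rapid_derive1 rp; have rp'' := rapid_derive1 rp'.
have rz' := rapid_derive1 rz.
have dE : dec 2 E by exact: dec_hilbert2.
have dZ1 : dec 2 (hilbert z^') by exact: dec_hilbert2.
have dE2 : dec 2 (E ^+ 2) by exact: dec_sqr.
have E0 : dec 0 E by exact: (decS (leq0n _) dE).
have Z10 : dec 0 (hilbert z^') by exact: (decS (leq0n _) dZ1).
have rzE : rapid (z * E) by exact: (rapidMl rz E0).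
have rz2 : rapid (z ^+ 2) by exact: rapid_sqr.
have rnE : rapid (p^' * E) by exact: (rapidMl rp' E0).
have rEp : rapid (E * p) by exact: (rapidMr E0 rp).
have rzp : rapid (z * p) by exact: (rapidMl rz (rp 0%N)).
have rnp : rapid (p^' * p) by exact: (rapidMl rp' (rp 0%N)).
set V := zeta_gradient _ _ _ _ _ _ _ _ _ _ _ _.
have dV : dec 0 V.
  exact: (dec_zeta_gradient (rp'' 0%N) E0 Z10 (rp 0%N) (rz 0%N)
    (dec_hilbert (dec_derive1 dE2)) (dec_absD (rzE 2%N)) (dec_absD (rz2 2%N))
    (dec_hilbert (rnE 2%N)) (dec_absD (rEp 2%N)) (dec_absD (rzp 2%N))
    (dec_hilbert (rnp 2%N))).
split; first exact: dec_continuous dV.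
move=> y /schwartz_rapid ry.
have sV := rapid_integrableR (rapidMr dV ry); split; first exact: sV.
have JE : (fun e => K3 g gamma p^' (z + e *: y)) = fun e => intR (density_at g gamma p (z + e *: y)).
  by apply/funext => e; apply: K3E => //; apply: rapidD => //; exact: rapidZ.
change (is_derive (0 : R) (1 : R) (fun e => K3 g gamma p^' (z + e *: y)) (intR (V * y))).
rewrite JE.
have ry' := rapid_derive1 ry.
have := @intR_density_zeta p^' p^'^' p E (hilbert p^'^') (hilbert p) z
  (hilbert z) (hilbert z^') y (hilbert y) (hilbert y^') _ _ _ _ _ _ _
  (null_hilbert_derive1 (ry 2%N) dE2) (null_absD (ry 2%N) (rzE 2%N))
  (null_hilbert (ry 2%N) (rnE 2%N)) (null_absD (ry 2%N) (rEp 2%N))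
  (null_absD (ry 2%N) (rz2 2%N)) (null_absD (ry 2%N) (rzp 2%N))
  (null_hilbert (ry 2%N) (rnp 2%N)) sV.
move=> <-; apply: is_derive_cubic.
  by move=> e; apply: integrableR_density_at => //; apply: rapidD => //; exact: rapidZ.
move=> x; have [k kE] := density_expand_zeta g gamma (p^' x) (p^'^' x) (p x) (E x)
  (hilbert p^'^' x) (hilbert p x) (z x) (hilbert z x) (hilbert z^' x)
  (y x) (hilbert y x) (hilbert y^' x).
exists k => e; rewrite density_at_line_zeta//; exact: kE.
Qed.

End Variations.

(** * The gradient in eta *)

Ltac sym0solve :=
  match goal with
  | |- sym0 (_ + _) => apply: sym0D; sym0solve
  | |- sym0 (- _) => apply: sym0N; sym0solve
  | |- sym0 (_ *: _) => apply: sym0Z; sym0solve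
  | _ => assumption
  end.

Section EtaVariation.
Variables (R : realType) (g gamma : R).
Hypothesis g_neq0 : g != 0.
Implicit Types (p z f h q y : R -> R) (e x : R).

(** The opposite of the gradient in eta; d1 stands for the derivative of z p and the
    other letters are as in density_eta_adjoint. *)
Definition eta_gradient
  (n E p z dz Z d1 h1 h2 h3 i1 h4 h5 i2 i3 a1 s h6 i4 h7 i5 i6 h8 i7 : R -> R) : R -> R :=
  h1 + (gamma / 2) *: (n * E - 2^-1 *: h2)
  + (gamma / (2 * g)) *: (z * dz - h3)
  - (gamma ^+ 2 / (4 * g)) *: (d1 + i1 - Z * E + h4 - h5 - i2)
  + (gamma ^+ 3 / (8 * g)) *: (i3 - a1 + s)
  - (gamma ^+ 3 / (16 * g ^+ 2)) *: (h6 + 2 *: i4)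
  + (gamma ^+ 4 / (16 * g ^+ 2)) *: (Z * p - i5 + h7 + i6)
  - (gamma ^+ 5 / (64 * g ^+ 2)) *: (h8 + 2 *: i7).

Lemma intR_density_eta
  (n dn p E dE P z dz Z Z1 f df q X X1 Q
   d1 h1 h2 h3 i1 h4 h5 i2 i3 a1 s h6 i4 h7 i5 i6 h8 i7 : R -> R) :
  d1 = dz * p + z * n ->
  null (X * (E * Z1) + f * h1) -> null (X * n ^+ 2 + f * h2) ->
  null (X * (z * Z1) + f * h3) -> null (X * (n * Z) + f * h4) ->
  null (X * (Z1 * p) + f * h5) -> null (X * z ^+ 2 + f * h6) ->
  null (X * (z * p) + f * h7) -> null (X * p ^+ 2 + f * h8) ->
  null (df * (z * z) + f * (dz * z + z * dz)) ->
  null (df * (z * p) + f * (dz * p + z * n)) ->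
  null (f * i1 + q * (z * dn)) -> null (f * i2 + q * (Z1 * E)) ->
  null (f * i4 + q * (z * Z1)) -> null (f * i3 + q * (dE * P)) ->
  null (f * i5 + q * (n * Z)) -> null (f * i6 + q * (z * E)) ->
  null (f * i7 + q * (E * p)) -> null (X1 * (p * P) - f * a1) ->
  null (Q * (dE * p) + f * s) ->
  integrableR (- eta_gradient n E p z dz Z d1 h1 h2 h3 i1 h4 h5 i2 i3 a1 s h6 i4 h7
    i5 i6 h8 i7 * f) ->
  intR (fun x => density_eta g gamma (n x) (dn x) (p x) (E x) (dE x) (P x)
    (z x) (Z x) (Z1 x) (f x) (df x) (q x) (X x) (X1 x) (Q x)) =
  intR (- eta_gradient n E p z dz Z d1 h1 h2 h3 i1 h4 h5 i2 i3 a1 s h6 i4 h7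
    i5 i6 h8 i7 * f).
Proof.
move=> -> n1 n2 n3 n4 n5 n6 n7 n8 n9 n10 n11 n12 n13 n14 n15 n16 n17 n18 n19 sW.
apply: (intR_null (h :=
  1 *: (X * (E * Z1) + f * h1)
     + (- (gamma / 4)) *: (X * n ^+ 2 + f * h2)
     + (- (gamma / (2 * g))) *: (X * (z * Z1) + f * h3)
     + (- (gamma ^+ 2 / (4 * g))) *: (X * (n * Z) + f * h4)
     + (gamma ^+ 2 / (4 * g)) *: (X * (Z1 * p) + f * h5)
     + (- (gamma ^+ 3 / (16 * g ^+ 2))) *: (X * z ^+ 2 + f * h6)
     + (gamma ^+ 4 / (16 * g ^+ 2)) *: (X * (z * p) + f * h7)
     + (- (gamma ^+ 5 / (64 * g ^+ 2))) *: (X * p ^+ 2 + f * h8)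
     + (gamma / (4 * g)) *: (df * (z * z) + f * (dz * z + z * dz))
     + (- (gamma ^+ 2 / (4 * g))) *: (df * (z * p) + f * (dz * p + z * n))
     + (- (gamma ^+ 2 / (4 * g))) *: (f * i1 + q * (z * dn))
     + (gamma ^+ 2 / (4 * g)) *: (f * i2 + q * (Z1 * E))
     + (- (gamma ^+ 3 / (8 * g ^+ 2))) *: (f * i4 + q * (z * Z1))
     + (gamma ^+ 3 / (8 * g)) *: (f * i3 + q * (dE * P))
     + (- (gamma ^+ 4 / (16 * g ^+ 2))) *: (f * i5 + q * (n * Z))
     + (gamma ^+ 4 / (16 * g ^+ 2)) *: (f * i6 + q * (z * E))
     + (- (gamma ^+ 5 / (32 * g ^+ 2))) *: (f * i7 + q * (E * p))
     + (gamma ^+ 3 / (8 * g)) *: (X1 * (p * P) - f * a1)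
     + (gamma ^+ 3 / (8 * g)) *: (Q * (dE * p) + f * s)) sW).
  by do !(apply: nullD; last exact: nullZ); exact: nullZ.
by move=> x; exact: density_eta_adjoint.
Qed.

Lemma dec_eta_gradient
  (n E p z dz Z d1 h1 h2 h3 i1 h4 h5 i2 i3 a1 s h6 i4 h7 i5 i6 h8 i7 : R -> R) :
  dec 0 n -> dec 0 E -> dec 0 p -> dec 0 z -> dec 0 dz -> dec 0 Z -> dec 0 d1 ->
  dec 0 h1 -> dec 0 h2 -> dec 0 h3 -> dec 0 i1 -> dec 0 h4 -> dec 0 h5 ->
  dec 0 i2 -> dec 0 i3 -> dec 0 a1 -> dec 0 s -> dec 0 h6 -> dec 0 i4 -> dec 0 h7 ->
  dec 0 i5 -> dec 0 i6 -> dec 0 h8 -> dec 0 i7 ->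
  dec 0 (eta_gradient n E p z dz Z d1 h1 h2 h3 i1 h4 h5 i2 i3 a1 s h6 i4 h7 i5 i6 h8 i7).
Proof. by move=> *; rewrite /eta_gradient; decsolve. Qed.

Lemma sym0_eta_gradient
  (n E p z dz Z d1 h1 h2 h3 i1 h4 h5 i2 i3 a1 s h6 i4 h7 i5 i6 h8 i7 : R -> R) :
  sym0 (n * E) -> sym0 (z * dz) -> sym0 (Z * E) -> sym0 (Z * p) -> sym0 d1 ->
  sym0 h1 -> sym0 h2 -> sym0 h3 -> sym0 i1 -> sym0 h4 -> sym0 h5 ->
  sym0 i2 -> sym0 i3 -> sym0 a1 -> sym0 s -> sym0 h6 -> sym0 i4 -> sym0 h7 ->
  sym0 i5 -> sym0 i6 -> sym0 h8 -> sym0 i7 ->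
  sym0 (eta_gradient n E p z dz Z d1 h1 h2 h3 i1 h4 h5 i2 i3 a1 s h6 i4 h7 i5 i6 h8 i7).
Proof.
by move=> *; rewrite /eta_gradient; sym0solve.
Qed.

Lemma sym0_hilbert f : dec 3 f -> sym0 (hilbert f).
Proof. by move=> df; apply: sym0_decay; exact: decay_hilbert1. Qed.

Lemma sym0_rapid f : rapid f -> sym0 f.
Proof. by move=> rf; apply: sym0_decay; exact: dec_decay (rf 1%N). Qed.

Lemma intR_hilbert_self f : dec 2 f -> intR (hilbert f * f) = 0.
Proof.
move=> df; have := intR_hilbertM df df; rewrite [f * _]mulrC => /eqP.
by rewrite -addr_eq0 -mulr2n mulrn_eq0 => /= /eqP.
Qed.


Section Gradient.
Variables p z : R -> R.
Hypotheses (rp : rapid p) (rz : rapid z).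
Let n := p^'.
Let E := hilbert n.
Let dE := hilbert n^'.
Let P := hilbert p.
Let Z := hilbert z.
Let Z1 := hilbert z^'.

Let W : R -> R :=
  eta_gradient n E p z z^' Z (z * p)^' (hilbert (E * Z1)) (hilbert (n ^+ 2))
    (hilbert (z * Z1)) (dxinv (z * n^')) (hilbert (n * Z)) (hilbert (Z1 * p))
    (dxinv (Z1 * E)) (dxinv (dE * P)) (absD (p * P)) (absDinv (dE * p))
    (hilbert (z ^+ 2)) (dxinv (z * Z1)) (hilbert (z * p)) (dxinv (n * Z))
    (dxinv (z * E)) (hilbert (p ^+ 2)) (dxinv (E * p)).

Let rn : rapid n. Proof. exact: rapid_derive1. Qed.
Let rdz : rapid z^'. Proof. exact: rapid_derive1. Qed.
Let dE2 : dec 2 E. Proof. exact: dec_hilbert2. Qed.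
Let dE0 : dec 0 E. Proof. exact: (decS (leq0n _) dE2). Qed.
Let ddE3 : dec 3 dE. Proof. exact: dec_hilbert3. Qed.
Let ddE0 : dec 0 dE. Proof. exact: (decS (leq0n _) ddE3). Qed.
Let dP1 : dec 1 P. Proof. exact: dec_hilbert1. Qed.
Let dP0 : dec 0 P. Proof. exact: (decS (leq0n _) dP1). Qed.
Let dZ1 : dec 1 Z. Proof. exact: dec_hilbert1. Qed.
Let dZ0 : dec 0 Z. Proof. exact: (decS (leq0n _) dZ1). Qed.
Let dZ12 : dec 2 Z1. Proof. exact: dec_hilbert2. Qed.
Let dZ10 : dec 0 Z1. Proof. exact: (decS (leq0n _) dZ12). Qed.

Let dEZ1 : dec 4 (E * Z1). Proof. exact: (decM dE2 dZ12). Qed.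
Let dEZ12 : dec 2 (E * Z1). Proof. exact: (decS (isT : (2 <= 4)%N) dEZ1). Qed.
Let dEZ13 : dec 3 (E * Z1). Proof. exact: (decS (isT : (3 <= 4)%N) dEZ1). Qed.
Let dZE1 : dec 1 (Z * E). Proof. exact: (decS (isT : (1 <= 3)%N) (decM dZ1 dE2)). Qed.
Let dZ1E : dec 4 (Z1 * E). Proof. exact: (decM dZ12 dE2). Qed.
Let ddEP : dec 4 (dE * P). Proof. exact: (decM ddE3 dP1). Qed.
Let rzn' : rapid (z * n^'). Proof. exact: (rapidMl rz (rapid_derive1 rn 0%N)). Qed.
Let rnn : rapid (n ^+ 2). Proof. exact: rapid_sqr. Qed.
Let rzZ1 : rapid (z * Z1). Proof. exact: (rapidMl rz dZ10). Qed.
Let rnZ : rapid (n * Z). Proof. exact: (rapidMl rn dZ0). Qed.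
Let rZ1p : rapid (Z1 * p). Proof. exact: (rapidMr dZ10 rp). Qed.
Let rzz : rapid (z ^+ 2). Proof. exact: rapid_sqr. Qed.
Let rzp : rapid (z * p). Proof. exact: (rapidMl rz (rp 0%N)). Qed.
Let rpp : rapid (p ^+ 2). Proof. exact: rapid_sqr. Qed.
Let rzE : rapid (z * E). Proof. exact: (rapidMl rz dE0). Qed.
Let rEp : rapid (E * p). Proof. exact: (rapidMr dE0 rp). Qed.
Let rpP : rapid (p * P). Proof. exact: (rapidMl rp dP0). Qed.
Let rdEp : rapid (dE * p). Proof. exact: (rapidMr ddE0 rp). Qed.

(** After an integration by parts this is the pairing of H(n) with n, which vanishes
    by antisymmetry.  It gives a meaning to |D|^-1 of this product. *)
Lemma intR_hilbert_derive2M : intR (dE * p) = 0.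
Proof.
have [_] := null_derive1 (rp 2%N) dE0.
have -> : E^' = dE by exact: (derive1_hilbert (rn 2%N)).
rewrite intRD; last 2 first.
- exact: (rapid_integrableR (rapidMl rn dE0)).
- by rewrite mulrC; exact: (rapid_integrableR rdEp).
rewrite [n * E]mulrC (intR_hilbert_self (rn 2%N)) add0r => <-.
by rewrite mulrC.
Qed.

Let s := primitive (dE * p).
Let rs : rapid s. Proof. exact: (rapid_primitive rdEp intR_hilbert_derive2M). Qed.
Let sE : s^' = dE * p. Proof. exact: (derive1_primitive (rdEp 2%N)). Qed.

Lemma absDinv_hilbert_derive2M : absDinv (dE * p) = - hilbert s.
Proof. by rewrite -sE; exact: (absDinv_derive1 (rs 2%N)). Qed.

Lemma dec_eta_gradient_at : dec 0 W.
Proof.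
have ds0 : dec 0 (absDinv (dE * p)).
  by rewrite absDinv_hilbert_derive2M; exact: (decN (dec_hilbert (rs 2%N))).
exact: (dec_eta_gradient (rn 0%N) dE0 (rp 0%N) (rz 0%N) (rdz 0%N) dZ0
  (rapid_derive1 rzp 0%N) (dec_hilbert dEZ12) (dec_hilbert (rnn 2%N))
  (dec_hilbert (rzZ1 2%N)) (dec_dxinv (rzn' 4%N)) (dec_hilbert (rnZ 2%N))
  (dec_hilbert (rZ1p 2%N)) (dec_dxinv dZ1E) (dec_dxinv ddEP) (dec_absD (rpP 2%N)) ds0
  (dec_hilbert (rzz 2%N)) (dec_dxinv (rzZ1 4%N)) (dec_hilbert (rzp 2%N))
  (dec_dxinv (rnZ 4%N)) (dec_dxinv (rzE 4%N)) (dec_hilbert (rpp 2%N))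
  (dec_dxinv (rEp 4%N))).
Qed.

Lemma sym0_eta_gradient_at : sym0 W.
Proof.
have sa : sym0 (absD (p * P)).
  by rewrite (absDE (rpP 2%N)); exact: (sym0_hilbert (rapid_derive1 rpP 3%N)).
have ss : sym0 (absDinv (dE * p)).
  by rewrite absDinv_hilbert_derive2M; exact: (sym0N (sym0_hilbert (rs 3%N))).
exact: (sym0_eta_gradient (sym0_rapid (rapidMl rn dE0)) (sym0_rapid (rapidMl rz (rdz 0%N)))
  (sym0_decay (dec_decay dZE1)) (sym0_rapid (rapidMr dZ0 rp))
  (sym0_rapid (rapid_derive1 rzp)) (sym0_hilbert dEZ13) (sym0_hilbert (rnn 3%N))
  (sym0_hilbert (rzZ1 3%N)) (dxinv_sym_cvg0 (rzn' 4%N)) (sym0_hilbert (rnZ 3%N))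
  (sym0_hilbert (rZ1p 3%N)) (dxinv_sym_cvg0 dZ1E) (dxinv_sym_cvg0 ddEP) sa ss
  (sym0_hilbert (rzz 3%N)) (dxinv_sym_cvg0 (rzZ1 4%N)) (sym0_hilbert (rzp 3%N))
  (dxinv_sym_cvg0 (rnZ 4%N)) (dxinv_sym_cvg0 (rzE 4%N)) (sym0_hilbert (rpp 3%N))
  (dxinv_sym_cvg0 (rEp 4%N))).
Qed.

(** An admissible variation is the derivative of a rapidly decreasing q, along which
    p moves. *)
Lemma eta_variation :
  is_variational_derivative (@eta_space R) (fun h => K3 g gamma h z) p^' (- W).
Proof.
split; first exact: (dec_continuous (decN dec_eta_gradient_at)).
move=> f /eta_space_rapid[rf f0].
pose q := primitive f.
have rq : rapid q by exact: (rapid_primitive rf f0).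
have fE : f = q^' by exact: (esym (derive1_primitive (rf 2%N))).
have sW : integrableR (- W * f) by exact: (rapid_integrableR (rapidMr (decN dec_eta_gradient_at) rf)).
split; first exact: sW.
have JE : (fun e => K3 g gamma (p^' + e *: f) z) = fun e => intR (density_at g gamma (p + e *: q) z).
  apply/funext => e; rewrite fE -(derive1_line e rp rq).
  by apply: K3E => //; apply: rapidD => //; exact: rapidZ.
change (is_derive (0 : R) (1 : R) (fun e => K3 g gamma (p^' + e *: f) z) (intR (- W * f))).
rewrite JE.
have rf' := rapid_derive1 rf.
have n9 : null (f^' * (z * z) + f * (z^' * z + z * z^')).
  rewrite -derive1M; [|exact: (dec_derivable (rz 0%N))|exact: (dec_derivable (rz 0%N))].
  exact: (null_derive1 (rf 2%N) (rapidMl rz (rz 0%N) 0%N)).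
have d1E : (z * p)^' = z^' * p + z * n.
  by apply: derive1M; [exact: (dec_derivable (rz 0%N))|exact: (dec_derivable (rp 0%N))].
have n10 : null (f^' * (z * p) + f * (z^' * p + z * n)).
  by rewrite -d1E; exact: (null_derive1 (rf 2%N) (rzp 0%N)).
have ndx h : dec 4 h -> null (f * dxinv h + q * h).
  by move=> dh; rewrite fE; exact: (null_dxinv (rq 2%N) dh).
have n19 : null (hilbert q * (dE * p) + f * absDinv (dE * p)).
  by rewrite fE; exact: (null_absDinv (rq 2%N) (rs 2%N) sE).
have := @intR_density_eta n n^' p E dE P z z^' Z Z1 f f^' q (hilbert f)
  (hilbert f^') (hilbert q) _ _ _ _ _ _ _ _ _ _ _ _ _ _ _ _ _ _ d1E
  (null_hilbert (rf 2%N) dEZ12)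
  (null_hilbert (rf 2%N) (rnn 2%N)) (null_hilbert (rf 2%N) (rzZ1 2%N))
  (null_hilbert (rf 2%N) (rnZ 2%N)) (null_hilbert (rf 2%N) (rZ1p 2%N))
  (null_hilbert (rf 2%N) (rzz 2%N)) (null_hilbert (rf 2%N) (rzp 2%N))
  (null_hilbert (rf 2%N) (rpp 2%N)) n9 n10 (ndx _ (rzn' 4%N)) (ndx _ dZ1E)
  (ndx _ (rzZ1 4%N)) (ndx _ ddEP) (ndx _ (rnZ 4%N)) (ndx _ (rzE 4%N)) (ndx _ (rEp 4%N))
  (null_absD (rf 2%N) (rpP 2%N)) n19 sW.
move=> <-; apply: is_derive_cubic.
  by move=> e; apply: integrableR_density_at => //; apply: rapidD => //; exact: rapidZ.
move=> x; have [k kE] := density_expand_eta g gamma (n x) (n^' x) (p x) (E x)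
  (dE x) (P x) (z x) (Z x) (Z1 x)
  (f x) (f^' x) (q x) (hilbert f x) (hilbert f^' x) (hilbert q x).
exists k => e; rewrite (density_at_line_eta _ _ _ _ _ rp rq) -fE; exact: kE.
Qed.

End Gradient.

End EtaVariation.

(** * The Hamiltonian system *)

Theorem proposition3p3 (R : realType) (g gamma : R) (eta zeta : R -> R)
  (g_gt0 : 0 < g) (eta_adm : eta_space eta) (zeta_adm : zeta_space zeta) :
  let eta' := hilbert eta in
  let zeta' := hilbert zeta in
  is_hamiltonian_vector_field (K3 g gamma) eta zeta
    (* d_s eta *)
    (2^-1 *: hilbert (dx (eta' ^+ 2))
     + (gamma / (2 * g)) *:
         (zeta * dx eta - eta' * dx zeta' - absD (zeta * eta'))
     + (gamma ^+ 2 / (4 * g ^+ 2)) *: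
         (zeta * dx zeta' + 2^-1 *: absD (zeta ^+ 2))
     + (gamma ^+ 2 / (4 * g)) *:
         (- (dxinv eta * dx eta) + hilbert (eta * eta')
          + absD (eta' * dxinv eta))
     - (gamma ^+ 3 / (8 * g ^+ 2)) *:
         (zeta * eta' + dx zeta' * dxinv eta + absD (zeta * dxinv eta))
     + (gamma ^+ 4 / (16 * g ^+ 2)) *:
         (hilbert (eta * dxinv eta) + eta' * dxinv eta))
    (* d_s zeta *)
    (hilbert (eta' * dx zeta')
     + (gamma / 2) *: (eta * eta' - 2^-1 *: hilbert (eta ^+ 2))
     + (gamma / (2 * g)) *: (zeta * dx zeta - hilbert (zeta * dx zeta'))
     - (gamma ^+ 2 / (4 * g)) *:
         (dx (zeta * dxinv eta) + dxinv (zeta * dx eta) - zeta' * eta'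
          + hilbert (eta * zeta') - hilbert (dx zeta' * dxinv eta)
          - dxinv (dx zeta' * eta'))
     + (gamma ^+ 3 / (8 * g)) *:
         (dxinv (dx eta' * dxinv eta') - absD (dxinv eta * dxinv eta')
          + absDinv (dx eta' * dxinv eta))
     - (gamma ^+ 3 / (16 * g ^+ 2)) *:
         (hilbert (zeta ^+ 2) + 2 *: dxinv (zeta * dx zeta'))
     + (gamma ^+ 4 / (16 * g ^+ 2)) *:
         (zeta' * dxinv eta - dxinv (eta * zeta')
          + hilbert (zeta * dxinv eta) + dxinv (zeta * eta'))
     - (gamma ^+ 5 / (64 * g ^+ 2)) *:
         (hilbert (dxinv eta ^+ 2) + 2 *: dxinv (eta' * dxinv eta))).
Proof.
move=> eta' zeta'; rewrite /eta' /zeta' => {eta' zeta'}.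
have rz : rapid zeta by exact: schwartz_rapid.
(* The zero mean of eta makes it the derivative of a rapidly decreasing function. *)
have [p rp etaE] : exists2 p, rapid p & eta = p^'.
  have [re e0] := eta_space_rapid eta_adm; exists (primitive eta).
    exact: rapid_primitive.
  exact: (esym (derive1_primitive (re 2%N))).
subst eta; have rp' := rapid_derive1 rp.
have g_neq0 : g != 0 by rewrite gt_eqF.
have aux (q E Z1 dE P : R -> R) : q = p -> E = hilbert p^' -> Z1 = hilbert zeta^' ->
    dE = hilbert p^'^' -> P = hilbert p ->
  is_hamiltonian_vector_field (K3 g gamma) p^' zeta
    (zeta_gradient g gamma p^'^' E Z1 q zeta
       (hilbert (E ^+ 2)^') (absD (zeta * E)) (absD (zeta ^+ 2)) (hilbert (p^' * E))
       (absD (E * q)) (absD (zeta * q)) (hilbert (p^' * q)))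
    (eta_gradient g gamma p^' E q zeta zeta^' (hilbert zeta) (zeta * q)^'
       (hilbert (E * Z1)) (hilbert (p^' ^+ 2)) (hilbert (zeta * Z1))
       (dxinv (zeta * p^'^')) (hilbert (p^' * hilbert zeta)) (hilbert (Z1 * q))
       (dxinv (Z1 * E)) (dxinv (dE * P)) (absD (q * P)) (absDinv (dE * q))
       (hilbert (zeta ^+ 2)) (dxinv (zeta * Z1)) (hilbert (zeta * q))
       (dxinv (p^' * hilbert zeta)) (dxinv (zeta * E)) (hilbert (q ^+ 2))
       (dxinv (E * q))).
  move=> -> -> -> -> ->; split.
  - exact: (zeta_variation gamma g_neq0 rp rz).
  - exact: (eta_variation gamma g_neq0 rp rz).
  - exact: (sym0_eta_gradient_at g gamma rp rz).
exact: (aux _ _ _ _ _ (dxinv_derive1 (rp 2%N)) erefl (derive1_hilbert (rz 2%N))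
  (derive1_hilbert (rp' 2%N)) (dxinv_hilbert_derive1 rp)).
Qed.
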